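(* Let $m\ge0$ and $\tau_d\in(0,\tau]$. Let $\mu_n\in\mathcal M_+([0,\tau])$ ($n\in\mathbb N$) be absolutely continuous with respect to Lebesgue measure and assume that $\mu_n\rightharpoonup m\delta_{\tau_d}$ narrowly as $n\to\infty$, where $\delta_{\tau_d}$ is the unit Dirac measure at $\tau_d$. Then the corresponding weak solutions of the delay problem with common data $u_0\in H$, $f\in L^2(0,T;V^* )$, $\psi\in L^2(-\tau,0;V)$ satisfy $$u_{\mu_n}\longrightarrow u_{m\delta_{\tau_d}}\quad\text{in }\mathcal W(0,T)\cap\mathcal C([0,T];H).$$
   Context: Fix real numbers $T>0$ and $\tau>0$. $V,H$ are real separable Hilbert spaces with $V\hookrightarrow H$ continuously and densely; $H$ is identified with its dual, giving the Gelfand triple $V\hookrightarrow H\cong H^*\hookrightarrow V^*$, and $\langle\cdot,\cdot\rangle$ is the duality pairing between $V^*$ and $V$. $a_0,a_1:V\times V\to\mathbb R$ are bilinear forms and $\Lambda_0,\Lambda_1,\alpha_0>0$ are constants with $|a_i(w,v)|\le\Lambda_i\|w\|_V\|v\|_V$ for all $w,v\in V$, $i\in\{0,1\}$, and $a_0(v,v)\ge\alpha_0\|v\|_V^2$ for all $v\in V$. The operators $A_i\in\mathcal L(V,V^* )$ are given by $\langle A_iw,v\rangle=a_i(w,v)$. $\mathcal M_+([0,\tau])$ is the set of finite non-negative Borel measures on $[0,\tau]$. Narrow convergence $\mu_n\rightharpoonup\mu$ means $\int\varphi\,d\mu_n\to\int\varphi\,d\mu$ for every $\varphi\in\mathcal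 C([0,\tau])$. For a finite Borel measure $\sigma$ on $[0,\tau]$ and $g\in L^2(-\tau,T;V)$, $\mathcal K_\sigma g\in L^2(0,T;V^* )$ is defined by $(\mathcal K_\sigma g)(t)=\int_{[0,\tau]}A_1g(t-s)\,d\sigma(s)$ for a.e. $t\in(0,T)$ (Bochner integral, using any Borel strongly measurable representative of $g$; the resulting element of $L^2(0,T;V^* )$ does not depend on the representative). $\mathcal W(0,T)=\{u\in L^2(0,T;V):\partial_tu\in L^2(0,T;V^* )\}$ with norm $\|u\|_{\mathcal W(0,T)}=\bigl(\|u\|_{L^2(0,T;V)}^2+\|\partial_tu\|_{L^2(0,T;V^* )}^2\bigr)^{1/2}$; it embeds into $\mathcal C([0,T];H)$, and pointwise values refer to the $H$-continuous representative. For $u:(0,T)\to V$ the joined trajectory is $\tilde u(t)=\psi(t)$ for $-\tau<t<0$ and $\tilde u(t)=u(t)$ for $0<t<T$. For a finite non-negative Borel measure $\mu$ on $[0,\tau]$ with $\mu(\{0\})=0$, the weak solution $u_\mu$ of the delay problem with kernel $\mu$ and data $(u_0,f,\psi)$ is the (unique) $u\in\mathcal W(0,T)$ with $u(0)=u_0$ in $H$ and $\partial_tu(t)+A_0u(t)+(\mathcal K_\mu\tilde u)(t)=f(t)$ in $V^*$ for a.e. $t\in(0,T)$. *)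

(* Defs.v *)
From HB Require Import structures.
From mathcomp Require Import all_boot all_order all_algebra.
From mathcomp Require Import all_classical all_reals all_analysis.
From mathcomp Require Import ring lra.

Set Implicit Arguments.
Unset Strict Implicit.
Unset Printing Implicit Defensive.

Import Order.TTheory GRing.Theory Num.Theory.
Import numFieldNormedType.Exports.

Local Open Scope classical_set_scope.
Local Open Scope ring_scope.

HB.mixin Record isHilbert (R : realType) V of CompleteNormedModule R V := {
  dotp : {dot V for (@idfun R)};
  sqr_normE : forall v : V, `|v| ^+ 2 = dotp v v
}.

#[short(type="hilbertType")]
HB.structure Definition Hilbert (R : realType) :=
  {V of CompleteNormedModule R V & isHilbert R V}.

Definition separable_space (X : topologicalType) : Prop :=
  exists2 D : set X, countable D & dense D.

Section dotp_theory.
Context (R : realType) (H : hilbertType R).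
Implicit Types x y z : H.

Lemma dotpC x y : dotp x y = dotp y x.
Proof. by rewrite hermC expr0 mul1r. Qed.

Lemma dotpBZ x y z (a b : R) :
  dotp (a *: x - b *: y) z = a * dotp x z - b * dotp y z.
Proof.
have -> : dotp (a *: x - b *: y) z = applyr dotp z (a *: x - b *: y) by [].
by rewrite linearB !linearZ.
Qed.

Lemma dotp_cauchy_schwarz x y : `|dotp x y| <= `|x| * `|y|.
Proof.
have [->|x0] := eqVneq x 0.
  have := dotpBZ 0 0 y 0 0; rewrite !scale0r !mul0r !subr0 => ->.
  by rewrite !normr0 mul0r.
have q0 (z : H) : 0 <= dotp z z by rewrite -sqr_normE exprn_ge0.
have x2 : 0 < dotp x x by rewrite -sqr_normE exprn_gt0// normr_gt0.
have := q0 (dotp x x *: y - dotp x y *: x).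
rewrite dotpBZ ![dotp _ (_ - _)]dotpC !dotpBZ (dotpC y x).
have [] := (sqr_normE x, sqr_normE y).
set a := dotp x x; set b := dotp x y; set c := dotp y y => xa yc h.
have : 0 <= a * (a * c - b ^+ 2) by move: h; lra.
rewrite pmulr_rge0// subr_ge0 => bac.
rewrite -(ler_pXn2r (n := 2)) ?nnegrE// ?mulr_ge0// exprMn xa yc.
by rewrite real_normK ?num_real.
Qed.

Lemma dotp_continuous x : continuous (fun y => dotp x y : R^o).
Proof.
move=> y; apply/cvgrPdist_lt => e e0.
have d0 : 0 < e / (`|x| + 1) by rewrite divr_gt0// ltr_wpDl.
near=> z.
rewrite /= -linearBr (le_lt_trans (dotp_cauchy_schwarz _ _))//.
have yz : `|y - z| < e / (`|x| + 1).
  by near: z; exact: (@cvgr_dist_lt _ _ _ _ _ id).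
rewrite (@le_lt_trans _ _ ((`|x| + 1) * `|y - z|))//.
  by rewrite ler_wpM2r// lerDl.
by rewrite mulrC -ltr_pdivlMr// ltr_wpDl.
Unshelve. all: by end_near. Qed.

End dotp_theory.

Section dual.
Context (R : realType) (V : normedModType R).

Definition continuous_linear : {pred V -> R^o} :=
  [pred f : V -> R^o | `[< linear f /\ continuous f >]].

Fact continuous_linear_submod_closed : submod_closed continuous_linear.
Proof.
split=> [|a f g].
  apply/asboolP; split=> [b x y|x].
    by rewrite /= scaler0 addr0.
  exact: cvg_cst.
move=> /asboolP[lf cf] /asboolP[lg cg]; apply/asboolP; split.
  move=> b x y /=; rewrite -![(_ + _) _]/(_ + _) -![(_ *: _) _]/(_ *: _).
  by rewrite lf lg !scalerDr !scalerA (mulrC a b) addrACA.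
move=> x; apply: cvgD; last exact: cg.
by apply: cvgZr; exact: cf.
Qed.

HB.instance Definition _ :=
  GRing.isSubmodClosed.Build R (V -> R^o) continuous_linear
    continuous_linear_submod_closed.

Record dual := Dual {
  dual_fun :> V -> R^o;
  _ : dual_fun \in continuous_linear }.

HB.instance Definition _ := [isSub for dual_fun].
HB.instance Definition _ := [Choice of dual by <:].
HB.instance Definition _ := [SubChoice_isSubLmodule of dual by <:].

End dual.

Section dual_norm.
Context (R : realType) (V : normedModType R).
Implicit Types f g : dual V.

Lemma dualP f : linear f /\ continuous f.
Proof. by case: f => f /= /asboolP. Qed.

Definition dual_norm f : R := sup [set `|f v| | v in [set v : V | `|v| <= 1]].

Let pack_linear (f : V -> R^o) (lf : linear f) : {linear V -> R^o} :=
  HB.pack f (GRing.isLinear.Build _ _ _ _ _ lf).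

Lemma dual_bounded f : exists2 M, 0 <= M & forall v, `|f v| <= M * `|v|.
Proof.
have [lf cf] := dualP f.
have : bounded_near (pack_linear lf) (nbhs (0 : V)).
  exact/linear_bounded_continuous.
move=> /linear_boundedP/pinfty_ex_gt0[M M0 h].
by exists M; [exact: ltW|exact: h].
Qed.

Lemma dual_norm_has_sup f :
  has_sup [set `|f v| | v in [set v : V | `|v| <= 1]].
Proof.
split; first by exists `|f 0|, 0 => //=; rewrite normr0.
have [M M0 fM] := dual_bounded f; exists M => _ [v /= v1 <-].
by rewrite (le_trans (fM v))// ler_piMr.
Qed.

Lemma dual_norm_ub f v : `|v| <= 1 -> `|f v| <= dual_norm f.
Proof.
by move=> v1; apply: sup_upper_bound; [exact: dual_norm_has_sup|exists v].
Qed.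

Lemma dual_norm_le f M :
  (forall v, `|v| <= 1 -> `|f v| <= M) -> dual_norm f <= M.
Proof.
move=> fM; apply: ge_sup; first by case: (dual_norm_has_sup f).
by move=> _ [v /= v1 <-]; exact: fM.
Qed.

Lemma dualDE f g v : (f + g) v = f v + g v. Proof. by []. Qed.
Lemma dualNE f v : (- f) v = - f v. Proof. by []. Qed.
Lemma dualZE (a : R) f v : (a *: f) v = a * f v. Proof. by []. Qed.

Lemma dual_scale f (a : R) v : f (a *: v) = a * f v.
Proof. exact: (linearZ_LR (pack_linear (dualP f).1)). Qed.

Let dual_normD f g : dual_norm (f + g) <= dual_norm f + dual_norm g.
Proof.
apply: dual_norm_le => v v1; rewrite dualDE (le_trans (ler_normD _ _))//.
by rewrite lerD// dual_norm_ub.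
Qed.

Let dual_normZ_le (a : R) f : dual_norm (a *: f) <= `|a| * dual_norm f.
Proof.
by apply: dual_norm_le => v v1; rewrite dualZE normrM ler_wpM2l// dual_norm_ub.
Qed.

Let dual_norm_ge0 f : 0 <= dual_norm f.
Proof. by rewrite (le_trans _ (@dual_norm_ub f 0 _))// normr0. Qed.

Let dual_normZ (a : R) f : dual_norm (a *: f) = `|a| * dual_norm f.
Proof.
apply/eqP; rewrite eq_le dual_normZ_le/=.
have [->|a0] := eqVneq a 0; first by rewrite normr0 mul0r dual_norm_ge0.
rewrite -[X in _ * dual_norm X](scalerK a0) -ler_pdivlMl ?normr_gt0//.
by rewrite -normfV dual_normZ_le.
Qed.

Let dual_norm0_eq0 f : dual_norm f = 0 -> f = 0.
Proof.
move=> f0; apply/val_inj/funext => v /=; change (f v = 0).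
have [->|v0] := eqVneq v 0.
  by have := dual_scale f 0 0; rewrite scale0r mul0r.
have := @dual_norm_ub f (`|v|^-1 *: v).
rewrite f0 dual_scale normrZ normfV normr_id mulVf ?normr_eq0// => /(_ (lexx _)).
rewrite normr_le0 mulf_eq0 invr_eq0 normr_eq0 (negbTE v0)/=.
by move=> /eqP.
Qed.

HB.instance Definition _ := Lmodule_isNormed.Build R (dual V)
  dual_normD dual_normZ dual_norm0_eq0.

Lemma dual_normE f :
  `|f| = sup [set `|f v| | v in [set v : V | `|v| <= 1]].
Proof. by []. Qed.

End dual_norm.

Record gelfand_triple (R : realType) (V H : hilbertType R) := GelfandTriple {
  gelfand_emb :> {linear V -> H};
  gelfand_emb_continuous : continuous gelfand_emb;
  gelfand_emb_injective : injective gelfand_emb;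
  gelfand_emb_dense : dense (range gelfand_emb) }.

Section pivot.
Context (R : realType) (V H : hilbertType R) (i : gelfand_triple V H).

Fact pivot_subproof (h : H) :
  (fun v : V => dotp h (i v) : R^o) \in @continuous_linear R V.
Proof.
apply/asboolP; split=> [a x y|x].
  by rewrite linearP dotpC /=; have := dotpBZ (i x) (i y) h a (- 1);
    rewrite scaleN1r opprK mulN1r opprK => ->; rewrite ![dotp _ h]dotpC.
apply: (@continuous_comp _ _ _ i (dotp h)); last exact: dotp_continuous.
exact: gelfand_emb_continuous.
Qed.

(* H is identified with its dual: h is seen as the functional v |-> (h, i v)_H *)
Definition pivot (h : H) : dual V := Dual (pivot_subproof h).

End pivot.

Section bochner.
Context d (X : measurableType d) (R : realType) (B : normedModType R).
Variables (mu : {measure set X -> \bar R}) (D : set X).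
Implicit Types (s f : X -> B).

Definition simple s : Prop :=
  finite_set (s @` D) /\ forall y, measurable (D `&` s @^-1` [set y]).

Definition integrable_simple s : Prop :=
  simple s /\ forall y, y != 0 -> (mu (D `&` s @^-1` [set y]) < +oo)%E.

Definition simple_integral s : B :=
  \sum_(y \in s @` D) fine (mu (D `&` s @^-1` [set y])) *: y.

(* the limit is required at every point of D, as opposed to mu-almost every
   point in strongly_measurable *)
Definition borel_strongly_measurable f : Prop :=
  exists2 s_ : nat -> X -> B, (forall n, simple (s_ n)) &
    forall x, D x -> s_ n x @[n --> \oo] --> f x.

Definition strongly_measurable f : Prop :=
  exists2 s_ : nat -> X -> B, (forall n, simple (s_ n)) &
    {ae mu, forall x, D x -> s_ n x @[n --> \oo] --> f x}.

(* f is Bochner integrable over D and its Bochner integral is I *)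
Definition is_bochner_integral f (I : B) : Prop :=
  exists s_ : nat -> X -> B,
  [/\ forall n, integrable_simple (s_ n),
      {ae mu, forall x, D x -> s_ n x @[n --> \oo] --> f x},
      (\int[mu]_(x in D) `|f x - s_ n x|%:E)%E @[n --> \oo] --> 0%E &
      simple_integral (s_ n) @[n --> \oo] --> I].

Definition sqr_L2_norm f : \bar R := (\int[mu]_(x in D) (`|f x| ^+ 2)%:E)%E.

(* elements of Bochner-Lebesgue spaces are represented by functions defined on
   the whole of X, whose values outside D are irrelevant *)
Definition in_L2 f : Prop := strongly_measurable f /\ (sqr_L2_norm f < +oo)%E.

End bochner.

Section weak_derivative.
Context (R : realType) (T : R).

(* phi is in C_c^oo(]0, T[), extended by 0 *)
Definition test_function (phi : R -> R) : Prop :=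
  (forall n t, derivable (phi^`(n)%classic) t 1) /\
  exists a b, [/\ 0 < a, b < T & forall t, phi t != 0 -> a <= t <= b].

Definition is_weak_derivative (B : normedModType R) (u g : R -> B) : Prop :=
  forall phi, test_function phi -> exists I : B,
    is_bochner_integral lebesgue_measure `]0, T[ (fun t => phi^`()%classic t *: u t) I /\
    is_bochner_integral lebesgue_measure `]0, T[ (fun t => phi t *: g t) (- I).

Context (V H : hilbertType R) (i : gelfand_triple V H).
Implicit Types u : R -> V.

Definition is_time_derivative u (g : R -> dual V) : Prop :=
  in_L2 lebesgue_measure `]0, T[ g /\
  is_weak_derivative (fun t => pivot i (i (u t))) g.

Definition in_W u : Prop :=
  in_L2 lebesgue_measure `]0, T[ u /\ exists g, is_time_derivative u g.

(* a representative of the weak time derivative (unique a.e. on ]0, T[); the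
   default value 0 is used only outside W(0,T) *)
Definition dt u : R -> dual V := xget (fun=> 0) [set g | is_time_derivative u g].

Definition W_norm u : \bar R :=
  ((sqr_L2_norm lebesgue_measure `]0%R, T[ u +
    sqr_L2_norm lebesgue_measure `]0%R, T[ (dt u)) `^ 2^-1)%E.

Definition is_H_representative u (c : R -> H) : Prop :=
  {within `[0, T], continuous c} /\
  {ae lebesgue_measure, forall t, t \in `]0, T[ -> c t = i (u t)}.

(* the H-continuous representative, unique on [0, T]; the default value 0 is
   never used for u in W(0,T) *)
Definition H_rep u : R -> H := xget (fun=> 0) [set c | is_H_representative u c].

Definition C_norm u : \bar R :=
  ereal_sup [set `|H_rep u t|%:E | t in `[0, T]].

End weak_derivative.

Section delay_problem.
Context (R : realType) (T tau : R) (V H : hilbertType R).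
Context (i : gelfand_triple V H) (A0 A1 : V -> dual V).

(* the values at t = 0 and outside ]-tau, T[ are irrelevant *)
Definition joined_trajectory (psi u : R -> V) (t : R) : V :=
  if t < 0 then psi t else u t.

(* k = K_sigma g a.e. on ]0, T[. The pointwise Bochner integrals are taken with
   a Borel representative g' of g: for a singular sigma, s |-> g (t - s) need
   not be sigma-measurable when g is merely Lebesgue measurable. Changing g' on
   a null set changes k on a null set only. *)
Definition is_delay_term (sigma : {measure set (measurableTypeR R) -> \bar R})
    (g : R -> V) (k : R -> dual V) : Prop :=
  exists g' : R -> V,
  [/\ @borel_strongly_measurable _ (measurableTypeR R) R V `]- tau, T[ g',
      {ae lebesgue_measure, forall t, t \in `]- tau, T[ -> g' t = g t} &
      {ae lebesgue_measure, forall t, t \in `]0, T[ ->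
        is_bochner_integral sigma `[0, tau] (fun s => A1 (g' (t - s))) (k t)}].

(* the value u(0) is that of the H-continuous representative *)
Definition weak_solution (mu : {measure set (measurableTypeR R) -> \bar R})
    (u0 : H) (f : R -> dual V) (psi u : R -> V) : Prop :=
  [/\ in_W T i u,
      exists2 c, is_H_representative T i u c & c 0 = u0 &
      exists2 k, is_delay_term mu (joined_trajectory psi u) k &
        {ae lebesgue_measure, forall t, t \in `]0, T[ ->
          dt T i u t + A0 (u t) + k t = f t}].

End delay_problem.

Definition narrow_cvg (R : realType) (tau : R)
    (mu_ : nat -> {measure set (measurableTypeR R) -> \bar R})
    (mu : {measure set (measurableTypeR R) -> \bar R}) : Prop :=
  forall phi : R -> R, {within `[0, tau], continuous phi} ->
    \int[mu_ n]_(s in `[0, tau]) phi s @[n --> \oo] -->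
    \int[mu]_(s in `[0, tau]) phi s.

(* Main.v *)
Require Import Defs.
From HB Require Import structures.
From mathcomp Require Import all_boot all_order all_algebra.
From mathcomp Require Import all_classical all_reals all_analysis.
From mathcomp Require Import measurable_realfun.
From mathcomp Require Import ring lra.

Set Implicit Arguments.
Unset Strict Implicit.
Unset Printing Implicit Defensive.

Import Order.TTheory GRing.Theory Num.Theory.
Import numFieldNormedType.Exports.

Local Open Scope classical_set_scope.
Local Open Scope ring_scope.

(** The difference w of the two solutions, u_{mu_n} - u, vanishes before time 0
    and solves the linear problem with initial value 0 and right-hand side
    K_{m delta} u~ - K_{mu_n} u~ - K_{mu_n} w.

    Energy. Testing with w bounds |w(t)|_H^2 and the energy of w on (0, t) by
    the L^2 norm of the right-hand side on (0, t). The contribution of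
    K_{mu_n} w is at most mu_n([0, tau_d / 2]) times the energy before t plus
    mu_n([0, tau]) times the energy before t - tau_d / 2. The first mass tends
    to 0, because narrow convergence tested on s |-> |s - tau_d| gives
    \int |s - tau_d| dmu_n(s) --> 0; so convergence before t - tau_d / 2 implies
    convergence before t, and finitely many steps reach T.

    Consistency. By Tonelli, K_{mu_n} u~ - K_{m delta} u~ is controlled in L^2
    by |mu_n([0, tau]) - m| and by the mu_n-average of the translation errors
    |u~(. - s) - u~(. - tau_d)|_{L^2}^2. Continuity of translations in L^2 bounds
    such an error by eps + C |s - tau_d|, so its average is small as well.

    Energy inequality. Let c be the H-continuous representative of w, let h > 0
    and integrate over r the increments
      |c(r)|^2 - |c(r - h)|^2 <= 2 (c(r) - c(r - h), c(r))
                               = 2 \int_(r - h)^r <w'(x), w(r)> dx.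
    Replacing w'(x) by w'(r) costs, by Tonelli, an average of the translation
    errors of w' over translations smaller than h; divide by h and let h --> 0. *)

(** * Strong measurability *)

(** Bochner integrals and weak derivatives are used only through their values on a fixed vector [v]
    of [V]: [bochner_eval] turns them into scalar Lebesgue integrals, and norms in [dual V] are
    recovered by letting [v] vary. The weak equation thus becomes an increment formula for the
    scalar products of the H-continuous representative [c] with [i v]. The given functions are only
    almost everywhere limits of simple functions. Each is first replaced by an everywhere limit of
    simple functions vanishing off its interval, so that shifts, Tonelli and integrals against
    [mu_n] make sense. The energy inequality averages increments over [r] because [c(r)] is known to
    lie in the image of [V] only for almost every [r], and because [w'] is only square integrable in
    time: no product rule is available, and an inequality is enough. The two delay terms are
    compared as a whole. With [g] and [h] the joined trajectories of the two solutions,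
    [g(r - s) - h(r - tau_d)] is split as [w(r - s)] plus a translation increment of the fixed
    function [h]; the first part is the stability term, the second the consistency error. *)

Definition zext (X : Type) (B : nmodType) (D : set X) (f : X -> B) (x : X) : B :=
  if x \in D then f x else 0.

Section borel_strong_measurability.
Context d (X : measurableType d) (R : realType).
Implicit Types B C E : normedModType R.

(** The limit holds at every point, so no measure is involved: the property survives composition
    with maps such as [(r, s) |-> r - s] and serves Lebesgue measure and [sigma] alike. *)
Definition smeas B (f : X -> B) := borel_strongly_measurable setT f.

Lemma simple_preimage B (D : set X) (s : X -> B) (A : set B) :
  measurable D -> simple D s -> measurable (D `&` s @^-1` A).
Proof.
move=> mD [fs ms].
have -> : D `&` s @^-1` A =
    \bigcup_(y in (s @` D) `&` A) (D `&` s @^-1` [set y]).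
  apply/seteqP; split=> [x [Dx Ax]|x [y [_ Ay]] [Dx /= sxy]].
    by exists (s x) => //; split => //; exists x.
  by split => //=; rewrite sxy.
by apply: fin_bigcup_measurable => //; exact: finite_setIl.
Qed.

Lemma simple_op2 B C E (F : B -> C -> E) (s : X -> B) (r : X -> C) :
  simple setT s -> simple setT r -> simple setT (fun x => F (s x) (r x)).
Proof.
move=> ss sr; split.
  apply: (@sub_finite_set _ _ ((fun p => F p.1 p.2) @` ((s @` setT) `*` (r @` setT)))).
    by move=> _ [x _ <-]; exists (s x, r x) => //; split => /=; exists x.
  by apply: finite_image; apply: finite_setX; [exact: ss.1|exact: sr.1].
move=> y; rewrite setTI.
have -> : (fun x => F (s x) (r x)) @^-1` [set y] =
   \bigcup_(b in s @` setT) ((setT `&` s @^-1` [set b]) `&`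
     (setT `&` r @^-1` [set c | F b c = y])).
  apply/seteqP; split=> [x /= Fy|x [b _] [[_ /= <-] [_ /= ]]//].
  by exists (s x); [exists x|split; split].
apply: fin_bigcup_measurable => [|b _]; first exact: ss.1.
by apply: measurableI; [exact: ss.2|exact: simple_preimage].
Qed.

(** Apply [F] to the two approximating sequences. Joint sequential continuity is the form that fits
    the pairing of [dual V] with [V]. *)
Lemma smeas_op2 B C E (F : B -> C -> E) (f : X -> B) (g : X -> C) :
  (forall (u : nat -> B) (v : nat -> C) b c, u n @[n --> \oo] --> b ->
     v n @[n --> \oo] --> c -> F (u n) (v n) @[n --> \oo] --> F b c) ->
  smeas f -> smeas g -> smeas (fun x => F (f x) (g x)).
Proof.
move=> cF [s_ ss sf] [r_ sr rg]; exists (fun n x => F (s_ n x) (r_ n x)).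
  by move=> n; exact: simple_op2.
by move=> x _; apply: cF; [exact: sf|exact: rg].
Qed.

Lemma smeas_op1 B C (F : B -> C) (f : X -> B) :
  continuous F -> smeas f -> smeas (fun x => F (f x)).
Proof.
move=> cF mf; apply: (@smeas_op2 _ _ _ (fun b _ => F b) f f) => // u v b c ub _.
exact: (cvg_comp u F ub (cF b)).
Qed.

Lemma smeasD B (f g : X -> B) : smeas f -> smeas g -> smeas (fun x => f x + g x).
Proof. by apply: (@smeas_op2 _ _ _ +%R) => u v b c; exact: cvgD. Qed.

Lemma smeasB B (f g : X -> B) : smeas f -> smeas g -> smeas (fun x => f x - g x).
Proof. by apply: (@smeas_op2 _ _ _ (fun b c => b - c)) => u v b c; exact: cvgB. Qed.

Lemma smeas_cst B (b : B) : smeas (cst b).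
Proof.
exists (fun _ => cst b) => [_|x _]; last exact: cvg_cst.
split; first exact/finite_image_cst.
by move=> y; rewrite preimage_cst; case: ifP => _; rewrite ?setI0 ?setTI.
Qed.

Lemma smeas_measurable (f : X -> R^o) : smeas f -> measurable_fun setT (f : X -> R).
Proof.
move=> [s_ ss sf].
apply: (@measurable_fun_cvg _ _ _ setT (fun n x => s_ n x : R)) => // n _ Y mY.
exact: simple_preimage.
Qed.

Lemma smeas_norm B (f : X -> B) : smeas f -> measurable_fun setT (fun x => `|f x|).
Proof.
move=> mf; apply: (@smeas_measurable (fun x => `|f x|)).
by apply: (smeas_op1 _ mf) => b; exact: norm_continuous.
Qed.

Lemma smeas_sqr_norm B (f : X -> B) :
  smeas f -> measurable_fun setT (fun x => (`|f x| ^+ 2)%:E).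
Proof.
by move=> mf; apply/measurable_EFinP; apply: measurable_funX; exact: smeas_norm.
Qed.

End borel_strong_measurability.

Lemma smeas_comp d d' (X : measurableType d) (Y : measurableType d') (R : realType)
    (B : normedModType R) (f : X -> B) (h : Y -> X) :
  measurable_fun setT h -> smeas f -> smeas (f \o h).
Proof.
move=> mh [s_ ss sf]; exists (fun n => s_ n \o h); last by move=> x _; exact: sf.
move=> n; split.
  apply: (sub_finite_set _ (ss n).1) => _ [x _ <-]; by exists (h x).
by move=> y; rewrite comp_preimage; apply: mh => //; rewrite -[X in measurable X]setTI;
  exact: (ss n).2.
Qed.

Lemma simple_zext d (X : measurableType d) (R : realType)
    (B : normedModType R) (D : set X) (s : X -> B) :
  measurable D -> simple D s -> simple setT (zext D s).
Proof.
move=> mD ss; split.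
  apply: (@sub_finite_set _ _ ((s @` D) `|` [set 0])).
    move=> _ [x _ <-]; rewrite /zext; case: ifPn => [xD|_]; last by right.
    by left; exists x => //; exact: set_mem.
  by rewrite finite_setU; split; [exact: ss.1|exact: finite_set1].
move=> y; rewrite setTI.
have -> : zext D s @^-1` [set y] = (D `&` s @^-1` [set y]) `|`
    (~` D `&` [set _ | y = 0]).
  apply/seteqP; split=> [x /=|x /=].
    rewrite /zext; case: ifPn => [/set_mem xA sy|]; first by left.
    by rewrite notin_setE => xA <-; right.
  case=> [[xA <-]|[xA ->]]; first by rewrite /zext mem_set.
  by rewrite /zext memNset.
apply: measurableU; first exact: ss.2.
have [y0|y0] := pselect (y = 0).
  apply: measurableI; [exact: measurableC|].
  by rewrite (_ : [set _ | _] = setT)//; apply/seteqP; split.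
by rewrite (_ : [set _ | _] = set0) ?setI0//; apply/seteqP; split.
Qed.

Lemma simple_subset d (X : measurableType d) (R : realType)
    (B : normedModType R) (D : set X) (s : X -> B) :
  measurable D -> simple setT s -> simple D s.
Proof.
move=> mD ss; split; last first.
  by move=> y; rewrite -[_ @^-1` _]setTI; exact: measurableI mD (ss.2 y).
by apply: (sub_finite_set _ ss.1) => _ [x _ <-]; exists x.
Qed.

Lemma smeas_zext d (X : measurableType d) (R : realType)
    (B : normedModType R) (D : set X) (f : X -> B) :
  measurable D -> borel_strongly_measurable D f -> smeas (zext D f).
Proof.
move=> mD [s_ ss sf]; exists (fun n => zext D (s_ n)).
  by move=> n; exact: simple_zext.
move=> x _; rewrite /zext; case: ifPn => xA; last exact: cvg_cst.
exact: sf (set_mem xA).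
Qed.

Lemma smeas_indic d (X : measurableType d) (R : realType)
    (B : normedModType R) (D : set X) (f : X -> B) :
  measurable D -> smeas f -> smeas (zext D f).
Proof.
move=> mD [s_ ss sf]; apply: smeas_zext => //.
exists s_; last by move=> x _; exact: sf.
by move=> n; exact: simple_subset.
Qed.

(** The simple functions converge on [D] outside a measurable null set [N]; putting 0 on [N] and off
    [D] makes the convergence hold everywhere. *)
Lemma strongly_measurable_borel d (X : measurableType d) (R : realType)
    (B : normedModType R) (mu : {measure set X -> \bar R}) (D : set X) (f : X -> B) :
  measurable D -> strongly_measurable mu D f ->
  exists g, [/\ smeas g, forall x, ~ D x -> g x = 0 &
    {ae mu, forall x, D x -> g x = f x}].
Proof.
move=> mD [s_ ss [N [mN N0 sN]]].
have mDN : measurable (D `\` N) by exact: measurableD.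
exists (zext (D `\` N) f); split.
- apply: smeas_zext => //; exists s_.
    move=> n; split.
      by apply: (sub_finite_set _ (ss n).1) => _ [x [Dx _] <-]; exists x.
    move=> y; rewrite setIDAC setIDA; apply: measurableD => //; exact: (ss n).2.
  move=> x [Dx Nx]; apply: contrapT => h; apply: Nx; apply: sN => /= h'.
  by apply: h; apply: h'.
- by move=> x Dx; rewrite /zext memNset// => -[].
- exists N; split => // x /= /not_implyP[Dx]; apply: contra_notP => Nx.
  by rewrite /zext mem_set.
Qed.

(** * Translations in L^2 *)

Lemma sqr_normD_le (R : realType) (B : normedModType R) (a b : B) :
  `|a + b| ^+ 2 <= 2 * `|a| ^+ 2 + 2 * `|b| ^+ 2.
Proof.
have h : `|a + b| ^+ 2 <= (`|a| + `|b|) ^+ 2.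
  by rewrite ler_pXn2r// ?nnegrE ?addr_ge0// ler_normD.
apply: (le_trans h); have := sqr_ge0 (`|a| - `|b|); move: `|a| `|b| => x y; nra.
Qed.

Section translation.
Context (R : realType).
Notation RT := (measurableTypeR R).
Notation mu := (@lebesgue_measure R).

Lemma measurable_translation (s : R) : measurable_fun [set: RT] (fun x : RT => x - s : RT).
Proof. by apply: measurable_funB. Qed.

(** The pushforward by a translation agrees with Lebesgue measure on half-open intervals, which
    determine it. *)
Lemma lebesgue_measure_translation (s : R) (A : set RT) : measurable A ->
  mu ((fun x => x - s) @^-1` A) = mu A.
Proof.
move=> mA; apply/esym.
pose f : {mfun RT >-> RT} :=
  HB.pack (fun x : RT => x - s : RT) (isMeasurableFun.Build _ _ _ _ _ (measurable_translation s)).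
apply: (lebesgue_measure_unique (mu := pushforward mu f)) => // _ [[p q] _ <-].
change (mu `]p, q] = mu ((fun x : R => x - s) @^-1` `]p, q])).
have -> : (fun x => x - s) @^-1` `]p, q] = `]p + s, q + s]%classic.
  by apply/seteqP; split => x /=; rewrite !in_itv/= ltrBrDr lerBlDr.
rewrite !lebesgue_measure_itv/= !lte_fin ltrD2r; case: ifP => // _.
by rewrite -!EFinB; congr EFin; ring.
Qed.

Lemma ge0_integral_translation (s : R) (F : RT -> \bar R) :
  measurable_fun setT F -> (forall x, 0 <= F x)%E ->
  (\int[mu]_x F (x - s)%R = \int[mu]_x F x)%E.
Proof.
move=> mF F0.
have := @ge0_integral_pushforward _ _ _ _ _ _ (measurable_translation s) mu setT F
  measurableT mF (fun x _ => F0 x).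
rewrite preimage_setT => /= <-.
pose f : {mfun RT >-> RT} :=
  HB.pack (fun x : RT => x - s : RT) (isMeasurableFun.Build _ _ _ _ _ (measurable_translation s)).
apply: (@eq_measure_integral _ _ _ _ mu (pushforward mu f)) => A mA _.
exact: lebesgue_measure_translation.
Qed.

Section continuity.
Context (B : normedModType R).
Implicit Types g h : RT -> B.

Definition translation_error g (s : R) : \bar R :=
  (\int[mu]_x (`|g (x - s)%R - g x| ^+ 2)%:E)%E.

Definition translation_continuous g := forall e : R, 0 < e ->
  exists2 dlt : R, 0 < dlt & forall s, `|s| < dlt -> (translation_error g s <= e%:E)%E.

Lemma smeas_translation (s : R) g : smeas g -> smeas (fun x : RT => g (x - s)).
Proof. by apply: smeas_comp; exact: measurable_translation. Qed.

Lemma smeas_translation_sub (s : R) g : smeas g -> smeas (fun x : RT => g (x - s) - g x).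
Proof. by move=> mg; apply: smeasB => //; exact: smeas_translation. Qed.

Lemma translation_continuousD g h : smeas g -> smeas h ->
  translation_continuous g -> translation_continuous h ->
  translation_continuous (fun x : RT => g x + h x).
Proof.
move=> mg mh cg ch e e0.
have e4 : 0 < e / 4 by rewrite divr_gt0.
have [d1 d10 h1] := cg _ e4; have [d2 d20 h2] := ch _ e4.
exists (Num.min d1 d2); first by rewrite lt_min d10.
move=> s; rewrite lt_min => /andP[/h1 {}h1 /h2 {}h2].
have mgs := smeas_sqr_norm (smeas_translation_sub s mg).
have mhs := smeas_sqr_norm (smeas_translation_sub s mh).
apply: (@le_trans _ _ (2%:E * translation_error g s + 2%:E * translation_error h s)%E).
  rewrite /translation_error -!ge0_integralZl_EFin//.
  rewrite -ge0_integralD//; last 2 first.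
  - exact: measurable_funeM.
  - exact: measurable_funeM.
  apply: ge0_le_integral => //.
  - apply: smeas_sqr_norm.
    by apply: smeas_translation_sub; exact: smeasD.
  - by apply: emeasurable_funD; exact: measurable_funeM.
  - move=> x _; rewrite -!EFinM -EFinD lee_fin.
    by rewrite opprD addrACA sqr_normD_le.
apply: (@le_trans _ _ ((2 * (e / 4))%:E + (2 * (e / 4))%:E)%E); last first.
  by rewrite -EFinD lee_fin; lra.
by rewrite !EFinM leeD// lee_pmul2l// lte_fin.
Qed.

(** Three-term argument through [h]: the two terms in [g - h] have the same integral by translation
    invariance. Squaring a sum of three costs a factor at most 4 per term, whence [e / 12]. *)
Lemma translation_continuous_lim g : smeas g ->
  (forall e : R, 0 < e -> exists h, [/\ smeas h, translation_continuous h &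
     (\int[mu]_x (`|g x - h x| ^+ 2)%:E <= e%:E)%E]) ->
  translation_continuous g.
Proof.
move=> mg H e e0.
have e4 : 0 < e / 12 by rewrite divr_gt0.
have [h [mh ch hg]] := H _ e4.
have [dl dl0 {}ch] := ch _ e4; exists dl => // s /ch hs.
have mgh := smeasB mg mh.
have mghs := smeas_sqr_norm (smeas_translation s mgh).
have mhs := smeas_sqr_norm (smeas_translation_sub s mh).
have mgh2 := smeas_sqr_norm mgh.
apply: (@le_trans _ _ (\int[mu]_x (4%:E * (`|g (x - s)%R - h (x - s)%R| ^+ 2)%:E +
   (4%:E * (`|g x - h x| ^+ 2)%:E + 4%:E * (`|h (x - s)%R - h x| ^+ 2)%:E)))%E).
  apply: ge0_le_integral => //.
  - apply: smeas_sqr_norm; exact: smeas_translation_sub.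
  - apply: emeasurable_funD; first exact: measurable_funeM.
    by apply: emeasurable_funD; exact: measurable_funeM.
  - move=> x _; rewrite -!EFinM -!EFinD lee_fin.
    have -> : g (x - s) - g x = (g (x - s) - h (x - s)) + ((h (x - s) - h x) + - (g x - h x)).
      by rewrite opprB !subrKA.
    have := sqr_normD_le (h (x - s) - h x) (- (g x - h x)).
    have := sqr_normD_le (g (x - s) - h (x - s)) ((h (x - s) - h x) + - (g x - h x)).
    by rewrite normrN; move: (`|_| ^+ 2) (`|_| ^+ 2) (`|_| ^+ 2)
      (sqr_ge0 `|g (x - s) - h (x - s)|) => a b c; lra.
rewrite ge0_integralD//; last 3 first.
- exact: measurable_funeM.
- by move=> x _; rewrite adde_ge0//.
- by apply: emeasurable_funD; exact: measurable_funeM.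
rewrite ge0_integralD//; last 2 first.
- exact: measurable_funeM.
- exact: measurable_funeM.
rewrite !ge0_integralZl_EFin//.
rewrite (@ge0_integral_translation s (fun x => (`|g x - h x| ^+ 2)%:E))//.
apply: (@le_trans _ _ ((4 * (e / 12))%:E +
    ((4 * (e / 12))%:E + (4 * (e / 12))%:E))%E); last first.
  by rewrite -!EFinD lee_fin; lra.
by rewrite !EFinM !leeD// lee_pmul2l// lte_fin.
Qed.

Lemma compact_open_translation (K U : set R) : compact K -> open U -> K `<=` U ->
  exists2 dl : R, 0 < dl & forall s x, `|s| < dl -> K x -> U (x + s).
Proof.
move=> /compact_near_coveringP cK oU KU.
have : \forall s \near (0 : R), K `<=` (fun x => U (x + s)).
  have := cK R (nbhs (0 : R)) (fun s x => U (x + s)) _; apply => x Kx.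
  have : (fun p : R * R => p.1 + p.2) @ (x, 0) --> x + 0 by apply: cvgD;
    [exact: cvg_fst|exact: cvg_snd].
  rewrite addr0 => /(_ U); apply.
  by apply: open_nbhs_nbhs; split => //; exact: KU.
move=> /nbhs_ballP[dl /= dl0 h]; exists dl => // s x sd Kx.
by apply: (h s) => //; rewrite /ball/= sub0r normrN.
Qed.

(** By regularity choose [K] compact and [U] open around [A], with [D = U \ K] small. For small [s],
    translation by [s] or [- s] keeps [K] inside [U]; hence if exactly one of [x], [x - s] lies in
    [A], one of them lies in [D]. The error is thus at most [2 * c * mu D], and the [+ 1] in [c]
    keeps the divisor positive when [b = 0]. *)
Lemma translation_continuous_indic (A : set RT) (b : B) : measurable A ->
  (mu A < +oo)%E -> translation_continuous (zext A (cst b)).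
Proof.
move=> mA Afin e e0.
pose c := `|b| ^+ 2 + 1.
have c0 : 0 < c by rewrite ltr_wpDl// sqr_ge0.
have ec : 0 < e / (4 * c) by rewrite divr_gt0// mulr_gt0.
have [U [oU AU UA]] := lebesgue_regularity_outer mA Afin ec.
have [K [cK KA AK]] := lebesgue_regularity_inner mA Afin ec.
have [dl dl0 KU] := compact_open_translation cK oU (subset_trans KA AU).
have mU : measurable U by exact: open_measurable.
have mK : measurable K by apply: closed_measurable; exact: compact_closed.
exists dl => // s sd.
pose D := U `\` K.
have mD : measurable D by exact: measurableD.
have muD : (mu D <= (e / (2 * c))%:E)%E.
  have -> : D = (U `\` A) `|` (A `\` K).
    apply/seteqP; split => x /=; last by move=> [[? ?]|[? ?]]; split; auto.
    by move=> [Ux Kx]; have [?|?] := pselect (A x); [right|left].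
  apply: (le_trans (measureU2 _ _ _)); [exact: measurableD|exact: measurableD|].
  have -> : e / (2 * c) = e / (4 * c) + e / (4 * c) by field; rewrite gt_eqF.
  by rewrite EFinD; apply: leeD; exact: ltW.
have mi : measurable_fun [set: RT] (fun x => (\1_D x)%:E : \bar R) by exact/measurable_EFinP.
have mis : measurable_fun [set: RT] (fun x : RT => (\1_D (x - s))%:E : \bar R).
  apply/measurable_EFinP.
  by apply: (measurableT_comp (f := (\1_D : RT -> R))) => //; exact: measurable_translation.
apply: (@le_trans _ _ (\int[mu]_x (c%:E * (\1_D (x - s)%R)%:E + c%:E * (\1_D x)%:E))%E).
  apply: ge0_le_integral => //.
  - apply: smeas_sqr_norm; apply: smeas_translation_sub.
    by apply: smeas_indic => //; exact: smeas_cst.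
  - by apply: emeasurable_funD; exact: measurable_funeM.
  - move=> x _; rewrite -!EFinM -!EFinD lee_fin.
    have q : `|b| ^+ 2 <= c by rewrite lerDl.
    have nn (y z : R) : 0 <= c * \1_D y + c * \1_D z by rewrite addr_ge0// mulr_ge0// ltW.
    rewrite /zext; case: ifPn => [/set_mem xs|]; case: ifPn => [/set_mem xA|];
      rewrite ?notin_setE ?subrr ?normr0 ?expr0n//=.
    + move=> xA; rewrite subr0.
      have [Kx|Kx] := pselect (K (x - s)).
        have Ux : U x by have := KU s _ sd Kx; rewrite subrK.
        have Dx : D x by split => // /KA.
        rewrite [\1_D x]indicE (mem_set Dx) mulr1 (le_trans q)// lerDr mulr_ge0//; exact: ltW.
      have Dx : D (x - s) by split => //; exact: AU.
      rewrite [\1_D (x - s)]indicE (mem_set Dx) mulr1 (le_trans q)// lerDl mulr_ge0//; exact: ltW.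
    + move=> xs; rewrite sub0r normrN.
      have [Kx|Kx] := pselect (K x).
        have Ux : U (x - s) by apply: (KU (- s)) => //; rewrite normrN.
        have Dx : D (x - s) by split => // /KA.
        rewrite [\1_D (x - s)]indicE (mem_set Dx) mulr1 (le_trans q)// lerDl mulr_ge0//; exact: ltW.
      have Dx : D x by split => //; exact: AU.
      rewrite [\1_D x]indicE (mem_set Dx) mulr1 (le_trans q)// lerDr mulr_ge0//; exact: ltW.
rewrite ge0_integralD//; last 4 first.
- by move=> x _; rewrite -EFinM lee_fin mulr_ge0// ltW.
- exact: measurable_funeM.
- by move=> x _; rewrite -EFinM lee_fin mulr_ge0// ltW.
- exact: measurable_funeM.
rewrite !ge0_integralZl_EFin ?(ltW c0)//; [|by move=> x _; rewrite lee_fin..].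
rewrite (@ge0_integral_translation s (fun x => (\1_D x)%:E))//.
rewrite integral_indic// setIT.
apply: (@le_trans _ _ ((c * (e / (2 * c)))%:E + (c * (e / (2 * c)))%:E)%E); last first.
  by rewrite -EFinD lee_fin le_eqVlt; apply/orP; left; apply/eqP; field; rewrite gt_eqF.
by rewrite !EFinM !leeD// lee_pmul2l// lte_fin.
Qed.

(** Finite sum of indicators over the distinct values. The level set of 0 may have infinite measure,
    but its term is the zero function. *)
Lemma translation_continuous_simple (h : RT -> B) : simple setT h ->
  (forall y, y != 0 -> (mu (h @^-1` [set y]) < +oo)%E) -> translation_continuous h.
Proof.
move=> sh hfin.
have /finite_seqP[r rh] := sh.1.
have -> : h = (fun x => \sum_(y <- undup r) zext (h @^-1` [set y]) (cst y) x).
  apply/funext => x; rewrite (bigD1_seq (h x)) ?undup_uniq//=; last first.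
    by rewrite mem_undup; have : [set` r] (h x) by rewrite -rh; exists x.
  rewrite {1}/zext mem_set// big1 ?addr0// => y /eqP yx.
  by rewrite /zext memNset//= => yE; apply: yx.
have mh y : measurable (h @^-1` [set y]) by rewrite -[_ @^-1` _]setTI; exact: sh.2.
have mz y : smeas (zext (h @^-1` [set y]) (cst y)).
  by apply: smeas_indic => //; exact: smeas_cst.
have z0 (h' : RT -> B) : h' = cst 0 -> translation_continuous h'.
  move=> -> e e0; exists 1 => // s _; rewrite /translation_error.
  by under eq_integral do rewrite subrr normr0 expr0n/=; rewrite integral0 lee_fin ltW.
suff H : forall s : seq B,
  smeas (fun x => \sum_(y <- s) zext (h @^-1` [set y]) (cst y) x) /\
  translation_continuous (fun x => \sum_(y <- s) zext (h @^-1` [set y]) (cst y) x).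
  exact: (H (undup r)).2.
elim=> [|y s [IH1 IH2]].
  under eq_fun do rewrite big_nil.
  by split; [exact: smeas_cst|exact: z0].
under eq_fun do rewrite big_cons.
split; first exact: smeasD.
apply: translation_continuousD => //.
have [->|y0] := eqVneq y 0; last first.
  by apply: translation_continuous_indic => //; exact: hfin.
by apply: z0; apply/funext => x; rewrite /zext; case: ifP.
Qed.

(** The approximating simple functions converge only pointwise. Cutting [s_ k] to 0 where it exceeds
    [2 * |g|] yields a domination, hence convergence in [L^2], and level sets of finite measure for
    the nonzero values. *)
Lemma translation_continuous_L2 g : smeas g ->
  (\int[mu]_x (`|g x| ^+ 2)%:E < +oo)%E -> translation_continuous g.
Proof.
move=> mg g2; apply: translation_continuous_lim => // e e0.
have [s_ ss sg] := mg.
pose A k := [set x | `|s_ k x| <= 2 * `|g x|].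
have msk k : smeas (s_ k) by exists (fun _ => s_ k) => // x _; exact: cvg_cst.
have mA k : measurable (A k).
  have /(_ measurableT [set true] I) : measurable_fun setT (fun x => `|s_ k x| <= 2 * `|g x|).
    apply: measurable_fun_ler; first exact: smeas_norm.
    by apply: measurable_funM => //; exact: smeas_norm.
  by rewrite setTI preimage_true.
pose h k := zext (A k) (s_ k).
have hg k x : `|h k x| <= 2 * `|g x|.
  by rewrite /h /zext; case: ifPn => [/set_mem//|_]; rewrite normr0 mulr_ge0.
have mh k : smeas (h k) by exact: smeas_indic.
have sh k : simple setT (h k) by apply: simple_zext => //; exact: simple_subset.
have mg2 := smeas_sqr_norm mg.
have ch k : translation_continuous (h k).
  apply: translation_continuous_simple => // y y0.
  (* Chebyshev: where [h k] equals [y], [|y| <= 2 * |g x|], that is [c <= |g x| ^+ 2]. *)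
  pose c := `|y| ^+ 2 / 4.
  have c0 : 0 < c by rewrite divr_gt0// exprn_gt0// normr_gt0.
  have mL : measurable (h k @^-1` [set y]) by rewrite -[_ @^-1` _]setTI; exact: (sh k).2.
  have : (c%:E * mu (h k @^-1` [set y]) < +oo)%E.
    apply: le_lt_trans g2; rewrite -[X in mu X]setIT -integral_indic//.
    rewrite -ge0_integralZl_EFin ?(ltW c0)//; last exact/measurable_EFinP.
    apply: ge0_le_integral => //.
    - by move=> x _; rewrite -EFinM lee_fin mulr_ge0// ltW.
    - by apply: measurable_funeM; exact/measurable_EFinP.
    move=> x _; rewrite -EFinM lee_fin indicE.
    have [xy|xy] := pselect (h k x = y); last by rewrite memNset//= mulr0 sqr_ge0.
    rewrite mem_set//= mulr1 /c -xy.
    have : `|h k x| ^+ 2 <= (2 * `|g x|) ^+ 2 by rewrite ler_pXn2r// nnegrE// mulr_ge0.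
    by rewrite exprMn; move: (`|_| ^+ 2) (`|_| ^+ 2) => a b; lra.
  case: (mu _) (measure_ge0 mu (h k @^-1` [set y])) => [r _ _|_|//]; first exact: ltry.
  by rewrite gt0_muley.
(* The cut-off does not disturb the limit: where [g x = 0] it forces [h k x = 0], and elsewhere
   [|s_ k x| < 2 * |g x|] for large [k]. *)
have cvh x : h k x @[k --> \oo] --> g x.
  have sgx : s_ k x @[k --> \oo] --> g x by exact: sg.
  have [g0|g0] := eqVneq (g x) 0.
    apply: (cvg_trans _ (_ : (fun=> 0 : B) k @[k --> \oo] --> g x)); last first.
      by rewrite g0; exact: cvg_cst.
    apply: near_eq_cvg; apply: nearW => k.
    by apply/esym/eqP; rewrite -normr_le0 (le_trans (hg k x))// g0 normr0 mulr0.
  apply: cvg_trans sgx; apply: near_eq_cvg.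
  have n2 : `|g x| < 2 * `|g x| by rewrite ltr_pMl ?normr_gt0// ltr1n.
  have : \forall k \near \oo, `|s_ k x| < 2 * `|g x|.
    have : `|s_ k x| @[k --> \oo] --> `|g x| by apply: cvg_norm; exact: sg.
    move=> /cvgr_lt; exact.
  by apply: filterS => k hk; rewrite /h /zext mem_set//; exact: ltW.
have [|||||_ _] := @dominated_convergence _ _ _ mu setT measurableT
  (fun k x => (`|g x - h k x| ^+ 2)%:E) (fun=> 0%E) (fun x => (9%:E * (`|g x| ^+ 2)%:E)%E).
- by move=> k; apply: smeas_sqr_norm; exact: smeasB.
- by [].
- apply: aeW => x _; apply: cvg_EFin; first exact: nearW.
  have -> : 0 = `|g x - g x| ^+ 2 :> R by rewrite subrr normr0 expr0n.
  rewrite (_ : _ \o _ = (fun k => `|g x - h k x| ^+ 2))//.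
  under eq_fun do rewrite expr2; rewrite expr2.
  by apply: cvgM; apply: cvg_norm; apply: cvgB => //; exact: cvg_cst.
- apply/integrableP; split; first exact: measurable_funeM.
  under eq_integral do rewrite gee0_abs ?mule_ge0//.
  by rewrite ge0_integralZl_EFin// lte_mul_pinfty.
- apply: aeW => x k _; rewrite gee0_abs// -EFinM lee_fin.
  have h3 : `|g x - h k x| <= 3 * `|g x|.
    by rewrite (le_trans (ler_normB _ _))//; have := hg k x; lra.
  have : `|g x - h k x| ^+ 2 <= (3 * `|g x|) ^+ 2 by rewrite ler_pXn2r// nnegrE// mulr_ge0.
  by rewrite exprMn; move: (`|_| ^+ 2) (`|_| ^+ 2) => a b; lra.
rewrite integral0 => /fine_cvgP[fi /cvgrPdist_le /(_ e e0) dc'].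
near \oo => k; exists (h k); split => //.
rewrite -[leLHS]fineK; last by near: k.
rewrite lee_fin; have : `|0 - fine (\int[mu]_x (`|g x - h k x| ^+ 2)%:E)%E| <= e by near: k.
by rewrite sub0r normrN; exact: le_trans (ler_norm _).
Unshelve. all: by end_near. Qed.

End continuity.
End translation.

(** * Integrals of non-measurable functions and Bochner integrals *)

Section almost_everywhere.
Context d (X : measurableType d) (R : realType) (mu : {measure set X -> \bar R}).
Implicit Types P Q : X -> Prop.

Lemma ae_mono P Q :
  (forall x, P x -> Q x) -> {ae mu, forall x, P x} -> {ae mu, forall x, Q x}.
Proof. by move=> PQ; apply: filterS. Qed.

Lemma ae_and P Q : {ae mu, forall x, P x} -> {ae mu, forall x, Q x} ->
  {ae mu, forall x, P x /\ Q x}.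
Proof. by move=> HP HQ; apply: filterS2 HP HQ => x. Qed.

End almost_everywhere.

Section lower_integral.
Context d (X : measurableType d) (R : realType) (mu : {measure set X -> \bar R}).
Local Open Scope ereal_scope.

(* For a nonnegative function that is not measurable, the integral of the
   library is the lower integral, which is still monotone. *)
Lemma ge0_le_lower_integral (D E : set X) (G h : X -> \bar R) : E `<=` D ->
  (forall x, E x -> 0 <= G x) -> (forall x, D x -> 0 <= h x) ->
  (forall x, E x -> G x <= h x) -> \int[mu]_(x in E) G x <= \int[mu]_(x in D) h x.
Proof.
move=> ED G0 h0 Gh; rewrite integral_mkcond [leRHS]integral_mkcond.
rewrite !ge0_integralTE; last 2 first.
- by move=> x; apply: erestrict_ge0 => //.
- by move=> x; apply: erestrict_ge0 => //.
apply: ereal_sup_le => _ [k /= kG <-]; exists k => //= x.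
apply: (le_trans (kG x)); rewrite !patchE; case: ifPn => [/set_mem Ex|_].
  by rewrite mem_set; [exact: Gh|exact: ED].
by case: ifPn => // /set_mem; exact: h0.
Qed.

(** Only the smaller function is measurable: the null set can be removed from its integral, and the
    lower integral on the right is monotone. *)
Lemma ge0_ae_le_lower_integral (D : set X) (G h : X -> \bar R) :
  measurable D -> measurable_fun D G ->
  (forall x, D x -> 0 <= G x) -> (forall x, D x -> 0 <= h x) ->
  {ae mu, forall x, D x -> G x <= h x} ->
  \int[mu]_(x in D) G x <= \int[mu]_(x in D) h x.
Proof.
move=> mD mG G0 h0 [N [mN N0 sN]].
rewrite (ge0_negligible_integral mN)//; apply: ge0_le_lower_integral => //.
- by move=> x [Dx _]; exact: G0.
- by move=> x [Dx Nx]; apply: contrapT => h'; apply: Nx; apply: sN => /= /(_ Dx).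
Qed.

Import HBNNSimple.

(** Here only the larger function is measurable: every nonnegative simple function below the
    restriction of [h] is almost everywhere below that of [G]. *)
Lemma ge0_ae_lower_integral_le (D : set X) (h G : X -> \bar R) :
  measurable D -> measurable_fun D G ->
  (forall x, D x -> 0 <= h x) -> (forall x, D x -> 0 <= G x) ->
  {ae mu, forall x, D x -> h x <= G x} ->
  \int[mu]_(x in D) h x <= \int[mu]_(x in D) G x.
Proof.
move=> mD mG h0 G0 hG; rewrite integral_mkcond [leRHS]integral_mkcond.
rewrite [leLHS]ge0_integralTE; last by move=> x; exact: erestrict_ge0.
apply: ge_ereal_sup => _ [k /= kh <-].
rewrite -integralT_nnsfun; apply: ae_ge0_le_integral => //.
- by move=> x _; rewrite lee_fin.
- exact/measurable_EFinP.
- by move=> x _; exact: erestrict_ge0.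
- by apply/measurable_restrict => //; rewrite setTI.
apply: filterS hG => x hGx _; apply: (le_trans (kh x)).
by rewrite !patchE; case: ifPn => // /set_mem; exact: hGx.
Qed.

Lemma integral_vanish (D : set X) (F : X -> \bar R) :
  (forall x, ~ D x -> F x = 0) -> \int[mu]_(x in D) F x = \int[mu]_x F x.
Proof.
move=> F0; rewrite integral_mkcond; congr integral; apply/funext => x.
by rewrite patchE; case: ifPn => //; rewrite notin_setE => /F0.
Qed.

End lower_integral.

(** * Pairings with a fixed vector and scalar evaluation of Bochner integrals *)

Section dual_evaluation.
Context (R : realType) (V : normedModType R).

Lemma dual_le (f : dual V) (v : V) : `|f v| <= `|f| * `|v|.
Proof.
have [->|v0] := eqVneq v 0.
  by have := dual_scale f 0 0; rewrite scale0r mul0r => ->; rewrite !normr0 mulr0.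
have nv : 0 < `|v| by rewrite normr_gt0.
rewrite -ler_pdivrMr// mulrC -[X in X * _]ger0_norm ?invr_ge0//.
rewrite -normrM -dual_scale; apply: dual_norm_ub.
by rewrite normrZ ger0_norm ?invr_ge0// mulVf// gt_eqF.
Qed.

Lemma dual_norm_bound (f : dual V) (M : R) :
  0 <= M -> (forall v, `|f v| <= M * `|v|) -> `|f| <= M.
Proof.
move=> M0 fM; apply: dual_norm_le => v v1; apply: (le_trans (fM v)).
by rewrite ler_piMr.
Qed.

Lemma dual_eval_sum (I : Type) (s : seq I) (F : I -> dual V) (v : V) :
  (\sum_(k <- s) F k) v = \sum_(k <- s) F k v.
Proof. by elim/big_rec2: _ => // k y1 y2 _ <-. Qed.

Lemma cvg_dual_eval (T : Type) (F : set_system T) {FF : Filter F}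
    (f_ : T -> dual V) (v_ : T -> V) (f : dual V) (v : V) :
  f_ x @[x --> F] --> f -> v_ x @[x --> F] --> v ->
  f_ x (v_ x) @[x --> F] --> (f v : R).
Proof.
move=> ff vv.
have lin := (dualP f).1; have cf := (dualP f).2.
have -> : (fun x => f_ x (v_ x)) = (fun x => (f_ x - f) (v_ x) + f (v_ x)).
  by apply/funext => x; rewrite dualDE dualNE subrK.
rewrite -[f v]add0r; apply: cvgD; last exact: (cvg_comp v_ f vv (cf v)).
have : `|f_ x - f| * `|v_ x| @[x --> F] --> 0 * `|v|.
  apply: cvgM; last exact: cvg_norm.
  by rewrite -[0](@normr0 _ (dual V)) -(subrr f); apply: cvg_norm; apply: cvgB => //;
    exact: cvg_cst.
rewrite mul0r => h; apply/norm_cvg0P.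
apply: (squeeze_cvgr _ _ h); last exact: cvg_cst.
by apply: nearW => x; rewrite normr_ge0 dual_le.
Qed.

Lemma smeas_pairing d (X : measurableType d) (g : X -> dual V) (w : X -> V) :
  smeas g -> smeas w -> measurable_fun setT (fun x => g x (w x)).
Proof.
move=> mg mw; apply: (@smeas_measurable _ _ _ (fun x => g x (w x) : R^o)).
apply: (@smeas_op2 _ _ _ (dual V) V R^o (fun (f : dual V) v => f v)) => //.
by move=> u v b c ub vc; exact: cvg_dual_eval.
Qed.

End dual_evaluation.

Section bochner_evaluation.
Context d (X : measurableType d) (R : realType) (V : normedModType R).
Variables (mu : {measure set X -> \bar R}) (D : set X).
Hypothesis mD : measurable D.
Implicit Types (s f : X -> dual V).

(** Both integrals are sums over the finitely many values of [s]. The value 0 is treated apart,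
    since its level set may have infinite measure. *)
Lemma simple_integral_eval s (v : V) : integrable_simple mu D s ->
  mu.-integrable D (EFin \o (fun x => s x v)) /\
  \int[mu]_(x in D) s x v = simple_integral mu D s v.
Proof.
move=> [[fs ms] sfin].
have /finite_seqP[r0 sr] := fs.
pose r := undup r0.
have {}sr : s @` D = [set` r].
  by rewrite sr; apply/seteqP; split => x /=; rewrite mem_undup.
pose L y := D `&` s @^-1` [set y].
pose F (y : dual V) x : \bar R := ((y v)%:E * (\1_(L y) x)%:E)%E.
have iF y : mu.-integrable D (F y).
  have [->|y0] := eqVneq y 0.
    rewrite /F; under eq_fun do rewrite mul0e.
    exact: integrable0.
  apply: integrableZl => //; apply/integrableP; split.
    by apply/measurable_EFinP/measurable_indic; exact: ms.
  under eq_integral do rewrite gee0_abs ?lee_fin//.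
  rewrite integral_indic//; last exact: ms.
  by rewrite /L setIAC setIid; exact: sfin.
have sE x : D x -> (s x v)%:E = (\sum_(y <- r) F y x)%E.
  move=> Dx; rewrite (bigD1_seq (s x)) ?undup_uniq//=; last first.
    by have : [set` r] (s x) by rewrite -sr; exists x.
  rewrite /F indicE mem_set// mule1 big1 ?adde0// => y /eqP yx.
  by rewrite indicE memNset ?mule0// => -[_ /= yE]; apply: yx.
have iS : mu.-integrable D (EFin \o (fun x => s x v)).
  apply: (@eq_integrable _ _ _ _ _ mD (fun x => \sum_(y <- r) F y x)%E).
    by move=> x /set_mem Dx; rewrite -sE.
  exact: integrable_sum.
split=> //; rewrite /simple_integral sr -fsbig_seq ?undup_uniq// dual_eval_sum.
rewrite /Rintegral (eq_integral (fun x => \sum_(y <- r) F y x)%E); last first.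
  by move=> x /set_mem Dx; rewrite sE.
rewrite integral_sum//.
rewrite (eq_bigr (fun y => ((fine (mu (L y)) *: y) v)%:E)) ?sumEFin// => y _.
have [->|y0] := eqVneq y 0.
  by rewrite /F scaler0; under eq_integral do rewrite mul0e; rewrite integral0.
rewrite integralZl//; last first.
  apply/integrableP; split.
    by apply/measurable_EFinP/measurable_indic; exact: ms.
  under eq_integral do rewrite gee0_abs ?lee_fin//.
  rewrite integral_indic//; last exact: ms.
  by rewrite /L setIAC setIid; exact: sfin.
rewrite integral_indic//; last exact: ms.
rewrite /L setIAC setIid dualZE mulrC EFinM fineK//.
by rewrite ge0_fin_numE//; exact: sfin.
Qed.

(* F is a measurable version of the scalar function x |-> (f x)(v): f itself is
   only equal to a measurable function almost everywhere. *)
Lemma bochner_eval f I (v : V) (F : X -> R) : is_bochner_integral mu D f I ->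
  measurable_fun D F -> {ae mu, forall x, D x -> f x v = F x} ->
  mu.-integrable D (EFin \o F) /\ \int[mu]_(x in D) F x = I v.
Proof.
move=> [s_ [sint _ sf sI]] mF fF.
have sE n := simple_integral_eval v (sint n).
have iF n : measurable_fun D (fun x => `|F x - s_ n x v|%:E).
  apply/measurable_EFinP; apply: measurableT_comp => //.
  apply: measurable_funB => //.
  by have [/integrableP[/measurable_EFinP]] := sE n.
pose c := `|v| + 1.
have c0 : 0 < c by rewrite ltr_wpDl.
pose err n := (\int[mu]_(x in D) `|F x - s_ n x v|%:E)%E.
(* The integrand on the left is [|(f x - s_ n x) v|] almost everywhere, at most
   [|f x - s_ n x| * |v|]; the [+ 1] in [c] permits division when [v = 0]. The integral on the right
   may be a lower integral, so measurability is available on the left only. *)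
have Fle n : (err n <= c%:E * \int[mu]_(x in D) `|f x - s_ n x|%:E)%E.
  rewrite -lee_pdivrMl// -ge0_integralZl_EFin ?invr_ge0 ?(ltW c0)//.
  apply: ge0_ae_le_lower_integral => //.
  - exact: measurable_funeM.
  - by move=> x _; rewrite -EFinM lee_fin mulr_ge0// invr_ge0 ltW.
  apply: filterS fF => x fx Dx; rewrite -EFinM lee_fin -fx// ler_pdivrMl//.
  rewrite -[f x v - _]/((f x - s_ n x) v) mulrC.
  apply: (le_trans (dual_le _ _)); by rewrite ler_wpM2l// lerDl.
have err0 : err n @[n --> \oo] --> 0%E.
  have h : (c%:E * \int[mu]_(x in D) `|f x - s_ n x|%:E)%E @[n --> \oo] --> 0%E.
    by rewrite -[X in _ --> X](mule0 c%:E); apply: cvgeZl.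
  apply: (squeeze_cvge _ (cvg_cst 0%E) h).
  by apply: nearW => n; rewrite Fle integral_ge0.
have /fine_cvgP[/= errfin err0'] := err0.
(* A single [n] with finite [err n] suffices: [F] is then an integrable function plus the integrable
   [s_ n x v]. *)
have intF : mu.-integrable D (EFin \o F).
  near \oo => n.
  have : mu.-integrable D (EFin \o (fun x => F x - s_ n x v)).
    apply/integrableP; split.
      apply/measurable_EFinP; apply: measurable_funB => //.
      by have [/integrableP[/measurable_EFinP]] := sE n.
    by rewrite -ge0_fin_numE ?integral_ge0//; near: n.
  move=> /(integrableD mD)/(_ (sE n).1); apply: eq_integrable => // x _ /=.
  by rewrite -EFinD subrK.
split=> //.
have cv1 : simple_integral mu D (s_ n) v @[n --> \oo] --> I v.
  by apply: cvg_dual_eval => //; exact: cvg_cst.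
suff cv2 : simple_integral mu D (s_ n) v @[n --> \oo] --> \int[mu]_(x in D) F x.
  exact: (cvg_unique _ cv2 cv1).
apply/subr_cvg0/norm_cvg0P.
apply: (squeeze_cvgr _ (cvg_cst 0) err0'); near=> n.
rewrite normr_ge0/=.
rewrite -(sE n).2 -RintegralB//; last exact: (sE n).1.
have iB : mu.-integrable D (EFin \o (fun x => s_ n x v - F x)).
  by move: (integrableB mD (sE n).1 intF); apply: eq_integrable.
apply: (le_trans (le_normr_Rintegral mD iB)).
rewrite /err /Rintegral le_eqVlt; apply/orP; left; apply/eqP; congr fine.
by apply: eq_integral => x _; rewrite distrC.
Unshelve. all: by end_near. Qed.

End bochner_evaluation.

(** * Test functions and the du Bois-Reymond lemma *)

Section smooth_step.
Context (R : realType).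
Implicit Types (f g : R -> R) (x : R).

(** The classical function [exp (- 1 / x)], flat at 0, with the powers of [1 / x] that
    differentiation brings in. *)
Definition flat (n : nat) x : R := if 0 < x then x^-1 ^+ n * expR (- x^-1) else 0.

(* Closed under differentiation, hence all its members are infinitely
   differentiable. *)
Inductive smooth_term : (R -> R) -> Prop :=
| smooth_flat n : smooth_term (flat n)
| smooth_cst c : smooth_term (cst c)
| smoothD f g : smooth_term f -> smooth_term g -> smooth_term (fun x => f x + g x)
| smoothM f g : smooth_term f -> smooth_term g -> smooth_term (fun x => f x * g x)
| smooth_affine f (a b : R) : smooth_term f -> smooth_term (fun x => f (a * x + b))
| smoothV f : (forall x, f x != 0) -> smooth_term f ->
    smooth_term (fun x => (f x)^-1).

(** With [y = 1 / x] and [N = n + 2], [exp y] is the [N]-th power of [exp (y / N) >= y / N]. The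
    order 2 in [x] makes the difference quotient at 0 tend to 0. *)
Lemma flat_bound n x : 0 <= flat n x <= n.+2%:R ^+ n.+2 * x ^+ 2.
Proof.
rewrite /flat; case: ifPn => [x0|_]; last first.
  by rewrite lexx mulr_ge0// ?sqr_ge0.
have [y y0 ->] : exists2 y : R, 0 < y & x = y^-1 by exists x^-1; rewrite ?invr_gt0 ?invrK.
rewrite invrK.
rewrite mulr_ge0 ?exprn_ge0 ?(ltW y0) ?expR_ge0//=.
have yk : y ^+ n.+2 <= n.+2%:R ^+ n.+2 * expR y.
  have e : expR y = expR (y / n.+2%:R) ^+ n.+2.
    by rewrite -expRM_natl; congr expR; rewrite mulrCA divff ?mulr1.
  rewrite e -exprMn lerXn2r// ?nnegrE ?mulr_ge0 ?expR_ge0 ?(ltW y0)//.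
  rewrite -ler_pdivrMl// mulrC (le_trans _ (expR_ge1Dx _))// lerDr//.
rewrite expRN ler_pdivrMr ?expR_gt0// exprVn mulrAC ler_pdivlMr ?exprn_gt0//.
by rewrite -exprD addn2.
Qed.

Lemma is_derive_flat n x :
  is_derive x 1 (flat n) (flat n.+2 x - n%:R * flat n.+1 x).
Proof.
have [x0|x0|->] := ltgtP x 0.
- have -> : flat n.+2 x - n%:R * flat n.+1 x = 0.
    by rewrite /flat ltNge (ltW x0)/= mulr0 subr0.
  apply: (@near_eq_is_derive _ _ _ (cst 0)) => //.
  near=> z; rewrite /flat ltNge (_ : z <= 0)//; apply/ltW; near: z.
  exact: lt_nbhsl.
- have [y0 x0'] : 0 < x^-1 /\ x != 0 by rewrite invr_gt0 gt_eqF.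
  rewrite /flat x0.
  apply: (@near_eq_is_derive _ _ _ ((fun z : R => z^-1 ^+ n * expR (- z^-1)))).
    near=> z; rewrite /flat (_ : 0 < z)//; near: z; exact: lt_nbhsr.
  have dV : is_derive x (1 : R) (fun z : R => z^-1) (- x ^- 2 *: 1) by exact: is_deriveV.
  have dE : is_derive x (1 : R) (fun z : R => expR (- z^-1)) (expR (- x^-1) * x ^- 2).
    have dN : is_derive x (1 : R) (fun z : R => - z^-1) (x ^- 2).
      apply: (is_derive_eq (is_deriveN dV)).
      by rewrite scaleNr opprK; exact: mulr1.
    exact: (@is_derive1_comp _ expR (fun z : R => - z^-1)).
  have dX : is_derive x (1 : R) (fun z : R => z^-1 ^+ n) (- n%:R * x^-1 ^+ n.+1).
    have -> : (fun z : R => z^-1 ^+ n) = (fun z : R => z^-1) ^+ n.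
      by apply/funext => z; rewrite exprfctE.
    apply: (is_derive_eq (is_deriveX n dV)).
    case: n => [|n]; first by rewrite mul0r scale0r oppr0 mul0r.
    by rewrite /GRing.scale/= mulr1 -exprVn mulrN mulNr -mulrA -exprD addn2.
  apply: (is_derive_eq (is_deriveM dX dE)).
  rewrite -exprVn -![_ *: _]/(_ * _); move: (expR (- x^-1)) => E; move: (x^-1) => y;
    rewrite !exprS; move: (y ^+ n) => z; ring.
- have f0 k : flat k 0 = 0 by rewrite /flat ltxx.
  rewrite !f0 mulr0 subr0.
  have h0 : h^-1 *: ((flat n \o shift 0) (h *: (1 : R)) - flat n 0) @[h --> (0 : R)^'] --> (0 : R).
    pose C : R := n.+2%:R ^+ n.+2.
    have C0 : C * `|h| @[h --> (0 : R)^'] --> (0 : R).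
      rewrite -[X in _ --> X](mulr0 C) -[X in _ --> C * X](@normr0 _ R).
      by apply: cvgMr; apply: cvg_norm; exact: nbhs_dnbhs.
    apply/norm_cvg0P; apply: (squeeze_cvgr _ (cvg_cst 0) C0).
    near=> h; rewrite normr_ge0/= f0 subr0 addr0 normrZ normfV.
    have h_neq0 : h != 0 by near: h; exact: nbhs_dnbhs_neq.
    rewrite ler_pdivrMl ?normr_gt0//.
    have /andP[fl0 fl1] := flat_bound n (h *: 1).
    rewrite ger0_norm// (le_trans fl1)//.
    rewrite -(real_normK (num_real _)) /GRing.scale/= mulr1.
    by rewrite le_eqVlt; apply/orP; left; apply/eqP; rewrite /C; ring.
  apply: DeriveDef; first by apply/cvg_ex; exists 0.
  exact: cvg_lim h0.
Unshelve. all: by end_near. Qed.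

Lemma smooth_term_derive f : smooth_term f ->
  exists2 g, smooth_term g & forall x, is_derive x 1 f (g x).
Proof.
elim=> {f} [n|c|f g sf [f' sf' df] sg [g' sg' dg]|f g sf [f' sf' df] sg [g' sg' dg]
  |f a b sf [f' sf' df]|f f0 sf [f' sf' df]].
- exists (fun x => flat n.+2 x + (- n%:R) * flat n.+1 x).
    apply: smoothD; first exact: smooth_flat.
    by apply: smoothM; [exact: smooth_cst|exact: smooth_flat].
  by move=> x; rewrite mulNr; exact: is_derive_flat.
- by exists (cst 0); [exact: smooth_cst|move=> x; exact: is_derive_cst].
- exists (fun x => f' x + g' x); first exact: smoothD.
  by move=> x; exact: is_deriveD.
- exists (fun x => f x * g' x + g x * f' x).
    by apply: smoothD; exact: smoothM.
  by move=> x; exact: is_deriveM.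
- exists (fun x => a * f' (a * x + b)).
    by apply: smoothM; [exact: smooth_cst|exact: smooth_affine].
  move=> x; rewrite mulrC.
  apply: (@is_derive1_comp _ f (fun x => a * x + b)) => //.
  apply: is_derive_eq; rewrite addr0 -[a *: _]/(a * _) mulr1//.
- exists (fun x => - ((f x)^-1 * (f x)^-1) * f' x).
    have -> : (fun x => - ((f x)^-1 * (f x)^-1) * f' x) =
      (fun x => -1 * ((f x)^-1 * (f x)^-1) * f' x) by apply/funext => x; rewrite mulN1r.
    apply: smoothM => //; apply: smoothM; first exact: smooth_cst.
    by apply: smoothM; exact: smoothV.
  move=> x; apply: (is_derive_eq (is_deriveV (f0 x) (df x))).
  by rewrite -exprVn expr2.
Qed.

Lemma smooth_term_derivable f : smooth_term f ->
  forall n x, derivable (f^`(n)%classic) x 1.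
Proof.
move=> sf n; elim: n f sf => [|n IH] f /smooth_term_derive[g sg dfg] x.
  by rewrite derive1n0; by have [] := dfg x.
rewrite derive1Sn (_ : f^`()%classic = g); first exact: IH.
by apply/funext => y; rewrite derive1E; by have [_ ->] := dfg y.
Qed.

(** The usual quotient [f(x) / (f(x) + f(1 - x))], rising from 0 to 1 on [[0, 1]]; [1 - x] is
    written in the form required by [smooth_affine]. *)
Definition smooth_step x : R := flat 0 x * (flat 0 x + flat 0 (- 1 * x + 1))^-1.

Lemma flat0_gt0 x : 0 < x -> 0 < flat 0 x.
Proof. by move=> x0; rewrite /flat x0 mul1r expR_gt0. Qed.

Lemma flat0_ge0 x : 0 <= flat 0 x.
Proof. by have /andP[] := flat_bound 0 x. Qed.

Lemma flat0_eq0 x : x <= 0 -> flat 0 x = 0.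
Proof. by move=> x0; rewrite /flat ltNge x0. Qed.

Lemma smooth_step_den_gt0 x : 0 < flat 0 x + flat 0 (- 1 * x + 1).
Proof.
have [x0|x0] := ltP 0 x; first by rewrite ltr_pwDl ?flat0_gt0 ?flat0_ge0.
by rewrite ltr_wpDl ?flat0_ge0// flat0_gt0//; lra.
Qed.

Lemma smooth_step_smooth : smooth_term smooth_step.
Proof.
apply: smoothM; first exact: smooth_flat.
apply: smoothV => [x|]; first by rewrite gt_eqF ?smooth_step_den_gt0.
by apply: smoothD; [exact: smooth_flat|apply: smooth_affine; exact: smooth_flat].
Qed.

Lemma smooth_step_le0 x : x <= 0 -> smooth_step x = 0.
Proof. by move=> x0; rewrite /smooth_step flat0_eq0// mul0r. Qed.

Lemma smooth_step_ge1 x : 1 <= x -> smooth_step x = 1.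
Proof.
move=> x1; rewrite /smooth_step [flat 0 (_ + _)]flat0_eq0; last lra.
by rewrite addr0 divff// gt_eqF// flat0_gt0//; lra.
Qed.

Lemma smooth_step_bounds x : 0 <= smooth_step x <= 1.
Proof.
rewrite /smooth_step divr_ge0 ?flat0_ge0 ?(ltW (smooth_step_den_gt0 x))//=.
by rewrite ler_pdivrMr ?smooth_step_den_gt0// mul1r lerDl flat0_ge0.
Qed.

(** These properties make the rescalings of [rho] an approximate identity. Outside [[0, 1]] the step
    is locally constant; the bound [K] is the maximum of [|rho|] on [[0, 1]]. *)
Lemma smooth_step_derive : exists rho : R -> R,
  [/\ forall x, is_derive x 1 smooth_step (rho x), continuous rho,
      forall x, x < 0 \/ 1 < x -> rho x = 0 &
      exists K, forall x, `|rho x| <= K].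
Proof.
have [rho srho drho] := smooth_term_derive smooth_step_smooth.
have crho : continuous rho.
  move=> x; have [drho' _ /(_ x) d] := smooth_term_derive srho.
  by apply: differentiable_continuous; apply/derivable1_diffP; by have [] := d.
have rho0 x : x < 0 \/ 1 < x -> rho x = 0.
  move=> x01; have [_ <-] := drho x.
  have d c : (\near x, smooth_step x = cst c x) -> 'D_1 smooth_step x = 0.
    by move=> h; rewrite (near_eq_derive _ h) derive_cst.
  case: x01 => x0.
    apply: (d 0); near=> z; rewrite smooth_step_le0//; apply/ltW; near: z; exact: lt_nbhsl.
  apply: (d 1); near=> z; rewrite smooth_step_ge1//; apply/ltW; near: z; exact: lt_nbhsr.
exists rho; split => //.
have [|c _ cmax] := @EVT_max _ (fun x => `|rho x|) 0 1 ler01.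
  apply: continuous_subspaceT => x; apply: continuous_comp; [exact: crho|exact: norm_continuous].
exists `|rho c| => x.
have [x0|x0] := ltP x 0; first by rewrite rho0 ?normr0//; left.
have [x1|x1] := ltP 1 x; first by rewrite rho0 ?normr0//; right.
by apply: cmax; rewrite in_itv/= x0.
Unshelve. all: by end_near. Qed.

End smooth_step.

(** * Increments of a continuous function from its weak derivative *)

Section du_bois_reymond.
Context (R : realType).
Notation mu := (@lebesgue_measure R).
Variable rho : R -> R.
Hypothesis drho : forall x : R, is_derive x 1 (@smooth_step R) (rho x).
Hypothesis crho : continuous rho.
Hypothesis rho0 : forall x, x < 0 \/ 1 < x -> rho x = 0.
Variable K : R.
Hypothesis rhoK : forall x, `|rho x| <= K.

(** The smooth step transported to [[a, a + e]]. Its derivative [kernel] lives on that interval, has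
    integral 1 and is bounded by [K / e]. *)
Let step (a e x : R) : R := smooth_step (e^-1 * x + (- (e^-1 * a))).
Let kernel (a e x : R) : R := rho (e^-1 * x + (- (e^-1 * a))) * e^-1.

Let is_derive_step a e x : is_derive x (1 : R) (step a e) (kernel a e x).
Proof.
rewrite /step /kernel; move: (- (e^-1 * a)) => b.
apply: (@is_derive1_comp _ (@smooth_step R) (fun x => e^-1 * x + b)) => //.
by apply: is_derive_eq; rewrite addr0 -[_ *: _]/(_ * _) mulr1.
Qed.

Let kernel_continuous a e : continuous (kernel a e).
Proof.
move=> x; apply: cvgM; last exact: cvg_cst.
apply: (@continuous_comp _ _ _ (fun x => e^-1 * x + - (e^-1 * a)) rho); last exact: crho.
by apply: cvgD; [apply: cvgM; [exact: cvg_cst|exact: cvg_id]|exact: cvg_cst].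
Qed.

Let kernel_out a e x : 0 < e -> ~ `[a, a + e]%classic x -> kernel a e x = 0.
Proof.
move=> e0 /negP; rewrite /= in_itv/= negb_and -!ltNge => h.
rewrite /kernel rho0 ?mul0r//; rewrite -mulrN -mulrDr.
case/orP: h => h; [left|right]; first by rewrite pmulr_rlt0 ?invr_gt0// subr_lt0.
by rewrite -ltr_pdivrMl ?invr_gt0// invrK mulr1; lra.
Qed.

Let step_left a e x : 0 < e -> x <= a -> step a e x = 0.
Proof.
move=> e0 xa; apply: smooth_step_le0; rewrite -mulrN -mulrDr.
by rewrite pmulr_rle0 ?invr_gt0// subr_le0.
Qed.

Let step_right a e x : 0 < e -> a + e <= x -> step a e x = 1.
Proof.
move=> e0 xa; apply: smooth_step_ge1; rewrite -mulrN -mulrDr.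
by rewrite -ler_pdivrMl ?invr_gt0// invrK mulr1; lra.
Qed.

Let kernel_integral a e : 0 < e -> \int[mu]_(x in `[a, a + e]) kernel a e x = 1.
Proof.
move=> e0; rewrite /Rintegral (@continuous_FTC2 _ _ (step a e)).
- by rewrite [step a e a]step_left// step_right// sube0.
- by rewrite ltrDl.
- exact: continuous_subspaceT.
- have cs : continuous (step a e).
    move=> x; apply: differentiable_continuous; apply/derivable1_diffP.
    by have [] := is_derive_step a e x.
  split.
  + by move=> x _; have [] := is_derive_step a e x.
  + exact: cvg_at_right_filter (cs a).
  + exact: cvg_at_left_filter (cs (a + e)).
- by move=> x _; rewrite derive1E; have [_ ->] := is_derive_step a e x.
Qed.

Let within_integrable (f : R -> R) a b : {within `[a, b], continuous f} ->
  mu.-integrable `[a, b] (EFin \o f).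
Proof. by move=> cf; apply: continuous_compact_integrable => //; exact: segment_compact. Qed.

(** As the kernel has integral 1, the difference is the integral of [kernel * (h - c)], over length
    [e] with kernel at most [K / e]. The factor [K] appears because no sign of [rho] is used. *)
Let kernel_approx (a e : R) (h : R -> R) (c eta : R) : 0 < e -> {within `[a, a + e],
  continuous h} ->
  (forall x, x \in `[a, a + e] -> `|h x - c| <= eta) ->
  `|\int[mu]_(x in `[a, a + e]) (kernel a e x * h x) - c| <= K * eta.
Proof.
move=> e0 ch hc.
have ck : {within `[a, a + e], continuous (kernel a e)} by exact: continuous_subspaceT.
have cM (f g : R -> R) : {within `[a, a + e], continuous f} ->
   {within `[a, a + e], continuous g} -> {within `[a, a + e], continuous (fun x => f x * g x)}.
  by move=> cf cg x; apply: cvgM; [exact: cf|exact: cg].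
have cc (r : R) : {within `[a, a + e], continuous (cst r : R -> R)}.
  by apply: continuous_subspaceT; exact: cst_continuous.
have mJ : measurable (`[a, a + e]%classic : set R) by [].
have -> : c = \int[mu]_(x in `[a, a + e]) (kernel a e x * c).
  by rewrite RintegralZr ?kernel_integral ?mul1r//; exact: within_integrable.
rewrite -RintegralB//; last 2 first.
- by apply: within_integrable; exact: cM.
- by apply: within_integrable; exact: (cM _ (cst c)).
under eq_Rintegral do rewrite -mulrBr.
have chc : {within `[a, a + e], continuous (fun x => h x - c)}.
  by move=> x; apply: cvgB; [exact: ch|exact: cc].
have ikh : mu.-integrable `[a, a + e] (EFin \o (fun x => kernel a e x * (h x - c))).
  by apply: within_integrable; exact: cM.
apply: (le_trans (le_normr_Rintegral _ ikh)) => //.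
have -> : K * eta = \int[mu]_(x in `[a, a + e]) (K * e^-1 * eta).
  rewrite Rintegral_cst//= lebesgue_measure_itv/= lte_fin ltrDl e0/=.
  by field; rewrite gt_eqF.
apply: le_Rintegral => //.
- exact: (integrable_norm ikh).
- by apply: within_integrable; exact: cc.
- move=> x xJ; rewrite normrM ler_pM//; last exact: hc.
  rewrite /kernel normrM [`|e^-1|]ger0_norm ?invr_ge0 ?(ltW e0)//.
  by rewrite ler_pM2r ?invr_gt0.
Qed.

Variable T : R.

Let kernel_localize (a e : R) (h : R -> R) : 0 < e -> 0 < a -> a + e < T ->
  \int[mu]_(x in `]0, T[) (kernel a e x * h x) =
  \int[mu]_(x in `[a, a + e]) (kernel a e x * h x).
Proof.
move=> e0 a0 aT; rewrite Rintegral_mkcond [RHS]Rintegral_mkcond.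
apply: eq_Rintegral => x _; rewrite !patchE.
case: ifPn => xT; case: ifPn => xJ //.
  by rewrite kernel_out ?mul0r// => xJ'; move: xJ; rewrite mem_set.
exfalso; move: xT; rewrite notin_setE; apply.
move: xJ; rewrite inE/= !in_itv/= => /andP[ax xe].
by rewrite (lt_le_trans a0 ax) (le_lt_trans xe aT).
Qed.

Variables (h q : R -> R).
Hypothesis ch : {within `[0, T], continuous h}.
Hypothesis iq : mu.-integrable `]0, T[ (EFin \o q).
Hypothesis hq : forall phi : R -> R, test_function T phi ->
  \int[mu]_(x in `]0, T[) (phi^`()%classic x * h x) =
  - \int[mu]_(x in `]0, T[) (phi x * q x).

Let smooth_step_term a e : smooth_term (step a e).
Proof. exact: smooth_affine (smooth_step_smooth R). Qed.

(** A smoothed indicator of []s, t[]: it goes up on [[s + e, s + 2 * e]] and down on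
    [[t - 2 * e, t - e]]. The margins [e] keep the support compact in []0, T[] even when [s = 0] or
    [t = T]. *)
Let phi s t e x : R := step (s + e) e x + -1 * step (t - 2 * e) e x.

Let phi_derive s t e x : (phi s t e)^`()%classic x =
  kernel (s + e) e x - kernel (t - 2 * e) e x.
Proof.
have d1 := is_derive_step (s + e) e x; have d2 := is_derive_step (t - 2 * e) e x.
have := is_deriveB d1 d2.
have -> : step (s + e) e - step (t - 2 * e) e = phi s t e.
  by apply/funext => y; rewrite /phi mulN1r.
by rewrite derive1E => -[_ ->].
Qed.

Let phi_out s t e x : 0 < e -> s + 3 * e <= t -> (x <= s + e) || (t - e <= x) ->
  phi s t e x = 0.
Proof.
move=> e0 st /orP[h1|h1].
  by rewrite /phi !step_left ?mulr0 ?addr0//; lra.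
by rewrite /phi !step_right ?mulr1 ?subrr//; lra.
Qed.

Let phi_test s t e : 0 <= s -> t <= T -> 0 < e -> s + 3 * e <= t ->
  test_function T (phi s t e).
Proof.
move=> s0 tT e0 st; split.
  apply: smooth_term_derivable; apply: smoothD => //.
  by apply: smoothM => //; exact: smooth_cst.
exists (s + e), (t - e); split; [lra|lra|move=> x px].
rewrite leNgt -[_ && _]negbK negb_and negbK -ltNge.
by apply: contraNN px => h'; rewrite phi_out// -?(ltW); case/orP: h' => /ltW -> //; rewrite orbT.
Qed.

Let phi_lhs s t e eta : 0 <= s -> t <= T -> 0 < e -> s + 3 * e <= t ->
  (forall x, 0 <= x <= T -> `|x - s| <= 2 * e -> `|h x - h s| <= eta) ->
  (forall x, 0 <= x <= T -> `|x - t| <= 2 * e -> `|h x - h t| <= eta) ->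
  `|\int[mu]_(x in `]0, T[) ((phi s t e)^`()%classic x * h x) - (h s - h t)| <= 2 * K * eta.
Proof.
move=> s0 tT e0 st hs ht.
have iE a : mu.-integrable `]0, T[ (EFin \o (fun x => kernel a e x * h x)).
  have : mu.-integrable `[0, T] (EFin \o (fun x => kernel a e x * h x)).
    apply: within_integrable => x; apply: cvgM; last exact: ch.
    exact: (@continuous_subspaceT _ _ `[0, T]%classic (kernel a e)).
  by apply: integrableS => //; apply: subset_itvW.
have chJ a : 0 <= a -> a + e <= T -> {within `[a, a + e], continuous h}.
  move=> a0 aT; apply: continuous_subspaceW ch => x /=; rewrite !in_itv/= => /andP[? ?]; lra.
have -> : \int[mu]_(x in `]0, T[) ((phi s t e)^`()%classic x * h x) =
    \int[mu]_(x in `[s + e, s + e + e]) (kernel (s + e) e x * h x) -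
    \int[mu]_(x in `[t - 2 * e, t - 2 * e + e]) (kernel (t - 2 * e) e x * h x).
  under eq_Rintegral do rewrite phi_derive mulrBl.
  by rewrite RintegralB// !kernel_localize//; lra.
have A : `|\int[mu]_(x in `[s + e, s + e + e]) (kernel (s + e) e x * h x) - h s| <= K * eta.
  apply: kernel_approx => //; first by apply: chJ; lra.
  move=> x; rewrite in_itv/= => /andP[x1 x2]; apply: hs; first lra.
  by rewrite ger0_norm; lra.
have B : `|\int[mu]_(x in `[t - 2 * e, t - 2 * e + e]) (kernel (t - 2 * e) e x * h x) - h t| <=
  K * eta.
  apply: kernel_approx => //; first by apply: chJ; lra.
  move=> x; rewrite in_itv/= => /andP[x1 x2]; apply: ht; first lra.
  by rewrite ler0_norm; lra.
move: A B; rewrite !ler_norml => /andP[A1 A2] /andP[B1 B2].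
by apply/andP; split; lra.
Qed.

(** Test with [phi s t e] and let [e] tend to 0. The derivative of [phi] averages [h] near [s] minus
    [h] near [t], while [phi] itself tends to the indicator of []s, t[]. *)
Lemma du_bois_reymond_rho s t : 0 <= s -> s < t -> t <= T ->
  h t - h s = \int[mu]_(x in `]s, t[) q x.
Proof.
move=> s0 st tT.
(* The factor [(t - s) / 3] ensures [s + 3 * e n <= t], so [phi s t (e n)] is a test function for
   every [n]. *)
pose e (n : nat) : R := (t - s) / 3 * n.+1%:R^-1.
have d0 : 0 < (t - s) / 3 by rewrite divr_gt0// subr_gt0.
have e0 n : 0 < e n by rewrite mulr_gt0// invr_gt0.
have e3 n : s + 3 * e n <= t.
  have : e n <= (t - s) / 3 by rewrite /e ger_pMr// invf_le1// ler1n.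
  by lra.
have ecvg : e n @[n --> \oo] --> 0.
  rewrite -[X in _ --> X](mulr0 ((t - s) / 3)); apply: cvgMr; exact: cvg_harmonic.
have K0 : 0 <= K by apply: le_trans (rhoK 0).
have hcont r : 0 <= r <= T -> forall eta, 0 < eta ->
  exists2 d, 0 < d & forall x, 0 <= x <= T -> `|x - r| < d -> `|h x - h r| <= eta.
  move=> rT eta eta0.
  have /subspace_continuousP/(_ r) := ch.
  rewrite /= in_itv/= => /(_ rT) /cvgrPdist_le/(_ _ eta0).
  move=> /nbhs_ballP[d /= dd0 H]; exists d => // x xT xr.
  rewrite distrC; apply: (H x); first by rewrite /ball/= distrC.
  by rewrite /= in_itv.
have lim1 : \int[mu]_(x in `]0, T[) ((phi s t (e n))^`()%classic x * h x) @[n --> \oo] -->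
  h s - h t.
  apply/cvgrPdist_le => eps eps0.
  pose eta := eps / (2 * K + 1).
  have K1 : 0 < 2 * K + 1 by lra.
  have eta0 : 0 < eta by rewrite divr_gt0.
  have [|d1 d10 H1] := hcont s _ _ eta0; first by lra.
  have [|d2 d20 H2] := hcont t _ _ eta0; first by lra.
  near=> n.
  have en1 : 2 * e n < d1.
    have : e n < d1 / 2 by near: n; apply: (cvgr_lt _ ecvg); rewrite divr_gt0.
    by lra.
  have en2 : 2 * e n < d2.
    have : e n < d2 / 2 by near: n; apply: (cvgr_lt _ ecvg); rewrite divr_gt0.
    by lra.
  rewrite distrC; apply: (le_trans (@phi_lhs s t (e n) eta _ _ _ _ _ _)) => //.
  - by move=> x xT xs; apply: H1 => //; exact: le_lt_trans xs en1.
  - by move=> x xT xs; apply: H2 => //; exact: le_lt_trans xs en2.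
  - have -> : eps = (2 * K + 1) * eta by rewrite /eta mulrC divfK// gt_eqF.
    by rewrite ler_pM2r//; lra.
pose qst : R -> R := q \_ `]s, t[.
have phicont n : continuous (phi s t (e n)).
  move=> x; apply: differentiable_continuous; apply/derivable1_diffP.
  by have [/(_ 0) + _] := phi_test s0 tT (e0 n) (e3 n); apply.
have step01 a b x : 0 <= step a b x <= 1 by exact: smooth_step_bounds.
have mq : measurable_fun `]0, T[ q by have /integrableP[/measurable_EFinP] := iq.
have lim2 : \int[mu]_(x in `]0, T[) (phi s t (e n) x * q x) @[n --> \oo] -->
    \int[mu]_(x in `]0, T[) qst x.
  (* Since [|phi| <= 1], [|q|] dominates. Inside []s, t[] the value of [phi] is eventually 1;
     outside it is 0 for every [n]. *)
  have [|||||iqst _] := @dominated_convergence _ _ _ mu `]0, T[%classic (measurable_itv _)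
    (fun n x => (phi s t (e n) x * q x)%:E) (EFin \o qst) (fun x => `|(q x)%:E|%E).
  - move=> n; apply/measurable_EFinP; apply: measurable_funM => //.
    by apply: measurable_funTS; exact: continuous_measurable_fun.
  - apply/measurable_EFinP; apply/measurable_restrict => //.
    by apply: measurable_funS mq => //; exact: subIsetl.
  - apply: aeW => x xT; apply: cvg_EFin; first exact: nearW.
    apply: (cvg_trans _ (_ : (fun n : nat => qst x) n @[n --> \oo] --> qst x)); last exact: cvg_cst.
    apply: near_eq_cvg; rewrite /qst patchE; case: ifPn => xst; last near=> n.
      move: (xst); rewrite inE/= in_itv/= => /andP[sx tx]; near=> n.
      have en1 : e n < (x - s) / 2.
        by near: n; apply: (cvgr_lt _ ecvg); rewrite divr_gt0// subr_gt0.
      have en2 : e n < (t - x) / 2.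
        by near: n; apply: (cvgr_lt _ ecvg); rewrite divr_gt0// subr_gt0.
      by rewrite /phi step_right//; [rewrite step_left//; lra|lra].
    move: (xst); rewrite notin_setE/= in_itv/= => /negP; rewrite negb_and -!leNgt => xst'.
    rewrite phi_out ?mul0r//.
    by have := e0 n; case/orP: xst' => ? ?; apply/orP; [left|right]; lra.
  - exact: integrable_abse.
  - apply: aeW => x n _; rewrite lee_fin normrM ler_piMl// ler_norml.
    have := step01 (s + e n) (e n) x; have := step01 (t - 2 * e n) (e n) x.
    by rewrite /phi => /andP[? ?] /andP[? ?]; apply/andP; split; lra.
  have fq : (\int[mu]_(x in `]0%R, T[) (EFin \o qst) x)%E \is a fin_num.
    exact: integrable_fin_num.
  rewrite -(fineK fq).
  by move=> /fine_cvg.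
have lim3 : \int[mu]_(x in `]0, T[) ((phi s t (e n))^`()%classic x * h x) @[n --> \oo] -->
    - \int[mu]_(x in `]0, T[) qst x.
  under eq_fun => n do rewrite (hq (phi_test s0 tT (e0 n) (e3 n))).
  exact: cvgN.
have lim13 : h s - h t = - \int[mu]_(x in `]0, T[) qst x by exact: (cvg_unique _ lim1 lim3).
rewrite -[h t - h s]opprB lim13 opprK -Rintegral_mkcondr; congr Rintegral.
by apply/setIidPr; apply: subset_itv; rewrite bnd_simp.
Unshelve. all: by end_near. Qed.

End du_bois_reymond.

Lemma du_bois_reymond (R : realType) (T : R) (h q : R -> R) :
  {within `[0, T], continuous h} ->
  lebesgue_measure.-integrable `]0, T[ (EFin \o q) ->
  (forall phi : R -> R, test_function T phi ->
    \int[lebesgue_measure]_(x in `]0, T[) (phi^`()%classic x * h x) =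
    - \int[lebesgue_measure]_(x in `]0, T[) (phi x * q x)) ->
  forall s t, 0 <= s -> s < t -> t <= T ->
  h t - h s = \int[lebesgue_measure]_(x in `]s, t[) q x.
Proof.
have [rho [drho crho rho0 [K rhoK]]] := smooth_step_derive R.
exact: (du_bois_reymond_rho drho crho rho0 rhoK).
Qed.

(** * Weak time derivatives *)

Section L2.
Context d (X : measurableType d) (R : realType).

(** The representative vanishes off [D], so that it can be shifted and integrated over the whole
    space. *)
Lemma in_L2_borel (mu : {measure set X -> \bar R}) (B : normedModType R)
    (D : set X) (f : X -> B) : measurable D -> in_L2 mu D f ->
  exists g, [/\ smeas g, forall x, ~ D x -> g x = 0,
    {ae mu, forall x, D x -> g x = f x} & (\int[mu]_x (`|g x| ^+ 2)%:E < +oo)%E].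
Proof.
move=> mD [/(strongly_measurable_borel mD)[g [mg g0 gf]] f2].
exists g; split => //; apply: le_lt_trans f2.
rewrite -(integral_vanish _ (D := D)); last by move=> x /g0 ->; rewrite normr0 expr0n.
apply: ge0_ae_le_lower_integral => //.
- by apply: measurable_funTS; exact: smeas_sqr_norm.
by apply: filterS gf => x gfx Dx; rewrite gfx// lexx.
Qed.

Lemma L2_integrable (mu : {measure set X -> \bar R}) (D : set X) (f : X -> R) :
  measurable D -> (mu D < +oo)%E -> measurable_fun D f ->
  (\int[mu]_(x in D) (f x ^+ 2)%:E < +oo)%E -> mu.-integrable D (EFin \o f).
Proof.
move=> mD Dfin mf f2; apply/integrableP; split; first exact/measurable_EFinP.
have mf2 : measurable_fun D (fun x => (f x ^+ 2)%:E).
  by apply/measurable_EFinP; exact: measurable_funX.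
apply: (@le_lt_trans _ _ (\int[mu]_(x in D) (1%:E + (f x ^+ 2)%:E))%E).
  apply: ge0_le_integral => //.
  - by apply: measurableT_comp => //; exact/measurable_EFinP.
  - exact: emeasurable_funD.
  - move=> x _; rewrite -EFinD /= lee_fin -(real_normK (num_real (f x))).
    by have := sqr_ge0 (`|f x| - 1); have := sqr_ge0 `|f x|; nra.
rewrite ge0_integralD//; last by move=> x _; rewrite lee_fin sqr_ge0.
by rewrite integral_cst// mul1e lte_add_pinfty.
Qed.

End L2.

Lemma dense_eq0 (R : realType) (V : normedModType R) (D : set V) (f : dual V) :
  dense D -> (forall v, D v -> f v = 0) -> f = 0.
Proof.
move=> dD fD; apply/val_inj/funext => v /=; change (f v = 0).
apply/eqP; rewrite -normr_le0; apply/ler_addgt0Pr => e e0; rewrite add0r.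
have [lf cf] := dualP f.
have /cvgrPdist_lt/(_ e e0)/nbhs_ballP[dl /= dl0 H] := cf v.
have [|w [vw Dw]] := dD (ball v dl) _ (ball_open v dl); first by exists v; exact: ballxx.
have := H _ vw; rewrite (fD _ Dw) subr0 => /ltW; exact.
Qed.

Section weak_derivative_increment.
Context (R : realType).
Notation mu := (@lebesgue_measure R).
Notation RT := (measurableTypeR R).

Lemma dual_eval_L2_integrable (V : normedModType R) (g : RT -> dual V) (v : V) (a b : R) :
  smeas g -> (\int[mu]_x (`|g x| ^+ 2)%:E < +oo)%E ->
  mu.-integrable `]a, b[ (EFin \o (fun x => g x v)).
Proof.
move=> mg g2.
have mgv : measurable_fun [set: RT] (fun x => g x v).
  exact: (smeas_pairing mg (smeas_cst _ v)).
apply: L2_integrable => //.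
- by rewrite /= lebesgue_measure_itv; case: ifP => // _; rewrite -EFinB ltry.
- exact: measurable_funTS.
apply: (@le_lt_trans _ _ (\int[mu]_x ((`|v| ^+ 2)%:E * (`|g x| ^+ 2)%:E))%E); last first.
  rewrite ge0_integralZl_EFin ?sqr_ge0//; last exact: smeas_sqr_norm.
  by rewrite lte_mul_pinfty// lee_fin sqr_ge0.
apply: ge0_le_lower_integral => //.
- by move=> x _; rewrite lee_fin sqr_ge0.
move=> x _; rewrite -EFinM lee_fin -exprMn -[leLHS](real_normK (num_real _)).
by rewrite ler_pXn2r ?nnegrE// ?mulr_ge0// mulrC dual_le.
Qed.

Context (T : R) (V H : hilbertType R) (i : gelfand_triple V H).

(** Evaluated at [v], the pivot embedding turns the weak derivative into that of the scalar function
    [dotp (c r) (i v)]. This function is continuous, so the du Bois-Reymond lemma gives its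
    increments. *)
Lemma time_derivative_increment (u : R -> V) (g : R -> dual V) (c : R -> H)
    (g' : RT -> dual V) :
  is_time_derivative T i u g -> is_H_representative T i u c ->
  smeas g' -> {ae mu, forall x, x \in `]0, T[ -> g' x = g x} ->
  (\int[mu]_x (`|g' x| ^+ 2)%:E < +oo)%E ->
  forall v s t, 0 <= s -> s < t -> t <= T ->
  dotp (c t) (i v) - dotp (c s) (i v) = \int[mu]_(r in `]s, t[) g' r v.
Proof.
move=> [gL2 wg] [cc cu] mg' gg' g'2 v.
pose h r := dotp (c r) (i v); pose q r := g' r v.
have ch : {within `[0, T], continuous h}.
  move=> x; have -> : h = (dotp (i v) : H -> R) \o c by apply/funext => y; exact: dotpC.
  exact: (@continuous_comp (subspace `[0,
    T]%classic) H R^o c (dotp (i v)) x (cc x) (@dotp_continuous R H (i v) _)).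
have iq : mu.-integrable `]0, T[ (EFin \o q) by exact: dual_eval_L2_integrable.
have mq : measurable_fun `]0, T[ q by have /integrableP[/measurable_EFinP] := iq.
have mh : measurable_fun `]0, T[ h.
  apply: (measurable_funS (E := `[0, T]%classic)) => //; first exact: subset_itvW.
  exact: subspace_continuous_measurable_fun.
apply: (@du_bois_reymond _ T h q) => // phi tphi.
have [I [I1 I2]] := wg phi tphi.
have mphi : measurable_fun `]0, T[ phi.
  apply: measurable_funTS; apply: continuous_measurable_fun => x.
  by apply: differentiable_continuous; apply/derivable1_diffP; exact: (tphi.1 0 x).
have mdphi : measurable_fun `]0, T[ (phi^`()%classic).
  apply: measurable_funTS; apply: continuous_measurable_fun => x.
  by apply: differentiable_continuous; apply/derivable1_diffP; exact: (tphi.1 1 x).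
have [||_ ->] := @bochner_eval _ RT R V mu `]0, T[%classic (measurable_itv _) _ _ v
  (fun x => phi^`()%classic x * h x) I1.
- exact: measurable_funM.
- by apply: ae_mono cu => x cux /cux cx; rewrite dualZE /h cx.
have [||_ ->] := @bochner_eval _ RT R V mu `]0, T[%classic (measurable_itv _) _ _ v
  (fun x => phi x * q x) I2.
- exact: measurable_funM.
- by apply: ae_mono gg' => x gx /gx; rewrite dualZE /q => ->.
by rewrite dualNE opprK.
Qed.

End weak_derivative_increment.

Section uniqueness.
Context (R : realType).
Notation mu := (@lebesgue_measure R).
Notation RT := (measurableTypeR R).

(** For fixed [v], Lebesgue differentiation of a vanishing primitive gives [g r v = 0] for almost
    every [r]. Separability provides one null set for a countable dense set of [v], and [g r] is
    continuous. *)
Lemma increments_eq0_ae (V : normedModType R) (T : R) (g : RT -> dual V) :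
  separable_space V -> smeas g -> (\int[mu]_x (`|g x| ^+ 2)%:E < +oo)%E ->
  (forall v s t, 0 <= s -> s < t -> t <= T -> \int[mu]_(r in `]s, t[) g r v = 0) ->
  {ae mu, forall r, r \in `]0, T[ -> g r = 0}.
Proof.
move=> [D /pcard_surjP[e De] dD] mg g2 ginc.
have H v : {ae mu, forall r, r \in `]0, T[ -> g r v = 0}.
  pose q r := g r v.
  have iq a b : mu.-integrable `]a, b[ (EFin \o q) by exact: dual_eval_L2_integrable.
  have iq0 y : mu.-integrable [set` Interval (BLeft 0) (BRight y)] (EFin \o q).
    apply: integrableS (iq (-1) (y + 1)) => //.
    by move=> x /=; rewrite !in_itv/= => /andP[? ?]; lra.
  have mq : measurable_fun [set: R] q.
    exact: (smeas_pairing mg (smeas_cst _ v)).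
  have lq : locally_integrable [set: R] q.
    split => //; first exact: openT.
    move=> K _ cK.
    have [M [Mr KM]] := compact_bounded cK.
    have := integrable_abse (iq (- (`|M| + 2)) (`|M| + 2)).
    move=> /integrableP[_]; apply: le_lt_trans; apply: ge0_le_lower_integral => //.
    - move=> x Kx; have : `|x| <= `|M| + 1.
        by apply: (KM (`|M| + 1)) => //; rewrite (le_lt_trans (ler_norm M))// ltrDl.
      by rewrite ler_norml /= in_itv/= => /andP[? ?]; apply/andP; split; lra.
    - by move=> x _ /=; rewrite normr_id.
  apply: ae_mono (FTC1 iq0 lq) => r + rT.
  move: (rT); rewrite in_itv/= => /andP[r0 rT'].
  move=> /(_ _)[|_ qr]; first by rewrite lte_fin.
  rewrite -[g r v]/(q r) -qr.
  rewrite derive1E (near_eq_derive _ (g := cst 0)) ?derive_cst//.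
  near=> x.
  have x0 : 0 < x by near: x; exact: lt_nbhsr.
  have xT : x < T by near: x; exact: lt_nbhsl.
  rewrite -Rintegral_itv_obnd_cbnd; last first.
    by apply: integrableS (iq0 x) => //; move=> y /=; rewrite !in_itv/= => /andP[/ltW -> ->].
  by rewrite -Rintegral_itv_bndo_bndc//; apply: ginc => //; exact: ltW.
have : {ae mu, forall r, forall n, r \in `]0, T[ -> g r (e n) = 0} by apply: ae_foralln => n;
  exact: H.
apply: ae_mono => r gr rT; apply: (dense_eq0 dD) => v /De[n _ <-]; exact: gr.
Unshelve. all: by end_near. Qed.

End uniqueness.

(** * The energy inequality *)

Lemma ae_le_Rintegral d (X : measurableType d) (R : realType)
    (mu : {measure set X -> \bar R}) (D : set X) (f1 f2 : X -> R) :
  measurable D -> mu.-integrable D (EFin \o f1) -> mu.-integrable D (EFin \o f2) ->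
  {ae mu, forall x, D x -> f1 x <= f2 x} ->
  \int[mu]_(x in D) f1 x <= \int[mu]_(x in D) f2 x.
Proof.
move=> mD i1 i2 f12; rewrite -subr_ge0 -RintegralB//.
have [/integrableP[/measurable_EFinP m1 _] /integrableP[/measurable_EFinP m2 _]] := (i1, i2).
rewrite /Rintegral (ae_eq_integral (fun x => `|(f2 x - f1 x)%:E|%E))//.
- by rewrite fine_ge0// integral_ge0.
- by apply/measurable_EFinP; exact: measurable_funB.
- by apply: measurableT_comp => //; apply/measurable_EFinP; exact: measurable_funB.
- by apply: ae_mono f12 => x h Dx; rewrite gee0_abs// lee_fin subr_ge0 h.
Qed.

Section energy.
Context (R : realType).
Notation mu := (@lebesgue_measure R).
Notation RT := (measurableTypeR R).

Lemma L2_integrable_sqr (B : normedModType R) (g : RT -> B) (D : set RT) :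
  measurable D -> smeas g -> (\int[mu]_x (`|g x| ^+ 2)%:E < +oo)%E ->
  mu.-integrable D (EFin \o (fun x => `|g x| ^+ 2)).
Proof.
move=> mD mg g2; apply: (integrableS measurableT) => //; apply/integrableP; split.
  exact: smeas_sqr_norm.
rewrite (eq_integral (fun x => (`|g x| ^+ 2)%:E))// => x _.
by rewrite gee0_abs//= lee_fin sqr_ge0.
Qed.

Lemma L2_integrable_sqr_sub (B : normedModType R) (g : RT -> B) (b : B) (D : set RT) :
  measurable D -> (mu D < +oo)%E -> smeas g -> (\int[mu]_x (`|g x| ^+ 2)%:E < +oo)%E ->
  mu.-integrable D (EFin \o (fun x => `|g x - b| ^+ 2)).
Proof.
move=> mD Dfin mg g2.
have : mu.-integrable D (fun x => (2%:E * (`|g x| ^+ 2)%:E + (2 * `|b| ^+ 2)%:E)%E).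
  apply: integrableD => //; first by apply: integrableZl => //; exact: L2_integrable_sqr.
  apply/integrableP; split => //.
  by rewrite integral_cst// lte_mul_pinfty.
apply: le_integrable => //.
  by apply: measurable_funTS; apply: smeas_sqr_norm; apply: smeasB => //; exact: smeas_cst.
move=> x _; rewrite !gee0_abs//= -?EFinM -?EFinD ?lee_fin.
  by rewrite -[`|b|]normrN sqr_normD_le.
by rewrite addr_ge0// mulr_ge0// sqr_ge0.
Qed.

Lemma pairing_integrable (V : normedModType R) (g : RT -> dual V) (w : RT -> V) (D : set RT) :
  measurable D -> smeas g -> smeas w -> (\int[mu]_x (`|g x| ^+ 2)%:E < +oo)%E ->
  (\int[mu]_x (`|w x| ^+ 2)%:E < +oo)%E ->
  mu.-integrable D (EFin \o (fun x => g x (w x))).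
Proof.
move=> mD mg mw g2 w2.
have : mu.-integrable D (fun x => ((`|g x| ^+ 2)%:E + (`|w x| ^+ 2)%:E)%E).
  by apply: integrableD => //; exact: L2_integrable_sqr.
apply: le_integrable => //.
  by apply/measurable_EFinP; apply: measurable_funTS; exact: smeas_pairing.
move=> x _; rewrite -EFinD [leRHS]gee0_abs ?lee_fin ?addr_ge0 ?sqr_ge0//.
apply: (le_trans (dual_le _ _)).
by move: `|g x| `|w x| (normr_ge0 (g x)) (normr_ge0 (w x)) => a b; nra.
Qed.

(** Substitute [x = y + r] with [y] in []- h, 0[] and exchange: for fixed [y], integrating over [r]
    gives a translation error. *)
Lemma oscillation_tonelli (B : normedModType R) (g : RT -> B) (h : R) : smeas g ->
  measurable_fun setT (fun r : RT => \int[mu]_(x in `](r - h)%R, r[) (`|g x - g r| ^+ 2)%:E)%E /\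
  (\int[mu]_r (\int[mu]_(x in `](r - h)%R, r[) (`|g x - g r| ^+ 2)%:E) =
   \int[mu]_(y in `](- h)%R, 0%R[) translation_error g (- y)%R)%E.
Proof.
move=> mg.
pose J : set RT := `]- h, 0[%classic.
pose F (p : RT * RT) : \bar R := (\1_J p.2 * (`|g (p.2 + p.1) - g p.1| ^+ 2))%:E.
have mF : measurable_fun setT F.
  apply/measurable_EFinP; apply: measurable_funM.
    have m1J : measurable_fun setT (\1_J : RT -> R) by apply: measurable_indic;
      exact: measurable_itv.
    exact: (measurableT_comp m1J (@measurable_snd _ _ RT RT)).
  apply: measurable_funX; apply: smeas_norm; apply: smeasB.
    apply: (smeas_comp (h := fun p : RT * RT => p.2 + p.1 : RT)) => //.
    by apply: measurable_funD;
      [exact: (@measurable_snd _ _ RT RT)|exact: (@measurable_fst _ _ RT RT)].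
  exact: (smeas_comp (@measurable_fst _ _ RT RT)).
have F0 p : (0 <= F p)%E by rewrite lee_fin mulr_ge0// sqr_ge0.
have FE r : (\int[mu]_(x in `](r - h)%R, r[) (`|g x - g r| ^+ 2)%:E = \int[mu]_y F (r, y))%E.
  rewrite -(@ge0_integral_translation _ r (fun y => F (r, y)))//; last first.
    exact: (measurableT_comp mF).
  rewrite integral_mkcond; apply: eq_integral => x _; rewrite /F/= subrK patchE indicE.
  have -> : (x - r \in J) = (x \in `]r - h, r[%classic).
    by apply/idP/idP => /set_mem; rewrite /J/= in_itv/= => /andP[? ?]; apply/mem_set;
      rewrite /= in_itv/=; apply/andP; split; lra.
  by case: ifPn => _; rewrite ?mul1r ?mul0r.
split.
  under eq_fun do rewrite FE.
  exact: measurable_fun_fubini_tonelli_F.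
under eq_integral do rewrite FE.
rewrite (fubini_tonelli F mF F0) [RHS]integral_mkcond; apply: eq_integral => y _.
rewrite patchE /F/= indicE.
case: ifPn => yJ; last by under eq_integral do rewrite mul0r; rewrite integral0.
by rewrite /translation_error; apply: eq_integral => r _; rewrite mul1r opprK [y + r]addrC.
Qed.

End energy.

Lemma integrable_addr d (X : measurableType d) (R : realType)
    (mu : {measure set X -> \bar R}) (D : set X) (f1 f2 : X -> R) :
  measurable D -> mu.-integrable D (EFin \o f1) -> mu.-integrable D (EFin \o f2) ->
  mu.-integrable D (EFin \o (fun x => f1 x + f2 x)).
Proof. by move=> mD i1 i2; exact: (integrableD mD i1 i2). Qed.

Lemma integrable_mulr d (X : measurableType d) (R : realType)
    (mu : {measure set X -> \bar R}) (D : set X) (a : R) (f : X -> R) :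
  measurable D -> mu.-integrable D (EFin \o f) ->
  mu.-integrable D (EFin \o (fun x => a * f x)).
Proof. by move=> mD i1; exact: (integrableZl mD a i1). Qed.

Lemma integrable_cst_fin d (X : measurableType d) (R : realType)
    (mu : {measure set X -> \bar R}) (D : set X) (k : R) :
  measurable D -> (mu D < +oo)%E -> mu.-integrable D (EFin \o (fun _ => k)).
Proof.
move=> mD Dfin; apply/integrableP; split.
  by apply/measurable_EFinP; exact: measurable_cst.
rewrite (_ : (\int[mu]_(x in D) `|(EFin \o (fun=> k)) x| = \int[mu]_(x in D) `|k|%:E)%E)//.
by rewrite integral_cst// lte_mul_pinfty// lee_fin.
Qed.

Lemma lebesgue_itvoo_fin (R : realType) (a b : R) :
  (@lebesgue_measure R `]a, b[%classic < +oo)%E.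
Proof. by rewrite lebesgue_measure_itv; case: ifP => // _; rewrite -EFinB ltry. Qed.

Lemma young_ineq (R : realFieldType) (eta a b : R) : 0 < eta ->
  a * b <= eta / 2 * b ^+ 2 + (2 * eta)^-1 * a ^+ 2.
Proof.
move=> eta0; rewrite -subr_ge0.
have -> : eta / 2 * b ^+ 2 + (2 * eta)^-1 * a ^+ 2 - a * b =
    (2 * eta)^-1 * (a - eta * b) ^+ 2 by field; rewrite gt_eqF.
by rewrite mulr_ge0 ?sqr_ge0// invr_ge0 mulr_ge0// ltW.
Qed.

Section hilbert.
Context (R : realType) (H : hilbertType R).
Implicit Types x y z : H.

Lemma dotpBl x y z : dotp (x - y) z = dotp x z - dotp y z.
Proof. by have := dotpBZ x y z 1 1; rewrite !scale1r !mul1r. Qed.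

(** The two sides differ by [|x - y| ^+ 2]. *)
Lemma sqr_norm_increment x y :
  `|x| ^+ 2 - `|y| ^+ 2 <= 2 * (dotp x x - dotp y x).
Proof.
have : 0 <= `|x - y| ^+ 2 by rewrite sqr_ge0.
rewrite !sqr_normE dotpBl (dotpC x (x - y)) (dotpC y (x - y)) !dotpBl (dotpC x y).
lra.
Qed.

End hilbert.

Section energy_inequality.
Context (R : realType) (V H : hilbertType R) (i : gelfand_triple V H) (T : R).
Notation mu := (@lebesgue_measure R).
Notation RT := (measurableTypeR R).
Variables (w : RT -> V) (g : RT -> dual V) (c : R -> H).
Hypotheses (mw : smeas w) (w2 : (\int[mu]_x (`|w x| ^+ 2)%:E < +oo)%E).
Hypotheses (mg : smeas g) (g2 : (\int[mu]_x (`|g x| ^+ 2)%:E < +oo)%E).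
Hypothesis g0 : forall x : R, x <= 0 -> g x = 0.
Hypotheses (cc : {within `[0, T], continuous c}) (c0 : c 0 = 0).
Hypothesis cw : {ae mu, forall r, r \in `]0, T[ -> c r = i (w r)}.
Hypothesis cg : forall v s t, 0 <= s -> s < t -> t <= T ->
  dotp (c t) (i v) - dotp (c s) (i v) = \int[mu]_(r in `]s, t[) g r v.
Variable t : R.
Hypothesis t0T : 0 < t <= T.

Let c2 (r : R) : R := `|c r| ^+ 2.

Let c2_continuous : {within `[0, T], continuous c2}.
Proof.
have -> : c2 = (fun r => `|c r| * `|c r|) by apply/funext => r; rewrite /c2 expr2.
by move=> x; have /(_ x) cx := cc; have cn := cvg_norm cx; apply: cvgM; exact: cn.
Qed.

Let c2_integrable (D : set RT) : measurable D -> D `<=` `[0, T] ->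
  mu.-integrable D (EFin \o c2).
Proof.
move=> mD DT; have : mu.-integrable `[0, T] (EFin \o c2).
  by apply: continuous_compact_integrable => //; exact: segment_compact.
exact: integrableS.
Qed.

(** [c2] is cut to 0 off []0, t[] since for [r <= h] the increment starts from the value
    [c 0 = 0]. *)
Let c2_shift (h : R) : 0 < h < t ->
  (\int[mu]_(r in `]0%R, t[) ((c2 \_ `]0, t[) (r - h)%R)%:E =
   \int[mu]_(r in `]0%R, (t - h)%R[) (c2 r)%:E)%E.
Proof.
move=> /andP[h0 ht]; have /andP[t0 tT] := t0T.
pose a : RT -> R := c2 \_ `]0, t[.
have ma : measurable_fun [set: RT] a.
  apply/measurable_restrict => //; rewrite setTI.
  have /integrableP[/measurable_EFinP //] : mu.-integrable `]0, t[ (EFin \o c2).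
  by apply: c2_integrable => //; apply: subset_itv; rewrite bnd_simp.
have a0 x : 0 <= a x by rewrite /a patchE; case: ifP => _; rewrite ?sqr_ge0.
pose F : RT -> \bar R := (EFin \o a) \_ `]- h, t - h[.
have mF : measurable_fun setT F.
  by apply/measurable_restrict => //; rewrite setTI; apply/measurable_EFinP;
    exact: measurable_funTS.
have F0 x : (0 <= F x)%E by apply: erestrict_ge0 => y _; rewrite lee_fin.
rewrite [LHS]integral_mkcond.
have -> : (fun r => (a (r - h))%:E) \_ `]0, t[ = (fun r => F (r - h)).
  apply/funext => r; rewrite /F !patchE.
  have -> : (r - h \in `]- h, t - h[%classic) = (r \in `]0, t[%classic) => //.
  by apply/idP/idP => /set_mem; rewrite /= in_itv/= => /andP[? ?]; apply/mem_set;
      rewrite /= in_itv/=; apply/andP; split; lra.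
rewrite ge0_integral_translation// /F -integral_mkcond.
rewrite (_ : EFin \o a = (EFin \o c2) \_ `]0, t[); last first.
  by apply/funext => r; rewrite /= /a !patchE; case: ifP.
rewrite -integral_mkcondr; congr integral.
apply/seteqP; split => r /=; rewrite !in_itv/=; last by move=> ?; split; lra.
by move=> [? ?]; lra.
Qed.

Let oscillation (h r : R) : R := \int[mu]_(x in `]r - h, r[) (`|g x - g r| ^+ 2).

Let oscillation_fin (h r : R) :
  ((oscillation h r)%:E = \int[mu]_(x in `](r - h)%R, r[) (`|g x - g r| ^+ 2)%:E)%E.
Proof.
rewrite /oscillation /Rintegral fineK//; apply: integrable_fin_num => //.
apply: L2_integrable_sqr_sub => //=.
by rewrite lebesgue_measure_itv; case: ifP => // _; rewrite -EFinB ltry.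
Qed.

Let oscillation_integrable (h eps : R) : 0 < h ->
  (forall y, 0 < y < h -> (translation_error g y <= eps%:E)%E) ->
  mu.-integrable `]0, t[ (EFin \o oscillation h) /\
  \int[mu]_(r in `]0, t[) oscillation h r <= h * eps.
Proof.
move=> h0 he; have [mO OE] := oscillation_tonelli h mg.
have {}mO : measurable_fun [set: RT] (EFin \o oscillation h).
  have -> : EFin \o oscillation h =
      (fun r : RT => \int[mu]_(x in `](r - h)%R, r[) (`|g x - g r| ^+ 2)%:E)%E.
    by apply/funext => r; exact: oscillation_fin.
  exact: mO.
have O0 r : 0 <= oscillation h r by apply: Rintegral_ge0 => x _; exact: sqr_ge0.
have h2 : 0 < h / 2 < h by lra.
have eps0 : (0 <= eps%:E)%E.
  apply: le_trans (he _ h2); rewrite /translation_error.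
  by apply: integral_ge0 => x _; rewrite lee_fin sqr_ge0.
have te_le : (\int[mu]_(y in `](- h)%R, 0%R[) translation_error g (- y)%R <=
    \int[mu]_(y in `](- h)%R, 0%R[) eps%:E)%E.
  apply: ge0_le_lower_integral; first exact: subset_refl.
  - by move=> y _; rewrite /translation_error; apply: integral_ge0 => x _; rewrite lee_fin sqr_ge0.
  - by move=> y _; exact: eps0.
  by move=> y /=; rewrite in_itv/= => /andP[? ?]; apply: he; lra.
clear he.
have muh : mu `]- h, 0[%classic = h%:E.
  rewrite lebesgue_measure_itv/= lte_fin ifT; last lra.
  by rewrite -EFinB sub0r opprK.
have eps_h : (\int[mu]_(y in `](- h)%R, 0%R[) eps%:E = (h * eps)%:E)%E.
  rewrite (integral_cst mu (measurable_itv _) eps%:E).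
  by rewrite [X in (_ * X)%E]muh -EFinM mulrC.
have le1 : (\int[mu]_(r in `]0%R, t[) (oscillation h r)%:E <= (h * eps)%:E)%E.
  apply: (@le_trans _ _ (\int[mu]_r (oscillation h r)%:E)%E).
    apply: ge0_le_lower_integral; [exact: subsetT|by move=> x _; rewrite lee_fin..|].
    by [].
  under eq_integral do rewrite oscillation_fin.
  by rewrite OE -eps_h.
clear te_le eps_h.
have iO : mu.-integrable `]0, t[ (EFin \o oscillation h).
  apply/integrableP; split; first exact: measurable_funTS.
  rewrite (_ : (\int[mu]_(x in `]0%R, t[) `|(EFin \o oscillation h) x|)%E =
    (\int[mu]_(r in `]0%R, t[) (oscillation h r)%:E)%E); last first.
    by apply: eq_integral => x _ /=; rewrite ger0_norm.
  by apply: le_lt_trans le1 _; exact: ltry.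
split; first exact: iO.
rewrite -lee_fin /Rintegral fineK; first exact: le1.
by apply: integrable_fin_num iO; exact: measurable_itv.
Qed.

(** In the increment, [g x (w r)] is [g r (w r)] plus [(g x - g r) (w r)], and the latter is split
    by Young's inequality. The weight [eta] stays free: it must make the [w] term small before [h]
    is chosen to control the oscillation. *)
Let pointwise_bound (h eta r : R) : 0 < h -> h < t -> 0 < eta -> r \in `]0, t[ ->
  c r = i (w r) ->
  c2 r <= (c2 \_ `]0, t[) (r - h) + (2 * h * g r (w r) + (h * eta * `|w r| ^+ 2 +
    eta^-1 * oscillation h r)).
Proof.
move=> h0 ht eta0; rewrite in_itv/= => /andP[r0 rt] crw.
have /andP[t0 tT] := t0T.
pose s := Num.max 0 (r - h).
have sr : s < r by rewrite gt_max r0/= ltrBlDr ltrDl.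
have s0 : 0 <= s by rewrite le_max lexx.
have -> : (c2 \_ `]0, t[) (r - h) = c2 s.
  rewrite patchE; have [rh|rh] := ltP 0 (r - h).
    by rewrite /s max_r ?(ltW rh)// mem_set//= in_itv/= rh/=; lra.
  rewrite /s max_l// /c2 c0 normr0 expr0n/= memNset//= in_itv/= => /andP[]; lra.
rewrite -lerBlDl; apply: (le_trans (sqr_norm_increment _ _)).
rewrite {2 3}crw cg//; last lra.
have ig a b v : mu.-integrable `]a, b[ (EFin \o (fun x => g x v)).
  exact: dual_eval_L2_integrable.
(* When [r - h] is negative the increment starts at 0; the integral may still be extended to length
   [h] because [g] vanishes at nonpositive times. *)
have -> : \int[mu]_(x in `]s, r[) g x (w r) = \int[mu]_(x in `]r - h, r[) g x (w r).
  have [rh|rh] := ltP 0 (r - h); first by rewrite /s max_r// ltW.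
  rewrite /s max_l// Rintegral_mkcond [RHS]Rintegral_mkcond.
  apply: eq_Rintegral => x _; rewrite !patchE.
  case: ifPn => x1; case: ifPn => x2 //.
    exfalso; move: x2; rewrite notin_setE; apply.
    by move: x1; rewrite inE/= !in_itv/= => /andP[? ?]; apply/andP; split; lra.
  rewrite g0//; move: x1; rewrite notin_setE/= in_itv/= => /negP; rewrite negb_and -!leNgt.
  by case/orP => //; move: x2; rewrite inE/= in_itv/= => /andP[? ?] ?; lra.
have fm : (mu `](r - h)%R, r[%classic < +oo)%E.
  by rewrite /= lebesgue_measure_itv; case: ifP => // _; rewrite -EFinB ltry.
pose k := g r (w r) + eta / 2 * `|w r| ^+ 2.
have iO : mu.-integrable `]r - h, r[ (EFin \o (fun x => `|g x - g r| ^+ 2)).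
  exact: L2_integrable_sqr_sub.
have ik : mu.-integrable `]r - h, r[ (EFin \o (fun _ : RT => k)).
  by apply: integrable_cst_fin.
have mJ : measurable (`]r - h, r[%classic : set RT) by [].
have iO2 := integrable_mulr ((2 * eta)^-1) mJ iO.
apply: (@le_trans _ _ (2 * \int[mu]_(x in `]r - h, r[) (k + (2 * eta)^-1 * `|g x - g r| ^+ 2))).
  rewrite ler_pM2l//; apply: le_Rintegral => //.
    exact: integrable_addr.
  move=> x _; rewrite /k -addrA -lerBlDl.
  rewrite -[g x (w r) - _]/((g x - g r) (w r)).
  apply: (le_trans (ler_norm _)); apply: (le_trans (dual_le _ _)).
  exact: young_ineq.
rewrite RintegralD// Rintegral_cst// RintegralZl// -/(oscillation h r).
rewrite /= lebesgue_measure_itv/= lte_fin ifT; last lra.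
rewrite -EFinB/= opprB addrCA subrr addr0 /k le_eqVlt; apply/orP; left; apply/eqP.
by field; rewrite gt_eqF.
Qed.

Let work : R := \int[mu]_(r in `]0, t[) g r (w r).
Let size2 : R := \int[mu]_(r in `]0, t[) (`|w r| ^+ 2).

(** Integrating the pointwise bound over []0, t[], the shifted integral of [c2] cancels all but the
    last slice []t - h, t[], and every other term carries a factor [h]. *)
Let integrated_bound (h eta eps : R) : 0 < h -> h < t -> 0 < eta ->
  (forall y, 0 < y < h -> (translation_error g y <= eps%:E)%E) ->
  \int[mu]_(r in `]t - h, t[) c2 r <= h * (2 * work + eta * size2 + eta^-1 * eps).
Proof.
move=> h0 ht eta0 /(oscillation_integrable h0)[iO O_le].
have /andP[t0 tT] := t0T.
have sub a : 0 <= a -> `]a, t[%classic `<=` `[0, T]%classic.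
  by move=> a0 x /=; rewrite !in_itv/= => /andP[? ?]; apply/andP; split; lra.
have ic : mu.-integrable `]0, t[ (EFin \o c2) by apply: c2_integrable => //; exact: sub.
have ic' : mu.-integrable `]0, t - h[ (EFin \o c2).
  by apply: c2_integrable => //; apply: (subset_trans _ (sub 0 (lexx _))); apply: subset_itvl;
    rewrite bnd_simp; lra.
have sh : 0 < h < t by rewrite h0.
have iash : mu.-integrable `]0, t[ (EFin \o (fun r => (c2 \_ `]0, t[) (r - h))).
  apply/integrableP; split.
    apply/measurable_EFinP; apply: measurable_funTS.
    apply: (measurableT_comp (f := c2 \_ `]0, t[)); last exact: measurable_translation.
    by apply/measurable_restrict => //; rewrite setTI; have /integrableP[/measurable_EFinP] := ic.
  rewrite (_ : (\int[mu]_(x in _) _ = \int[mu]_(r in `]0%R, (t - h)%R[) (c2 r)%:E)%E).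
    have /integrableP[_] := ic'; apply: le_lt_trans.
    rewrite (_ : (\int[mu]_(x in _) `|_ x| = \int[mu]_(r in `]0%R, (t - h)%R[) (c2 r)%:E)%E)//.
    by apply: eq_integral => x _ /=; rewrite ger0_norm// sqr_ge0.
  rewrite -c2_shift//; apply: eq_integral => x _ /=.
  by rewrite ger0_norm// patchE; case: ifP => // _; rewrite sqr_ge0.
have igw : mu.-integrable `]0, t[ (EFin \o (fun r => g r (w r))) by exact: pairing_integrable.
have iw : mu.-integrable `]0, t[ (EFin \o (fun r => `|w r| ^+ 2)) by exact: L2_integrable_sqr.
have m0t : measurable (`]0, t[%classic : set RT) by [].
have igw2 := integrable_mulr (2 * h) m0t igw.
have iw2 := integrable_mulr (h * eta) m0t iw.
have iO2 := integrable_mulr (eta^-1) m0t iO.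
have : \int[mu]_(r in `]0, t[) c2 r <= \int[mu]_(r in `]0, t[)
    ((c2 \_ `]0, t[) (r - h) + (2 * h * g r (w r) + (h * eta * `|w r| ^+ 2 +
    eta^-1 * oscillation h r))).
  apply: ae_le_Rintegral => //.
    by do 3 (apply: integrable_addr => //).
  apply: ae_mono cw => r cwr rt.
  have rT : r \in `]0, T[.
    by move: rt; rewrite /= !in_itv/= => /andP[? ?]; apply/andP; split; lra.
  by apply: pointwise_bound => //; exact: cwr.
rewrite RintegralD//; last by do 2 (apply: integrable_addr => //).
rewrite RintegralD//; last by apply: integrable_addr.
rewrite RintegralD// !RintegralZl// -/work -/size2.
rewrite [X in X + _](_ : _ = \int[mu]_(r in `]0, t - h[) c2 r); last first.
  by rewrite /Rintegral c2_shift.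
rewrite (@Rintegral_itv_bndo_bndc _ (BRight 0) (t - h))//.
have split_int : \int[mu]_(r in `]0, t[) c2 r - \int[mu]_(r in `]0, t - h]) c2 r =
    \int[mu]_(r in `]t - h, t[) c2 r.
  by apply: (Rintegral_itvB (x := t - h) ic); rewrite bnd_simp; lra.
have O_le' : eta^-1 * \int[mu]_(r in `]0, t[) oscillation h r <= eta^-1 * (h * eps).
  by rewrite ler_pM2l// invr_gt0.
rewrite -split_int !mulrDr => ub.
have -> : h * (eta^-1 * eps) = eta^-1 * (h * eps) by ring.
move: ub O_le'; move: (\int[mu]_(r in _) oscillation h r) (eta^-1 * (h * eps)).
move: (\int[mu]_(r in _) c2 r) (\int[mu]_(r in _) c2 r) => x1 x2 x3 x4; lra.
Qed.

Lemma energy_inequality : `|c t| ^+ 2 <= 2 * \int[mu]_(r in `]0, t[) g r (w r).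
Proof.
rewrite -/work; have /andP[t0 tT] := t0T.
have size0 : 0 <= size2 by apply: Rintegral_ge0 => x _; exact: sqr_ge0.
apply/ler_addgt0Pr => e e0.
(* The error [e] is split in three: [eta * size2], [eta^-1 * eps] and the variation of [c2] on []t -
   h, t[] each cost at most [e / 3]. *)
pose eta := e / (3 * (size2 + 1)).
have s1 : 0 < 3 * (size2 + 1) by lra.
have eta0 : 0 < eta by rewrite divr_gt0.
have e3 : 0 < e / 3 by rewrite divr_gt0.
pose eps := eta * (e / 3).
have eps0 : 0 < eps by rewrite mulr_gt0.
have [d1 d10 hd1] := translation_continuous_L2 mg g2 eps0.
have tI : 0 <= t <= T by lra.
have /subspace_continuousP/(_ t) := c2_continuous.
rewrite /= in_itv/= => /(_ tI) /cvgrPdist_le/(_ _ e3)/nbhs_ballP[d2 /= d20 hd2].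
pose h := Num.min (Num.min d1 d2) (t / 2).
have h0 : 0 < h by rewrite !lt_min d10 d20 divr_gt0.
have hd : [/\ h <= d1, h <= d2 & h < t].
  have : h <= Num.min d1 d2 by rewrite ge_min lexx.
  rewrite le_min => /andP[-> ->]; split => //.
  have : h <= t / 2 by rewrite ge_min lexx orbT.
  lra.
have [hd1' hd2' ht] := hd.
have te_le y : 0 < y < h -> (translation_error g y <= eps%:E)%E.
  by move=> /andP[y0 yh]; apply: hd1; rewrite ger0_norm ?(ltW y0)//; exact: lt_le_trans yh hd1'.
have ub := integrated_bound h0 ht eta0 te_le.
clear te_le.
have lb : h * (c2 t - e / 3) <= \int[mu]_(r in `]t - h, t[) c2 r.
  have -> : h * (c2 t - e / 3) = \int[mu]_(r in `]t - h, t[) (c2 t - e / 3).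
    rewrite Rintegral_cst//= lebesgue_measure_itv/= lte_fin ifT; last lra.
    by rewrite -EFinB/=; ring.
  apply: le_Rintegral => //.
  - by apply: integrable_cst_fin => //; exact: lebesgue_itvoo_fin.
  - by apply: c2_integrable => // x /=; rewrite !in_itv/= => /andP[? ?]; lra.
  move=> x /=; rewrite in_itv/= => /andP[x1 x2].
  have : `|c2 t - c2 x| <= e / 3.
    apply: hd2; last by rewrite /= in_itv/=; lra.
    by rewrite /ball/= ger0_norm; lra.
  by rewrite ler_norml => /andP[? ?]; lra.
have := le_trans lb ub; rewrite ler_pM2l// -/c2.
have -> : eta^-1 * eps = e / 3 by rewrite /eps mulKf ?gt_eqF.
have : eta * size2 <= e / 3.
  rewrite /eta -(@ler_pM2l _ (3 * (size2 + 1)))//.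
  rewrite [leLHS]mulrA [_ * (e / _)]mulrC divfK ?gt_eqF//.
  have : 0 <= size2 * e by rewrite mulr_ge0// ltW.
  lra.
rewrite -/(c2 t); lra.
Qed.

End energy_inequality.

(** Cauchy-Schwarz by integrating [2 * c * f <= f ^+ 2 + c ^+ 2] at [c = J / M]. A positive bound
    [M] replaces the mass of [D], which may be 0. *)
Lemma sqr_Rintegral_le d (X : measurableType d) (R : realType)
    (mu : {measure set X -> \bar R}) (D : set X) (f : X -> R) (M : R) :
  measurable D -> mu.-integrable D (EFin \o f) ->
  mu.-integrable D (EFin \o (fun x => f x ^+ 2)) ->
  0 < M -> (mu D <= M%:E)%E ->
  (\int[mu]_(x in D) f x) ^+ 2 <= M * \int[mu]_(x in D) (f x ^+ 2).
Proof.
move=> mD i1 i2 M0 DM.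
have Dfin : (mu D < +oo)%E by apply: (le_lt_trans DM); exact: ltry.
set J := \int[mu]_(x in D) f x.
pose c := J / M.
have ic := integrable_cst_fin (c ^+ 2) mD Dfin.
have i3 := integrable_mulr (2 * c) mD i1.
have : \int[mu]_(x in D) (2 * c * f x) <= \int[mu]_(x in D) (f x ^+ 2 + c ^+ 2).
  apply: le_Rintegral => //; first exact: integrable_addr.
  by move=> x _; have := sqr_ge0 (f x - c); lra.
rewrite RintegralZl// RintegralD// Rintegral_cst// -/J.
have DM' : fine (mu D) <= M by rewrite -lee_fin fineK// ge0_fin_numE.
have c2 : c ^+ 2 * fine (mu D) <= c ^+ 2 * M by rewrite ler_wpM2l// sqr_ge0.
have e1 : c ^+ 2 * M = J ^+ 2 / M by rewrite /c; field; rewrite gt_eqF.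
have e2 : 2 * c * J = 2 * (J ^+ 2 / M) by rewrite /c; field; rewrite gt_eqF.
rewrite e2 [M * _]mulrC -ler_pdivrMr//.
move: (\int[mu]_(x in D) _) (c ^+ 2 * fine _) c2 => Q z2; rewrite e1.
move: (J ^+ 2 / M) => z; lra.
Qed.

(** * The delay term *)

Section delay_term.
Context (R : realType) (V : normedModType R) (A : {linear V -> dual V}) (L : R).
Notation mu := (@lebesgue_measure R).
Notation RT := (measurableTypeR R).
Hypothesis Lgt0 : 0 < L.
Let L0 : 0 <= L := ltW Lgt0.
Hypothesis AL : forall v, `|A v| <= L * `|v|.

Lemma bounded_linear_continuous : continuous A.
Proof.
move=> v; apply/cvgrPdist_lt => e e0.
have d0 : 0 < e / (L + 1) by rewrite divr_gt0// ltr_wpDl.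
near=> z; rewrite -linearB.
apply: (le_lt_trans (AL _)).
have vz : `|v - z| < e / (L + 1) by near: z; exact: (@cvgr_dist_lt _ _ _ _ _ id).
rewrite (@le_lt_trans _ _ ((L + 1) * `|v - z|))//; first by rewrite ler_wpM2r// lerDl.
by rewrite mulrC -ltr_pdivlMr// ltr_wpDl.
Unshelve. all: by end_near. Qed.

Lemma measurable_reflection (r : R) : measurable_fun [set: RT] (fun s : RT => r - s : RT).
Proof. by apply: measurable_funB. Qed.

Lemma delay_eval_measurable (g : RT -> V) (r : R) (v : V) : smeas g ->
  measurable_fun [set: RT] (fun s => A (g (r - s)) v).
Proof.
move=> mg; apply: (smeas_pairing (g := fun s : RT => A (g (r - s))) (w := cst v));
  last exact: smeas_cst.
apply: smeas_op1; first exact: bounded_linear_continuous.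
exact: (smeas_comp (measurable_reflection r)).
Qed.

(** The measure charges only [taud], so the integrand evaluated at [v] is almost everywhere the
    constant [C]. *)
Lemma dirac_delay_term (tau taud m : R) (m0 : 0 <= m) (g : RT -> V) (r : R) (k : dual V) :
  0 <= taud <= tau -> smeas g ->
  is_bochner_integral (mscale (NngNum m0) \d_(taud : RT)) `[0, tau] (fun s => A (g (r - s))) k ->
  k = m *: A (g (r - taud)).
Proof.
move=> td mg bk; apply/val_inj/funext => v /=; change (k v = m * A (g (r - taud)) v).
have mF := delay_eval_measurable r v mg.
pose C : R := A (g (r - taud)) v.
have tauD : taud \in `[0, tau]%classic by rewrite inE/= in_itv.
have [|| _ <-] := @bochner_eval _ RT R V _ `[0, tau]%classic (measurable_itv _) _ _ v (cst C) bk.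
- exact: measurable_cst.
- pose F : RT -> R := fun s => A (g (r - s)) v.
  exists (~` (F @^-1` [set C])); split.
  + apply: measurableC; rewrite -[_ @^-1` _]setTI; exact: mF.
  + rewrite /= /mscale/= diracE memNset ?mule0// => h; exact: h.
  + by move=> s /= /not_implyP[].
rewrite Rintegral_cst; last exact: measurable_itv.
rewrite [X in fine X](_ : _ = m%:E); first by rewrite mulrC.
by rewrite /= /mscale/= diracE tauD mule1.
Qed.


(* The bound is extended-real valued because the integral on the right may be
   infinite for exceptional values of r. *)
Lemma delay_term_difference (sigma : {finite_measure set RT -> \bar R})
    (tau taud m M : R) (m0 : 0 <= m) (g h : RT -> V) (r : R) (kg kh : dual V) :
  0 <= taud <= tau -> smeas g -> smeas h -> 0 < M -> (sigma `[0%R, tau]%classic <= M%:E)%E ->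
  is_bochner_integral sigma `[0, tau] (fun s => A (g (r - s))) kg ->
  is_bochner_integral (mscale (NngNum m0) \d_(taud : RT)) `[0, tau] (fun s => A (h (r - s))) kh ->
  ((`|kg - kh| ^+ 2)%:E <= (2 * L ^+ 2)%:E * (M%:E *
    \int[sigma]_(s in `[0%R, tau]) (`|g (r - s)%R - h (r - taud)%R| ^+ 2)%:E +
    ((fine (sigma `[0%R, tau]%classic) - m) ^+ 2 * `|h (r - taud)%R| ^+ 2)%:E))%E.
Proof.
move=> td mg mh M0 sM bg /(dirac_delay_term td mh)->.
set D : set RT := `[0, tau]%classic.
set b := h (r - taud).
have mD : measurable D by exact: measurable_itv.
have Dfin : (sigma D < +oo)%E by apply: (le_lt_trans sM); exact: ltry.
have mgr : smeas (fun s : RT => g (r - s)) by exact: (smeas_comp (measurable_reflection r)).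
have mgb : smeas (fun s : RT => g (r - s) - b) by apply: smeasB => //; exact: smeas_cst.
pose f s := `|g (r - s) - b|.
have mf : measurable_fun D f by apply: measurable_funTS; exact: smeas_norm.
pose Y := (\int[sigma]_(s in D) (f s ^+ 2)%:E)%E.
have Y0 : (0 <= Y)%E by apply: integral_ge0 => x _; rewrite lee_fin sqr_ge0.
change ((`|kg - m *: A b| ^+ 2)%:E <=
  (2 * L ^+ 2)%:E * (M%:E * Y + ((fine (sigma D) - m) ^+ 2 * `|b| ^+ 2)%:E))%E.
have L2 : 0 < 2 * L ^+ 2 by rewrite mulr_gt0// exprn_gt0.
(* If [Y] is infinite, so is the right-hand side. *)
have [Yfin|Yoo] := ltP Y +oo%E; last first.
  move: Yoo; rewrite leye_eq => /eqP ->.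
  by rewrite gt0_muley ?lte_fin// addye// gt0_muley ?lte_fin// leey.
have if1 : sigma.-integrable D (EFin \o f) by exact: L2_integrable.
have if2 : sigma.-integrable D (EFin \o (fun s => f s ^+ 2)).
  apply/integrableP; split; first by apply/measurable_EFinP; exact: measurable_funX.
  rewrite (_ : (\int[sigma]_(s in D) `|_ s| = Y)%E)//.
  by apply: eq_integral => x _ /=; rewrite ger0_norm// sqr_ge0.
pose J := \int[sigma]_(s in D) f s.
have J0 : 0 <= J by apply: Rintegral_ge0 => x _; rewrite /f.
have J2 := sqr_Rintegral_le mD if1 if2 M0 sM.
pose q := `|fine (sigma D) - m|.
have q0 : 0 <= q by exact: normr_ge0.
have LJ0 : 0 <= L * (J + q * `|b|) by apply: mulr_ge0 => //; apply: addr_ge0 => //; exact: mulr_ge0.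
have kb : `|kg - m *: A b| <= L * (J + q * `|b|).
  apply: dual_norm_bound => //.
  move=> v; rewrite dualDE dualNE dualZE.
  have [|| iF <-] := @bochner_eval _ RT R V _ D mD _ _ v (fun s => A (g (r - s)) v) bg.
  - by apply: measurable_funTS; exact: delay_eval_measurable.
  - exact: aeW.
  pose C : R := A b v.
  have iC := integrable_cst_fin C mD Dfin.
  (* Separate the displacement of the delay, [g(r - s)] against [b], from the defect of mass,
     [sigma D] against [m]. *)
  have -> : \int[sigma]_(s in D) A (g (r - s)) v - m * C =
      \int[sigma]_(s in D) (A (g (r - s)) v - C) + (fine (sigma D) - m) * C.
    by rewrite RintegralB// Rintegral_cst//; lra.
  have iFC : sigma.-integrable D (EFin \o (fun s => A (g (r - s)) v - C)).
    exact: (integrableB mD iF iC).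
  have iLf := integrable_mulr (L * `|v|) mD if1.
  have h1 : `|\int[sigma]_(s in D) (A (g (r - s)) v - C)| <= L * `|v| * J.
    apply: (le_trans (le_normr_Rintegral mD iFC)).
    rewrite -RintegralZl//; apply: le_Rintegral => //; first exact: (integrable_norm iFC).
    move=> s _; rewrite /C -dualNE -dualDE -linearB.
    apply: (le_trans (dual_le _ _)); rewrite mulrAC ler_wpM2r//; exact: AL.
  have h2 : `|(fine (sigma D) - m) * C| <= q * (L * `|v| * `|b|).
    rewrite normrM ler_wpM2l// /C; apply: (le_trans (dual_le _ _)).
    by rewrite mulrAC ler_wpM2r//; exact: AL.
  apply: (le_trans (ler_normD _ _)); apply: (le_trans (lerD h1 h2)).
  by rewrite le_eqVlt; apply/orP; left; apply/eqP; ring.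
have YE : Y = (\int[sigma]_(s in D) (f s ^+ 2))%:E.
  by rewrite /Rintegral fineK// ge0_fin_numE.
rewrite YE.
change (`|kg - m *: A b| ^+ 2 <=
  (2 * L ^+ 2) * (M * \int[sigma]_(s in D) (f s ^+ 2) + ((fine (sigma D) - m) ^+ 2 * `|b| ^+ 2))).
have q2 : (fine (sigma D) - m) ^+ 2 = q ^+ 2 by rewrite /q real_normK ?num_real.
rewrite q2 -exprMn.
have kb2 : `|kg - m *: A b| ^+ 2 <= (L * (J + q * `|b|)) ^+ 2.
  by rewrite ler_pXn2r ?nnegrE.
apply: (le_trans kb2); rewrite [leLHS]exprMn.
have e X : 2 * L ^+ 2 * X = L ^+ 2 * (2 * X) by ring.
rewrite e ler_wpM2l ?sqr_ge0//.
have := sqr_ge0 (J - q * `|b|).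
move: J2; rewrite -/J; move: (M * _) (q * `|b|) => x y; nra.
Qed.

End delay_term.

Lemma sqr_L2D_le (R : realType) (B : normedModType R) (D : set (measurableTypeR R))
    (f g : measurableTypeR R -> B) : measurable D -> smeas f -> smeas g ->
  (\int[lebesgue_measure]_(x in D) (`|f x + g x|%R ^+ 2)%:E <=
   2%:E * \int[lebesgue_measure]_(x in D) (`|f x| ^+ 2)%:E +
   2%:E * \int[lebesgue_measure]_(x in D) (`|g x| ^+ 2)%:E)%E.
Proof.
move=> mD mf mg.
have m1 : measurable_fun D (fun x => (`|f x| ^+ 2)%:E).
  by apply: measurable_funTS; exact: smeas_sqr_norm.
have m2 : measurable_fun D (fun x => (`|g x| ^+ 2)%:E).
  by apply: measurable_funTS; exact: smeas_sqr_norm.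
rewrite -!ge0_integralZl_EFin// -ge0_integralD//; last 2 first.
- exact: measurable_funeM.
- exact: measurable_funeM.
apply: ge0_le_lower_integral.
- exact: subset_refl.
- by move=> x _; rewrite lee_fin sqr_ge0.
- by move=> x _; rewrite -!EFinM -EFinD lee_fin addr_ge0// mulr_ge0// sqr_ge0.
by move=> x _; rewrite -!EFinM -EFinD lee_fin sqr_normD_le.
Qed.

(** * Time integrals of delayed functions *)

Section delay_estimates.
Context (R : realType).
Notation mu := (@lebesgue_measure R).
Notation RT := (measurableTypeR R).
Variable sigma : {finite_measure set RT -> \bar R}.

Lemma tonelli_domain (E D : set RT) (F : RT * RT -> R) :
  measurable E -> measurable D -> measurable_fun setT F -> (forall p, 0 <= F p) ->
  measurable_fun setT (fun r : RT => \int[sigma]_(s in D) (F (r, s))%:E)%E /\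
  (\int[mu]_(r in E) \int[sigma]_(s in D) (F (r, s))%:E =
   \int[sigma]_(s in D) \int[mu]_(r in E) (F (r, s))%:E)%E.
Proof.
move=> mE mD mF F0.
pose G (A B : set RT) (p : RT * RT) : \bar R := (\1_A p.1 * (\1_B p.2 * F p))%:E.
have G0 A B p : (0 <= G A B p)%E by rewrite lee_fin !mulr_ge0.
have mG A B : measurable A -> measurable B -> measurable_fun setT (G A B).
  move=> mA mB; apply/measurable_EFinP; apply: measurable_funM.
    have m1 : measurable_fun setT (\1_A : RT -> R) by exact: measurable_indic.
    exact: (measurableT_comp m1 (@measurable_fst _ _ RT RT)).
  apply: measurable_funM => //.
  have m1 : measurable_fun setT (\1_B : RT -> R) by exact: measurable_indic.
  exact: (measurableT_comp m1 (@measurable_snd _ _ RT RT)).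
have GD A r : (\int[sigma]_s G A D (r, s) = (\1_A r)%:E * \int[sigma]_(s in D) (F (r, s))%:E)%E.
  rewrite [in RHS]integral_mkcond -ge0_integralZl_EFin//; last 2 first.
  - by move=> x _; apply: erestrict_ge0 => y _; rewrite lee_fin.
  - apply/measurable_restrict => //; rewrite setTI; apply: measurable_funTS.
    by apply/measurable_EFinP; exact: (measurableT_comp mF).
  apply: eq_integral => s _; rewrite /G/= patchE [\1_D _]indicE.
  by case: ifPn => _; rewrite ?mul1r ?mul0r ?mulr0 ?mule0// EFinM.
have GE s : (\int[mu]_r G E D (r, s) = (\1_D s)%:E * \int[mu]_(r in E) (F (r, s))%:E)%E.
  rewrite [in RHS]integral_mkcond -ge0_integralZl_EFin//; last 2 first.
  - by move=> x _; apply: erestrict_ge0 => y _; rewrite lee_fin.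
  - apply/measurable_restrict => //; rewrite setTI; apply: measurable_funTS.
    by apply/measurable_EFinP; exact: (measurableT_comp mF).
  apply: eq_integral => r _; rewrite /G/= patchE [\1_E _]indicE.
  by case: ifPn => _; rewrite ?mul1r ?mul0r ?mule0// EFinM.
split.
  have := measurable_fun_fubini_tonelli_F (m2 := sigma) (G setT D) (mG _ _ measurableT mD) (G0 _ _).
  by apply: eq_measurable_fun => r _; rewrite /fubini_F GD indicT mul1e.
have := fubini_tonelli (m1 := mu) (m2 := sigma) (G E D) (mG _ _ mE mD) (G0 _ _).
under eq_integral do rewrite GD; under [RHS]eq_integral do rewrite GE.
move=> e; rewrite integral_mkcond [RHS]integral_mkcond.
transitivity (\int[mu]_r ((\1_E r)%:E * \int[sigma]_(s in D) (F (r, s))%:E))%E.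
  by apply: eq_integral => r _; rewrite patchE indicE; case: ifPn => _; rewrite ?mul1e ?mul0e.
rewrite e; apply: eq_integral => s _.
by rewrite patchE indicE; case: ifPn => _; rewrite ?mul1e ?mul0e.
Qed.

Variables (tau taud : R).
Hypothesis td : 0 < taud <= tau.
Let D : set RT := `[0, tau]%classic.
Let dist : R := \int[sigma]_(s in D) `|s - taud|.
Let mass : R := fine (sigma D).

Let mD : measurable D. Proof. exact: measurable_itv. Qed.

Let massE : sigma D = mass%:E.
Proof. by rewrite /mass fineK//; exact: fin_num_measure. Qed.

Let mdist : measurable_fun [set: RT] (fun s : RT => `|s - taud|).
Proof. by apply: measurableT_comp => //; exact: measurable_funB. Qed.

Let distE : (\int[sigma]_(s in D) `|s - taud|%:E)%E = dist%:E.
Proof.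
rewrite /dist /Rintegral fineK// ge0_fin_numE ?integral_ge0//.
apply: (@le_lt_trans _ _ (\int[sigma]_(s in D) tau%:E)%E).
  apply: ge0_le_integral => //; first exact/measurable_EFinP/measurable_funTS.
  move=> s; rewrite /D/= in_itv/= lee_fin ler_norml => /andP[s0 st].
  have /andP[t1 t2] := td. by apply/andP; split; lra.
by rewrite integral_cst//= massE -EFinM ltry.
Qed.

(** Markov's inequality: on [[0, taud / 2]] the distance to [taud] is at least [taud / 2]. *)
Lemma mass_near_zero_le : fine (sigma (D `&` `[0, taud / 2])) <= (taud / 2)^-1 * dist.
Proof.
have t2 : 0 < taud / 2 by have /andP[? _] := td; lra.
rewrite -lee_fin EFinM -distE lee_pdivlMl// fineK; last first.
  by apply: fin_num_measure; exact: measurableI.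
rewrite setIC -integral_indic//.
rewrite -ge0_integralZl_EFin ?(ltW t2)//; last first.
  by apply/measurable_EFinP; exact: measurable_indic.
apply: ge0_le_integral => //.
- by move=> x _; rewrite -EFinM lee_fin mulr_ge0// ltW.
- by apply: measurable_funeM; apply/measurable_EFinP; exact: measurable_indic.
- exact/measurable_EFinP/measurable_funTS.
move=> s Ds; rewrite -EFinM lee_fin indicE.
case: (boolP (s \in _)) => [/set_mem|_]; last by rewrite mulr0.
by rewrite /= in_itv/= => /andP[s0 st]; rewrite mulr1 ler0_norm; lra.
Qed.

Section functions.
Variable B : normedModType R.
Implicit Types w h : RT -> B.

Let smeas_shift_pair w : smeas w -> smeas (fun p : RT * RT => w (p.1 - p.2)).
Proof.
move=> mw; apply: (smeas_comp (h := fun p : RT * RT => p.1 - p.2 : RT)) => //.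
by apply: measurable_funB; [exact: (@measurable_fst _ _ RT RT)|exact: (@measurable_snd _ _ RT RT)].
Qed.

(** Starting at [-oo] makes the quantity compatible with shifts: delaying [w] by [s] replaces [t] by
    [t - s]. *)
Definition energy_before w (t : R) : R := \int[mu]_(x in `]-oo, t[) (`|w x| ^+ 2).

Lemma energy_beforeE w t : smeas w -> (\int[mu]_x (`|w x| ^+ 2)%:E < +oo)%E ->
  (\int[mu]_(x in `]-oo, t[) (`|w x| ^+ 2)%:E = (energy_before w t)%:E)%E.
Proof.
move=> mw w2; rewrite /energy_before /Rintegral fineK//.
by apply: integrable_fin_num => //; exact: L2_integrable_sqr.
Qed.

Lemma energy_before_le w s t : smeas w -> (\int[mu]_x (`|w x| ^+ 2)%:E < +oo)%E ->
  s <= t -> energy_before w s <= energy_before w t.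
Proof.
move=> mw w2 st; rewrite -lee_fin -!energy_beforeE//.
apply: ge0_le_lower_integral.
- by apply: subset_itvl; rewrite bnd_simp.
- by move=> x _; rewrite lee_fin sqr_ge0.
- by move=> x _; rewrite lee_fin sqr_ge0.
- by [].
Qed.

Lemma energy_before_ge0 w t : 0 <= energy_before w t.
Proof. by apply: Rintegral_ge0 => x _; exact: sqr_ge0. Qed.

Let shifted_energy w (s t : R) : smeas w -> (\int[mu]_x (`|w x| ^+ 2)%:E < +oo)%E ->
  (\int[mu]_(r in `]0%R, t[) (`|w (r - s)%R| ^+ 2)%:E <= (energy_before w (t - s))%:E)%E.
Proof.
move=> mw w2.
pose F : RT -> \bar R := (fun x => (`|w x| ^+ 2)%:E) \_ `]-oo, t - s[.
have mF : measurable_fun setT F.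
  apply/measurable_restrict => //; rewrite setTI; apply: measurable_funTS; exact: smeas_sqr_norm.
have F0 x : (0 <= F x)%E by apply: erestrict_ge0 => y _; rewrite lee_fin sqr_ge0.
rewrite -energy_beforeE// [leRHS]integral_mkcond -(ge0_integral_translation s mF F0).
apply: ge0_le_lower_integral.
- exact: subsetT.
- by move=> x _; rewrite lee_fin sqr_ge0.
- by move=> x _; exact: F0.
move=> r; rewrite /= in_itv/= => /andP[r0 rt]; rewrite /F patchE mem_set//= in_itv/=.
by rewrite ltrD2r.
Qed.

(** After Tonelli, the delay [s] costs at most the energy before [t - s]: at most that before [t]
    when [s <= taud / 2], and that before [t - taud / 2] otherwise. *)
Lemma delayed_energy_le w (t : R) : smeas w -> (\int[mu]_x (`|w x| ^+ 2)%:E < +oo)%E ->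
  (\int[mu]_(r in `]0%R, t[) \int[sigma]_(s in D) (`|w (r - s)%R| ^+ 2)%:E <=
   (fine (sigma (D `&` `[0%R, (taud / 2)%R])) * energy_before w t +
    mass * energy_before w (t - taud / 2))%:E)%E.
Proof.
move=> mw w2; have [t1 t2] := andP td.
have mF : measurable_fun setT (fun p : RT * RT => `|w (p.1 - p.2)| ^+ 2).
  by apply: measurable_funX; apply: smeas_norm; exact: smeas_shift_pair.
have [_ ->] := @tonelli_domain `]0, t[%classic D _ (measurable_itv _) mD mF (fun p => sqr_ge0 _).
pose A : set RT := `[0, taud / 2]%classic.
have mA : measurable A by exact: measurable_itv.
have E0 := energy_before_ge0 w.
apply: (@le_trans _ _ (\int[sigma]_(s in D) ((energy_before w t)%:E * (\1_A s)%:E +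
    (energy_before w (t - taud / 2))%:E))%E).
  apply: ge0_le_lower_integral.
  - exact: subset_refl.
  - by move=> s _; apply: integral_ge0 => r _; rewrite lee_fin sqr_ge0.
  - by move=> s _; rewrite -EFinM -EFinD lee_fin addr_ge0// mulr_ge0.
  move=> s; rewrite /D/= in_itv/= => /andP[s0 st].
  apply: (le_trans (shifted_energy s t mw w2)).
  rewrite -EFinM -EFinD lee_fin indicE.
  have [sA|sA] := leP s (taud / 2).
    rewrite mem_set ?mulr1; last by rewrite /A/= in_itv/= s0.
    by rewrite (le_trans (energy_before_le mw w2 (_ : t - s <= t))) ?lerDl//; lra.
  rewrite memNset ?mulr0 ?add0r; last by rewrite /A/= in_itv/= => /andP[_]; lra.
  by apply: energy_before_le => //; lra.
rewrite ge0_integralD//; last 3 first.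
- by move=> s _; rewrite -EFinM lee_fin mulr_ge0.
- by apply: measurable_funeM; apply/measurable_EFinP; exact: measurable_indic.
- by move=> s _; rewrite lee_fin.
rewrite ge0_integralZl_EFin//; last first.
  by apply/measurable_EFinP; exact: measurable_indic.
rewrite integral_indic// integral_cst//= massE [A `&` D]setIC.
have sA : sigma (D `&` A) = (fine (sigma (D `&` A)))%:E.
  by rewrite fineK//; apply: fin_num_measure; exact: measurableI.
rewrite sA -!EFinM -EFinD lee_fin /= mulrC.
by rewrite [X in _ + X]mulrC.
Qed.

Lemma translation_error_le h s : smeas h ->
  (translation_error h s <= 4%:E * \int[mu]_x (`|h x| ^+ 2)%:E)%E.
Proof.
move=> mh; rewrite /translation_error.
have mN : smeas (fun x => - h x) by apply: (smeas_op1 _ mh) => b; exact: oppr_continuous.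
apply: (le_trans (sqr_L2D_le measurableT (smeas_translation s mh) mN)).
under [X in (_ + _ * X)%E]eq_integral do rewrite normrN.
have m2 := smeas_sqr_norm mh.
rewrite (@ge0_integral_translation _ s (fun x => (`|h x| ^+ 2)%:E))//.
by rewrite -ge0_muleDl// -EFinD; have -> : 2 + 2 = 4 :> R by lra.
Qed.

(** After Tonelli and a shift by [taud], the delay [s] costs the translation error at [s - taud]. It
    is at most [eps] when [|s - taud| < d]; otherwise it is at most [4 * G], hence at most
    [4 * G / d * |s - taud|]. *)
Lemma delayed_translation_le h (t eps d G : R) : smeas h -> 0 <= eps -> 0 < d ->
  (\int[mu]_x (`|h x| ^+ 2)%:E = G%:E)%E ->
  (forall s, `|s| < d -> (translation_error h s <= eps%:E)%E) ->
  (\int[mu]_(r in `]0%R, t[) \int[sigma]_(s in D) (`|h (r - s)%R - h (r - taud)%R| ^+ 2)%:E <=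
   (eps * mass + 4 * G / d * dist)%:E)%E.
Proof.
move=> mh eps0 d0 hG hd; have [t1 t2] := andP td.
have G0 : 0 <= G by rewrite -lee_fin -hG; apply: integral_ge0 => x _; rewrite lee_fin sqr_ge0.
have mF : measurable_fun setT (fun p : RT * RT => `|h (p.1 - p.2) - h (p.1 - taud)| ^+ 2).
  apply: measurable_funX; apply: smeas_norm; apply: smeasB; first exact: smeas_shift_pair.
  apply: (smeas_comp (h := fun p : RT * RT => p.1 - taud : RT)) => //.
  by apply: measurable_funB => //; exact: (@measurable_fst _ _ RT RT).
have [_ ->] := @tonelli_domain `]0, t[%classic D _ (measurable_itv _) mD mF (fun p => sqr_ge0 _).
have c0 : 0 <= 4 * G / d by rewrite divr_ge0 ?mulr_ge0// ltW.
apply: (@le_trans _ _ (\int[sigma]_(s in D) (eps%:E + (4 * G / d)%:E * `|s - taud|%:E))%E).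
  apply: ge0_le_lower_integral.
  - exact: subset_refl.
  - by move=> s _; apply: integral_ge0 => r _; rewrite lee_fin sqr_ge0.
  - by move=> s _; rewrite -EFinM -EFinD lee_fin addr_ge0// mulr_ge0.
  move=> s _; apply: (@le_trans _ _ (translation_error h (s - taud))).
    rewrite /translation_error.
    rewrite -(@ge0_integral_translation _ taud (fun x =>
      (`|h (x - (s - taud))%R - h x| ^+ 2)%:E))//; last first.
      by apply: smeas_sqr_norm; exact: smeas_translation_sub.
    apply: ge0_le_lower_integral.
    - exact: subsetT.
    - by move=> r _; rewrite lee_fin sqr_ge0.
    - by move=> r _; rewrite lee_fin sqr_ge0.
    by move=> r _; have -> : r - taud - (s - taud) = r - s by lra.
  rewrite -EFinM -EFinD; have [sd|sd] := ltP `|s - taud| d.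
    by apply: (le_trans (hd _ sd)); rewrite lee_fin lerDl mulr_ge0.
  apply: (le_trans (translation_error_le _ mh)); rewrite hG -EFinM lee_fin.
  apply: (@le_trans _ _ (4 * G / d * `|s - taud|)); last by rewrite lerDr.
  by rewrite -mulrA ler_peMr ?mulr_ge0// ler_pdivlMl// mulr1.
rewrite ge0_integralD//; last 2 first.
- by move=> s _; rewrite -EFinM lee_fin mulr_ge0.
- by apply: measurable_funeM; apply/measurable_EFinP; exact: measurable_funTS.
rewrite integral_cst//= massE ge0_integralZl_EFin//; last first.
  by apply/measurable_EFinP; exact: measurable_funTS.
by rewrite distE.
Qed.

End functions.
End delay_estimates.

(** * Continuous representatives and joined trajectories *)

Section representatives.
Context (R : realType).
Notation mu := (@lebesgue_measure R).
Notation RT := (measurableTypeR R).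

Lemma ae_neq (a : R) : {ae mu, forall x, x != a}.
Proof.
exists [set a]; split => //; first exact: lebesgue_measure_set1.
by move=> x /= /negP; rewrite negbK => /eqP.
Qed.

(** If the functions differed at one point, they would differ on an interval []a, b[] of positive
    length inside []0, T[]. *)
Lemma continuous_ae_eq (B : normedModType R) (T : R) (c1 c2 : R -> B) : 0 < T ->
  {within `[0, T], continuous c1} -> {within `[0, T], continuous c2} ->
  {ae mu, forall x, x \in `]0, T[ -> c1 x = c2 x} ->
  forall x, 0 <= x <= T -> c1 x = c2 x.
Proof.
move=> T0 cc1 cc2 [N [mN N0 sN]] t tT.
apply/eqP; rewrite -subr_eq0 -normr_eq0; apply/negPn/negP => d_neq0.
have d0 : 0 < `|c1 t - c2 t| by rewrite lt_neqAle eq_sym d_neq0/=.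
have /subspace_continuousP/(_ t) := cc1; rewrite /= in_itv/= => /(_ tT) h1.
have /subspace_continuousP/(_ t) := cc2; rewrite /= in_itv/= => /(_ tT) h2.
have : `|c1 x - c2 x| @[x --> within `[0, T] (nbhs t)] --> `|c1 t - c2 t|.
  by apply: cvg_norm; exact: cvgB.
move=> /cvgr_gt/(_ 0 d0)/nbhs_ballP[e /= e0 he].
pose a := Num.max 0 (t - e); pose b := Num.min T (t + e).
have ab : a < b.
  by rewrite gt_max !lt_min; lra.
have abN : `]a, b[%classic `<=` N.
  move=> x; rewrite /= in_itv/= gt_max lt_min => /andP[/andP[x0 xt] /andP[xT xe]].
  apply: sN => /= /(_ _) c12.
  have : 0 < `|c1 x - c2 x|.
    apply: he; last by rewrite /= in_itv/=; lra.
    by rewrite /ball/= ltr_norml; lra.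
  by rewrite c12 ?subrr ?normr0 ?ltxx// in_itv/= x0.
have : (mu `]a, b[%classic <= mu N)%E by apply: le_measure; rewrite ?inE//.
by rewrite N0 lebesgue_measure_itv/= lte_fin ab -EFinB lee_fin subr_le0 leNgt ab.
Qed.

(** Almost everywhere, [h] is the sum of the extensions by 0 of [psi] and [u]; the junction point 0
    is negligible. *)
Lemma joined_trajectory_L2 (V : normedModType R) (T tau : R) (psi u h : RT -> V) :
  0 < T -> 0 < tau ->
  in_L2 mu `]- tau, 0[ psi -> in_L2 mu `]0, T[ u -> smeas h ->
  (forall x, ~ `]- tau, T[%classic x -> h x = 0) ->
  {ae mu, forall t : R, t \in `]- tau, T[ -> h t = if t < 0 then psi t else u t} ->
  (\int[mu]_x (`|h x| ^+ 2)%:E < +oo)%E.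
Proof.
move=> T0 tau0 psi2 u2 mh h0 hE.
have mI (a b : R) : measurable (`]a, b[%classic : set RT) by [].
have [p [mp p0 pE p2]] := in_L2_borel (mI _ _) psi2.
have [v [mv v0 vE v2]] := in_L2_borel (mI _ _) u2.
have hpv : {ae mu, forall x, h x = p x + v x}.
  have := ae_and (ae_and hE (ae_neq 0)) (ae_and pE vE).
  apply: ae_mono => x [[hx x0] [px vx]].
  have [xD|xD] := boolP (x \in `]- tau, T[); last first.
    rewrite h0 ?p0 ?v0 ?addr0//.
    - move=> xT; move: xD; rewrite in_itv/= negb_and -!leNgt; move: xT; rewrite /= in_itv/= =>
      /andP[? ?] /orP[?|?]; lra.
    - move=> xT; move: xD; rewrite in_itv/= negb_and -!leNgt; move: xT; rewrite /= in_itv/= =>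
      /andP[? ?] /orP[?|?]; lra.
    - by move=> xT; move: xD; rewrite xT.
  rewrite hx//; move: xD; rewrite in_itv/= => /andP[x1 x2].
  case: ifPn => [xn|xn].
    rewrite px; last by rewrite /= in_itv/= x1.
    rewrite v0 ?addr0//= in_itv/= => /andP[? _]; lra.
  have xp : 0 < x by rewrite lt_neqAle eq_sym x0 leNgt.
  rewrite vx; last by rewrite /= in_itv/= xp.
  by rewrite p0 ?add0r//= in_itv/= => /andP[_ ?]; lra.
apply: (@le_lt_trans _ _ (\int[mu]_x (`|p x + v x|%R ^+ 2)%:E)%E).
  apply: ge0_ae_le_lower_integral.
  - exact: measurableT.
  - exact: smeas_sqr_norm.
  - by move=> x _; rewrite lee_fin sqr_ge0.
  - by move=> x _; rewrite lee_fin sqr_ge0.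
  by apply: ae_mono hpv => x -> _; exact: lexx.
apply: (le_lt_trans (sqr_L2D_le measurableT mp mv)).
by rewrite lte_add_pinfty// lte_mul_pinfty.
Qed.

End representatives.

(** Bound for the squared [L^2] norm of the difference of the delay terms: [M] bounds the mass, [q]
    is the defect of mass, [G] the squared norm of the limit trajectory and [Rn] the consistency
    error. The factors 2 come from squaring sums. *)
Definition delay_bound (R : realType)
    (sigma : {finite_measure set (measurableTypeR R) -> \bar R})
    (tau taud L M q G Rn : R) (V : normedModType R) (w : measurableTypeR R -> V)
    (t : R) : R :=
  2 * L ^+ 2 * (M * (2 * (fine (sigma (`[0, tau] `&` `[0, taud / 2])) * energy_before w t +
    fine (sigma `[0, tau]%classic) * energy_before w (t - taud / 2)) + 2 * Rn) + q ^+ 2 * G).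

Section delay_difference.
Context (R : realType) (V : hilbertType R).
Notation mu := (@lebesgue_measure R).
Notation RT := (measurableTypeR R).

Lemma is_bochner_integral_ext d (X : measurableType d) (sigma : {measure set X -> \bar R})
    (D : set X) (f1 f2 : X -> dual V) (I : dual V) : (forall x, D x -> f1 x = f2 x) ->
  is_bochner_integral sigma D f1 I -> is_bochner_integral sigma D f2 I.
Proof.
move=> f12 [s_ [sint scvg serr sI]]; exists s_; split; [exact: sint| |  |exact: sI].
  by apply: ae_mono scvg => x h Dx; rewrite -f12//; exact: h.
apply: cvg_trans serr; apply: near_eq_cvg; apply: nearW => n.
by apply: eq_integral => x /set_mem Dx; rewrite f12.
Qed.

(** For [t] in []0, T[] and [s] in [[0, tau]], [t - s] stays in []- tau, T[], so extension by 0
    leaves the Bochner integrals unchanged. *)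
Lemma is_delay_term_borel (T tau : R) (A : V -> dual V)
    (sigma : {measure set RT -> \bar R}) (g : RT -> V) (k : RT -> dual V) :
  @is_delay_term R T tau V A sigma g k ->
  exists h : RT -> V, [/\ smeas h, forall x, ~ `]- tau, T[%classic x -> h x = 0,
    {ae mu, forall t, t \in `]- tau, T[ -> h t = g t} &
    {ae mu, forall t, t \in `]0, T[ ->
      is_bochner_integral sigma `[0, tau] (fun s => A (h (t - s))) (k t)}].
Proof.
move=> [g' [mg' gg' bg']]; exists (zext `]- tau, T[%classic g'); split.
- by apply: smeas_zext => //; exact: measurable_itv.
- by move=> x xD; rewrite /zext memNset.
- by apply: ae_mono gg' => t h tT; rewrite /zext mem_set// h.
apply: ae_mono bg' => t h tT; have {}h := h tT; apply: is_bochner_integral_ext h => s.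
rewrite /= in_itv/= => /andP[s0 st]; congr A.
rewrite /zext mem_set//= in_itv/=.
by move: tT; rewrite in_itv/= => /andP[? ?]; lra.
Qed.

Variables (sigma : {finite_measure set RT -> \bar R}) (tau taud L M q G Rn T : R).
Hypothesis td : 0 < taud <= tau.
Hypothesis M0 : 0 < M.
Let D : set RT := `[0, tau]%classic.
Variables (g h : RT -> V) (K : RT -> dual V).
Hypotheses (mg : smeas g) (mh : smeas h) (mK : smeas K).
Let w (x : RT) : V := g x - h x.
Hypothesis w2 : (\int[mu]_x (`|w x| ^+ 2)%:E < +oo)%E.
Hypothesis hG : (\int[mu]_x (`|h x| ^+ 2)%:E = G%:E)%E.
Hypothesis hR : (\int[mu]_(r in `]0%R, T[) \int[sigma]_(s in D)
  (`|h (r - s)%R - h (r - taud)%R| ^+ 2)%:E <= Rn%:E)%E.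
Hypothesis KE : {ae mu, forall r, r \in `]0, T[ ->
  ((`|K r| ^+ 2)%:E <= (2 * L ^+ 2)%:E * (M%:E *
    \int[sigma]_(s in D) (`|g (r - s)%R - h (r - taud)%R| ^+ 2)%:E +
    (q ^+ 2 * `|h (r - taud)%R| ^+ 2)%:E))%E}.

(** Write [g(r - s) - h(r - taud)] as [w(r - s)] plus [h(r - s) - h(r - taud)] and integrate the
    pointwise bound on [K] term by term. *)
Lemma delay_difference_L2 (t : R) : t <= T ->
  (\int[mu]_(r in `]0%R, t[) (`|K r| ^+ 2)%:E <= (delay_bound sigma tau taud L M q G Rn w t)%:E)%E.
Proof.
move=> tT.
have mD : measurable D by exact: measurable_itv.
have mI (a b : R) : measurable (`]a, b[%classic : set RT) by [].
have mw : smeas w by exact: smeasB.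
have msub (f : RT -> V) (P : RT * RT -> RT) : measurable_fun setT P -> smeas f ->
  smeas (fun p => f (P p)).
  by move=> mP mf; exact: (smeas_comp mP).
have mP1 : measurable_fun setT (fun p : RT * RT => p.1 - p.2 : RT).
  by apply: measurable_funB;
    [exact: (@measurable_fst _ _ RT RT)|exact: (@measurable_snd _ _ RT RT)].
have mP2 : measurable_fun setT (fun p : RT * RT => p.1 - taud : RT).
  by apply: measurable_funB => //; exact: (@measurable_fst _ _ RT RT).
pose F1 (p : RT * RT) : R := `|g (p.1 - p.2) - h (p.1 - taud)| ^+ 2.
pose F2 (p : RT * RT) : R := `|w (p.1 - p.2)| ^+ 2.
pose F3 (p : RT * RT) : R := `|h (p.1 - p.2) - h (p.1 - taud)| ^+ 2.
have mF1 : measurable_fun setT F1.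
  by apply: measurable_funX; apply: smeas_norm; apply: smeasB; exact: msub.
have mF2 : measurable_fun setT F2.
  by apply: measurable_funX; apply: smeas_norm; exact: msub.
have mF3 : measurable_fun setT F3.
  by apply: measurable_funX; apply: smeas_norm; apply: smeasB; exact: msub.
have [mY1 _] := tonelli_domain sigma (mI 0 T) mD mF1 (fun p => sqr_ge0 _).
have [mY2 _] := tonelli_domain sigma (mI 0 T) mD mF2 (fun p => sqr_ge0 _).
have [mY3 _] := tonelli_domain sigma (mI 0 T) mD mF3 (fun p => sqr_ge0 _).
pose Y1 (r : RT) : \bar R := (\int[sigma]_(s in D) (F1 (r, s))%:E)%E.
pose Y2 (r : RT) : \bar R := (\int[sigma]_(s in D) (F2 (r, s))%:E)%E.
pose Y3 (r : RT) : \bar R := (\int[sigma]_(s in D) (F3 (r, s))%:E)%E.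
pose Y4 (r : RT) : \bar R := (`|h (r - taud)%R| ^+ 2)%:E.
have mY4 : measurable_fun setT Y4 by apply: smeas_sqr_norm; exact: smeas_translation.
have Y10 r : (0 <= Y1 r)%E by apply: integral_ge0 => s _; rewrite lee_fin sqr_ge0.
have Y20 r : (0 <= Y2 r)%E by apply: integral_ge0 => s _; rewrite lee_fin sqr_ge0.
have Y30 r : (0 <= Y3 r)%E by apply: integral_ge0 => s _; rewrite lee_fin sqr_ge0.
have Y40 r : (0 <= Y4 r)%E by rewrite lee_fin sqr_ge0.
have mP (F : RT * RT -> R) r : measurable_fun setT F -> measurable_fun D (fun s : RT => (F (r,
  s))%:E).
  by move=> mF; apply/measurable_EFinP; apply: measurable_funTS; exact: (measurableT_comp mF).
have Y1le r : (Y1 r <= 2%:E * Y2 r + 2%:E * Y3 r)%E.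
  rewrite /Y1 /Y2 /Y3 -!ge0_integralZl_EFin//; last 4 first.
  - by move=> s _; rewrite lee_fin sqr_ge0.
  - exact: mP.
  - by move=> s _; rewrite lee_fin sqr_ge0.
  - exact: mP.
  rewrite -ge0_integralD//; last 4 first.
  - by move=> s _; rewrite -EFinM lee_fin mulr_ge0// sqr_ge0.
  - by apply: measurable_funeM; exact: mP.
  - by move=> s _; rewrite -EFinM lee_fin mulr_ge0// sqr_ge0.
  - by apply: measurable_funeM; exact: mP.
  apply: ge0_le_lower_integral.
  - exact: subset_refl.
  - by move=> s _; rewrite lee_fin sqr_ge0.
  - by move=> s _; rewrite -!EFinM -EFinD lee_fin addr_ge0// mulr_ge0// sqr_ge0.
  move=> s _; rewrite -!EFinM -EFinD lee_fin /F1 /F2 /F3 /w/=.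
  by rewrite -(subrKA (h (r - s))) sqr_normD_le.
have c0 : 0 <= 2 * L ^+ 2 by rewrite mulr_ge0// sqr_ge0.
have q0 : 0 <= q ^+ 2 by rewrite sqr_ge0.
have M0' := ltW M0.
pose Z (r : RT) : \bar R :=
  ((2 * L ^+ 2)%:E * (M%:E * (2%:E * Y2 r + 2%:E * Y3 r) + (q ^+ 2)%:E * Y4 r))%E.
apply: (@le_trans _ _ (\int[mu]_(r in `]0%R, t[) Z r)%E).
  apply: ge0_ae_le_lower_integral.
  - exact: measurable_itv.
  - by apply: measurable_funTS; exact: smeas_sqr_norm.
  - by move=> r _; rewrite lee_fin sqr_ge0.
  - move=> r _; rewrite mule_ge0 ?lee_fin// adde_ge0// mule_ge0 ?lee_fin//.
    by rewrite adde_ge0// mule_ge0.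
  apply: ae_mono KE => r hr rt.
  have rT : r \in `]0, T[ by move: rt; rewrite /= !in_itv/= => /andP[? ?]; apply/andP; split; lra.
  apply: (le_trans (hr rT)); rewrite lee_wpmul2l ?lee_fin// EFinM leeD2r//.
  by rewrite lee_wpmul2l ?lee_fin//; exact: Y1le.
pose I : set RT := `]0, t[%classic.
have mI' : measurable I by exact: measurable_itv.
have n2 r : I r -> (0 <= Y2 r)%E by [].
have n3 r : I r -> (0 <= Y3 r)%E by [].
have n4 r : I r -> (0 <= Y4 r)%E by [].
have m2 : measurable_fun I Y2 by exact: measurable_funTS.
have m3 : measurable_fun I Y3 by exact: measurable_funTS.
have m4 : measurable_fun I Y4 by exact: measurable_funTS.
have ZE : (\int[mu]_(r in I) Z r = (2 * L ^+ 2)%:E * (M%:E * (2%:E * \int[mu]_(r in I) Y2 r +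
    2%:E * \int[mu]_(r in I) Y3 r) + (q ^+ 2)%:E * \int[mu]_(r in I) Y4 r))%E.
  have n2' r : I r -> (0 <= 2%:E * Y2 r)%E by move=> _; exact: mule_ge0.
  have n3' r : I r -> (0 <= 2%:E * Y3 r)%E by move=> _; exact: mule_ge0.
  have n4' r : I r -> (0 <= (q ^+ 2)%:E * Y4 r)%E by move=> _; rewrite mule_ge0 ?lee_fin.
  have n23 r : I r -> (0 <= 2%:E * Y2 r + 2%:E * Y3 r)%E by move=> Ir; rewrite adde_ge0 ?n2' ?n3'.
  have nM r : I r -> (0 <= M%:E * (2%:E * Y2 r + 2%:E * Y3 r))%E.
    by move=> Ir; rewrite mule_ge0 ?n23 ?lee_fin.
  have m2' : measurable_fun I (fun r => 2%:E * Y2 r)%E by exact: measurable_funeM.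
  have m3' : measurable_fun I (fun r => 2%:E * Y3 r)%E by exact: measurable_funeM.
  have m4' : measurable_fun I (fun r => (q ^+ 2)%:E * Y4 r)%E by exact: measurable_funeM.
  have m23 : measurable_fun I (fun r => 2%:E * Y2 r + 2%:E * Y3 r)%E by exact: emeasurable_funD.
  have mM : measurable_fun I (fun r =>
    M%:E * (2%:E * Y2 r + 2%:E * Y3 r))%E by exact: measurable_funeM.
  rewrite -(ge0_integralZl_EFin mu mI' n2 m2 (ltW (ltr0Sn R 1))).
  rewrite -(ge0_integralZl_EFin mu mI' n3 m3 (ltW (ltr0Sn R 1))).
  rewrite -(ge0_integralZl_EFin mu mI' n4 m4 q0).
  rewrite -(ge0_integralD mu mI' n2' m2' n3' m3').
  rewrite -(ge0_integralZl_EFin mu mI' n23 m23 M0').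
  rewrite -(ge0_integralD mu mI' nM mM n4' m4').
  rewrite -(ge0_integralZl_EFin mu mI' _ _ c0)//.
    by move=> r Ir; rewrite adde_ge0 ?nM ?n4'.
  exact: emeasurable_funD.
rewrite ZE {ZE}.
have i2 := delayed_energy_le sigma td t mw w2.
have i3 : (\int[mu]_(r in `]0%R, t[) Y3 r <= Rn%:E)%E.
  apply: le_trans hR; apply: ge0_le_lower_integral => //.
    by apply: subset_itvl; rewrite bnd_simp.
  by move=> r _; exact: Y30.
have i4 : (\int[mu]_(r in `]0%R, t[) Y4 r <= G%:E)%E.
  rewrite -hG -(ge0_integral_translation taud (smeas_sqr_norm mh))//.
  exact: ge0_le_lower_integral.
set X2 := (_ + _)%:E in i2.
have -> : (delay_bound sigma tau taud L M q G Rn w t)%:E =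
    ((2 * L ^+ 2)%:E * (M%:E * (2%:E * X2 + 2%:E * Rn%:E) + (q ^+ 2)%:E * G%:E))%E by [].
apply: lee_wpmul2l; first by rewrite lee_fin.
apply: leeD; last by apply: lee_wpmul2l; rewrite ?lee_fin.
apply: lee_wpmul2l; first by rewrite lee_fin.
by apply: leeD; apply: lee_wpmul2l; rewrite ?lee_fin.
Qed.

End delay_difference.

(** * Stability of weak solutions *)

Lemma L2B (R : realType) (B : normedModType R) (f g : measurableTypeR R -> B) :
  smeas f -> smeas g ->
  (\int[lebesgue_measure]_x (`|f x| ^+ 2)%:E < +oo)%E ->
  (\int[lebesgue_measure]_x (`|g x| ^+ 2)%:E < +oo)%E ->
  (\int[lebesgue_measure]_x (`|f x - g x|%R ^+ 2)%:E < +oo)%E.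
Proof.
move=> mf mg f2 g2.
have mNg : smeas (fun x => - g x) by apply: (smeas_op1 _ mg) => b; exact: oppr_continuous.
apply: (le_lt_trans (sqr_L2D_le measurableT mf mNg)).
rewrite lte_add_pinfty// lte_mul_pinfty//.
by under eq_integral do rewrite normrN.
Qed.

(** Subtraction of two equations with the same right-hand side [f]: the defect of the difference of
    the solutions is the difference of their delay terms. *)
Lemma balance_difference (Z : zmodType) (d1 d a1 a k1 k : Z) :
  d1 + a1 + k1 = d + a + k -> - (d1 - d) - (a1 - a) = k1 - k.
Proof.
move=> e; have -> : k1 = d + a + k - (d1 + a1) by rewrite -e [d1 + a1 + k1]addrC addrK.
by rewrite !opprB opprD [RHS]addrAC addrK addrACA.
Qed.

Section stability.
Context (R : realType) (T tau taud m M L0 L1 alpha : R) (V H : hilbertType R).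
Context (i : gelfand_triple V H) (A0 A1 : {linear V -> dual V}).
Notation mu := (@lebesgue_measure R).
Notation RT := (measurableTypeR R).
Hypotheses (T0 : 0 < T) (tau0 : 0 < tau) (td : 0 < taud <= tau) (m0 : 0 <= m).
Hypotheses (M0 : 0 < M) (L0_gt0 : 0 < L0) (L1_gt0 : 0 < L1) (alpha_gt0 : 0 < alpha).
Hypothesis A0_bounded : forall v, `|A0 v| <= L0 * `|v|.
Hypothesis A1_bounded : forall v, `|A1 v| <= L1 * `|v|.
Hypothesis A0_coercive : forall v, alpha * `|v| ^+ 2 <= A0 v v.
Hypothesis sepV : separable_space V.

Lemma dt_is_time_derivative (u : RT -> V) : in_W T i u -> is_time_derivative T i u (dt T i u).
Proof. by move=> [_ [g hg]]; apply: xgetPex; exists g. Qed.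

Lemma energy_before_vanish (w : RT -> V) (t : R) : smeas w ->
  (\int[mu]_x (`|w x| ^+ 2)%:E < +oo)%E -> {ae mu, forall x, ~ `]0, T[%classic x -> w x = 0} ->
  t <= T -> energy_before w t = \int[mu]_(x in `]0, t[) (`|w x| ^+ 2).
Proof.
move=> mw w2 w0 tT; rewrite /energy_before /Rintegral; congr fine.
rewrite integral_mkcond [RHS]integral_mkcond.
have mw2 (D : set RT) : measurable D -> measurable_fun setT ((fun x => (`|w x| ^+ 2)%:E) \_ D).
  move=> mD; apply/measurable_restrict => //; rewrite setTI; apply: measurable_funTS;
    exact: smeas_sqr_norm.
apply: ge0_ae_eq_integral => //.
- by apply: mw2; exact: measurable_itv.
- by apply: mw2; exact: measurable_itv.
- by move=> x _; apply: erestrict_ge0 => y _; rewrite lee_fin sqr_ge0.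
- by move=> x _; apply: erestrict_ge0 => y _; rewrite lee_fin sqr_ge0.
apply: ae_mono w0 => x wx _; rewrite !patchE.
case: ifPn => x1; case: ifPn => x2 //.
  rewrite wx ?normr0 ?expr0n// => x3; move: x2; rewrite notin_setE; apply.
  by move: x1 x3; rewrite inE/= !in_itv/= => -> /andP[->].
exfalso; move: x1; rewrite notin_setE; apply.
by move: x2; rewrite inE/= !in_itv/= => /andP[].
Qed.

(** [dt] of a difference is a choice unrelated to those made for the two solutions. Having the same
    increments as [G], it equals [G] almost everywhere. *)
Lemma time_derivative_bound (v : RT -> V) (c : R -> H) (G : RT -> dual V) (bound : \bar R) :
  is_H_representative T i v c -> smeas G -> (\int[mu]_x (`|G x| ^+ 2)%:E < +oo)%E ->
  (forall x s t, 0 <= s -> s < t -> t <= T ->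
    dotp (c t) (i x) - dotp (c s) (i x) = \int[mu]_(r in `]s, t[) G r x) ->
  (\int[mu]_(x in `]0%R, T[) (`|G x| ^+ 2)%:E <= bound)%E ->
  (sqr_L2_norm mu `]0%R, T[ (dt T i v) <= bound)%E.
Proof.
move=> cv mG G2 cG Gb; apply: le_trans Gb.
have mI : measurable (`]0, T[%classic : set RT) by [].
have [[g hg]|nog] := pselect (exists g, is_time_derivative T i v g); last first.
  (* without a time derivative, dt has its default value 0 *)
  have -> : dt T i v = fun=> 0.
    by apply: xgetPN => g hg; apply: nog; exists g.
  rewrite /sqr_L2_norm; apply: ge0_le_lower_integral.
  - exact: subset_refl.
  - by move=> x _; rewrite lee_fin sqr_ge0.
  - by move=> x _; rewrite lee_fin sqr_ge0.
  by move=> x _; rewrite lee_fin normr0 expr0n/= sqr_ge0.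
have hd : is_time_derivative T i v (dt T i v) by apply: xgetPex; exists g.
have [d [md d0 dE d2]] := in_L2_borel mI hd.1.
have dinc := time_derivative_increment hd cv md dE d2.
have mGd : smeas (fun x => d x - G x) by exact: smeasB.
have Gd2 : (\int[mu]_x (`|d x - G x| ^+ 2)%:E < +oo)%E.
  exact: L2B.
have dG : {ae mu, forall r, r \in `]0, T[ -> d r - G r = 0}.
  apply: (increments_eq0_ae sepV mGd Gd2) => x s t s0 st tT.
  have mJ : measurable (`]s, t[%classic : set RT) by [].
  transitivity (\int[mu]_(r in `]s, t[) (d r x - G r x)); first exact: eq_Rintegral.
  rewrite RintegralB//; [|exact: dual_eval_L2_integrable|exact: dual_eval_L2_integrable].
  by rewrite -dinc// -cG// subrr.
rewrite /sqr_L2_norm; apply: ge0_ae_lower_integral_le.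
- exact: mI.
- by apply: measurable_funTS; exact: smeas_sqr_norm.
- by move=> x _; rewrite lee_fin sqr_ge0.
- by move=> x _; rewrite lee_fin sqr_ge0.
have := ae_and dE dG; apply: ae_mono => x [h1 h2] xT.
by rewrite -h1// lee_fin (_ : d x = G x)//; apply/eqP; rewrite -subr_eq0; apply/eqP; exact: h2.
Qed.

Section defect.
Variables (w : RT -> V) (D : RT -> dual V).
Hypotheses (mw : smeas w) (w2 : (\int[mu]_x (`|w x| ^+ 2)%:E < +oo)%E).
Hypotheses (mD : smeas D) (D2 : (\int[mu]_x (`|D x| ^+ 2)%:E < +oo)%E).

(** For [w] the difference of two solutions and [D] its time derivative, this is the delay term of
    the first minus that of the second. *)
Definition defect (r : RT) : dual V := - D r - A0 (w r).

Let mA0w : smeas (fun x => A0 (w x)).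
Proof. by apply: (smeas_op1 _ mw); exact: (bounded_linear_continuous L0_gt0 A0_bounded). Qed.

Lemma defect_smeas : smeas defect.
Proof.
by apply: smeasB => //; apply: (smeas_op1 _ mD) => b; exact: oppr_continuous.
Qed.

Let A0w2 (J : set RT) : measurable J -> (\int[mu]_(x in J) (`|A0 (w x)| ^+ 2)%:E <=
  (L0 ^+ 2)%:E * \int[mu]_(x in J) (`|w x| ^+ 2)%:E)%E.
Proof.
move=> mJ; rewrite -ge0_integralZl_EFin ?sqr_ge0//; last first.
  by apply: measurable_funTS; exact: smeas_sqr_norm.
apply: ge0_le_lower_integral.
- exact: subset_refl.
- by move=> x _; rewrite lee_fin sqr_ge0.
- by move=> x _; rewrite -EFinM lee_fin mulr_ge0// sqr_ge0.
move=> x _; rewrite -EFinM lee_fin -exprMn ler_pXn2r ?nnegrE// mulr_ge0//.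
exact: ltW.
Qed.

Lemma defect_L2 : (\int[mu]_x (`|defect x| ^+ 2)%:E < +oo)%E.
Proof.
apply: L2B => //.
- by apply: (smeas_op1 _ mD) => b; exact: oppr_continuous.
- by under eq_integral do rewrite normrN.
apply: (le_lt_trans (A0w2 measurableT)).
by rewrite lte_mul_pinfty// lee_fin sqr_ge0.
Qed.

Lemma sqr_L2_defect (J : set RT) : measurable J ->
  (\int[mu]_(x in J) (`|D x| ^+ 2)%:E <=
   2%:E * \int[mu]_(x in J) (`|defect x| ^+ 2)%:E +
   2%:E * ((L0 ^+ 2)%:E * \int[mu]_(x in J) (`|w x| ^+ 2)%:E))%E.
Proof.
move=> mJ.
apply: (le_trans _ (le_trans (sqr_L2D_le mJ defect_smeas mA0w) _)).
  apply: ge0_le_lower_integral.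
  - exact: subset_refl.
  - by move=> x _; rewrite lee_fin sqr_ge0.
  - by move=> x _; rewrite lee_fin sqr_ge0.
  by move=> x _; rewrite /defect subrK normrN.
by apply: leeD2l; apply: lee_wpmul2l; [rewrite lee_fin|exact: A0w2].
Qed.

(** Express [D] by the defect. Coercivity gives [- 2 * alpha * |w| ^+ 2], of which Young's
    inequality with weight [alpha] uses one half; the other half is kept as the energy on the
    left. *)
Lemma energy_balance (t : R) :
  2 * \int[mu]_(r in `]0, t[) D r (w r) + alpha * \int[mu]_(r in `]0, t[) (`|w r| ^+ 2) <=
  alpha^-1 * \int[mu]_(r in `]0, t[) (`|defect r| ^+ 2).
Proof.
have mJ : measurable (`]0, t[%classic : set RT) by [].
have i1 : mu.-integrable `]0, t[ (EFin \o (fun r => D r (w r))) by exact: pairing_integrable.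
have i2 : mu.-integrable `]0, t[ (EFin \o (fun r => `|w r| ^+ 2)) by exact: L2_integrable_sqr.
have i3 : mu.-integrable `]0, t[ (EFin \o (fun r => `|defect r| ^+ 2)).
  by apply: L2_integrable_sqr => //; [exact: defect_smeas|exact: defect_L2].
rewrite -!RintegralZl// -RintegralD//; [|exact: integrable_mulr|exact: integrable_mulr].
apply: le_Rintegral => //.
- by apply: integrable_addr => //; exact: integrable_mulr.
- exact: integrable_mulr.
move=> r _.
have e1 : D r (w r) = - defect r (w r) - A0 (w r) (w r).
  by rewrite /defect dualDE !dualNE; ring.
have e2 := A0_coercive (w r).
have e3 : - defect r (w r) <= `|defect r| * `|w r|.
  by rewrite -dualNE (le_trans (ler_norm _))// (le_trans (dual_le _ _))// normrN.
have e4 := young_ineq `|defect r| `|w r| alpha_gt0.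
have e5 : alpha^-1 * `|defect r| ^+ 2 = 2 * ((2 * alpha)^-1 * `|defect r| ^+ 2).
  by field; rewrite gt_eqF.
rewrite e1 e5.
move: (defect r (w r)) (A0 (w r) (w r)) (`|defect r| * `|w r|) ((2 * alpha)^-1 * `|defect r| ^+ 2)
  (`|w r| ^+ 2) e2 e3 e4.
move=> x1 x2 x3 x4 x5; lra.
Qed.

End defect.

Variables (sigma : {finite_measure set RT -> \bar R}).
Variables (u0 : H) (f : RT -> dual V) (psi u1 u : RT -> V).
Hypothesis sigmaM : (sigma `[0%R, tau]%classic <= M%:E)%E.
Hypothesis psi_L2 : in_L2 mu `]- tau, 0[ psi.
Hypothesis sol1 : weak_solution T tau i A0 A1 sigma u0 f psi u1.
Variables (cu : R -> H) (k : RT -> dual V) (h : RT -> V) (G Rn : R).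
Hypothesis Wu : in_W T i u.
Hypothesis cuE : is_H_representative T i u cu.
Hypothesis cu0 : cu 0 = u0.
Hypothesis mh : smeas h.
Hypothesis h_out : forall x, ~ `]- tau, T[%classic x -> h x = 0.
Hypothesis hE : {ae mu, forall t, t \in `]- tau, T[ -> h t = joined_trajectory psi u t}.
Hypothesis kE : {ae mu, forall t, t \in `]0, T[ ->
  is_bochner_integral (mscale (NngNum m0) \d_(taud : RT)) `[0, tau]
    (fun s => A1 (h (t - s))) (k t)}.
Hypothesis uE : {ae mu, forall t, t \in `]0, T[ -> dt T i u t + A0 (u t) + k t = f t}.
Hypothesis hG : (\int[mu]_x (`|h x| ^+ 2)%:E = G%:E)%E.
Hypothesis hR : (\int[mu]_(r in `]0%R, T[) \int[sigma]_(s in `[0%R, tau])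
  (`|h (r - s)%R - h (r - taud)%R| ^+ 2)%:E <= Rn%:E)%E.

(** Everything attached to the limit solution ([cu], [k], [h], [G]) is fixed beforehand, so that one
    and the same [h] serves all the measures. [w] and [c] are explicit representatives of the
    difference, to which the chosen values [H_rep] and [dt] are then compared. *)
Lemma stability : exists (w : RT -> V) (c : R -> H),
  let bound t := delay_bound sigma tau taud L1 M
    (fine (sigma `[0, tau]%classic) - m) G Rn w t in
  let d t := u1 t - u t in
  [/\ smeas w, (\int[mu]_x (`|w x| ^+ 2)%:E < +oo)%E, energy_before w 0 = 0, c 0 = 0 &
  [/\ forall t, 0 <= t <= T -> H_rep T i d t = c t,
    (sqr_L2_norm mu `]0%R, T[ d <= (energy_before w T)%:E)%E,
    (sqr_L2_norm mu `]0%R, T[ (dt T i d) <=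
      (2 * bound T + 2 * (L0 ^+ 2 * energy_before w T))%:E)%E &
    forall t, 0 < t <= T ->
      `|c t| ^+ 2 + alpha * energy_before w t <= alpha^-1 * bound t]].
Proof.
have [W1 [c1 c1E c10] [k1 /is_delay_term_borel[g [mg g_out gE k1E]] eq1]] := sol1.
have mI : measurable (`]0, T[%classic : set RT) by [].
have h2 : (\int[mu]_x (`|h x| ^+ 2)%:E < +oo)%E by rewrite hG ltry.
have g2 := joined_trajectory_L2 T0 tau0 psi_L2 W1.1 mg g_out gE.
pose w (x : RT) : V := g x - h x.
have mw : smeas w by exact: smeasB.
have w2 : (\int[mu]_x (`|w x| ^+ 2)%:E < +oo)%E by exact: L2B.
have wE : {ae mu, forall x, x \in `]0, T[ -> w x = u1 x - u x}.
  have := ae_and gE hE; apply: ae_mono => x [gx hx] xT.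
  have [x1 x2] : - tau < x /\ x < T by move: xT; rewrite in_itv/= => /andP[xp xT]; split => //;
    apply: lt_trans xp; rewrite oppr_lt0.
  have x0 : (x < 0) = false by move: xT; rewrite in_itv/= => /andP[? ?]; apply/negbTE;
    rewrite -leNgt ltW.
  by rewrite /w gx ?hx ?in_itv/= ?x1 ?x2// /joined_trajectory x0.
(* Before time 0 both trajectories coincide with [psi]. *)
have w_out : {ae mu, forall x, ~ `]0, T[%classic x -> w x = 0}.
  have := ae_and (ae_and gE hE) (ae_neq 0); apply: ae_mono => x [[gx hx] x0] xT.
  have [xD|xD] := boolP (x \in `]- tau, T[); last first.
    by rewrite /w g_out ?h_out ?subrr// => xD'; move: xD; rewrite xD'.
  have xn : x < 0.
    rewrite lt_neqAle x0/= leNgt; apply/negP => xp; apply: xT.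
    by rewrite /= in_itv/= xp; move: xD; rewrite in_itv/= => /andP[].
  by rewrite /w gx// hx// /joined_trajectory xn subrr.
have d1 := dt_is_time_derivative W1; have du := dt_is_time_derivative Wu.
have [b1 [mb1 b1_out b1E b12]] := in_L2_borel mI d1.1.
have [b [mb b_out bE b2]] := in_L2_borel mI du.1.
have inc1 := time_derivative_increment d1 c1E mb1 b1E b12.
have inc := time_derivative_increment du cuE mb bE b2.
pose D (x : RT) : dual V := b1 x - b x.
have mD : smeas D by exact: smeasB.
have D2 : (\int[mu]_x (`|D x| ^+ 2)%:E < +oo)%E by exact: L2B.
have D0 (x : R) : x <= 0 -> D x = 0.
  by move=> x0; rewrite /D b1_out ?b_out ?subrr//= in_itv/= ltNge x0.
pose c (t : R) : H := c1 t - cu t.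
have cc : {within `[0, T], continuous c}.
  by move=> x; have [/(_ x) h1 _] := c1E; have [/(_ x) h3 _] := cuE; apply: cvgB.
have c0 : c 0 = 0 by rewrite /c c10 cu0 subrr.
have cd : {ae mu, forall t, t \in `]0, T[ -> c t = i (u1 t - u t)}.
  have := ae_and c1E.2 cuE.2; apply: ae_mono => t [h1 h3] tT.
  by rewrite /c h1// h3// linearB.
have crep : is_H_representative T i (fun t => u1 t - u t) c by [].
have cinc v s t : 0 <= s -> s < t -> t <= T ->
    dotp (c t) (i v) - dotp (c s) (i v) = \int[mu]_(r in `]s, t[) D r v.
  move=> s0 st tT.
  have mJ : measurable (`]s, t[%classic : set RT) by [].
  transitivity (\int[mu]_(r in `]s, t[) (b1 r v - b r v)); last exact: eq_Rintegral.
  rewrite RintegralB//; [|exact: dual_eval_L2_integrable|exact: dual_eval_L2_integrable].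
  by rewrite -inc1// -inc// /c !dotpBl; ring.
have cw : {ae mu, forall r, r \in `]0, T[ -> c r = i (w r)}.
  by have := ae_and cd wE; apply: ae_mono => r [h1 h3] rT; rewrite h1// h3.
pose K := defect w D.
have mK : smeas K by exact: defect_smeas.
have taud01 : 0 <= taud <= tau by have /andP[/ltW -> ->] := td.
have KE : {ae mu, forall r, r \in `]0, T[ ->
  ((`|K r| ^+ 2)%:E <= (2 * L1 ^+ 2)%:E * (M%:E *
    \int[sigma]_(s in `[0%R, tau]) (`|g (r - s)%R - h (r - taud)%R| ^+ 2)%:E +
    ((fine (sigma `[0%R, tau]%classic) - m) ^+ 2 * `|h (r - taud)%R| ^+ 2)%:E))%E}.
  have := ae_and (ae_and k1E kE) (ae_and (ae_and eq1 uE) (ae_and wE (ae_and b1E bE))).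
  apply: ae_mono => r [[h1 h3] [[h4 h5] [h6 [h7 h8]]]] rT.
  have -> : K r = k1 r - k r.
    rewrite /K /defect /D h7// h8// h6// (linearB A0).
    by apply: balance_difference; rewrite h4// h5.
  exact: (delay_term_difference L1_gt0 A1_bounded taud01 mg mh M0 sigmaM (h1 rT) (h3 rT)).
have E0 : energy_before w 0 = 0.
  by rewrite energy_before_vanish// ?set_itvoo0 ?Rintegral_set0// ltW.
have bK (t : R) : t <= T -> (\int[mu]_(r in `]0%R, t[) (`|K r| ^+ 2)%:E <=
    (delay_bound sigma tau taud L1 M (fine (sigma `[0%R, tau]%classic) - m) G Rn w t)%:E)%E.
  by move=> tT; exact: (delay_difference_L2 td M0 mg mh mK w2 hG hR KE tT).
have wT : (\int[mu]_(x in `]0%R, T[) (`|w x| ^+ 2)%:E <= (energy_before w T)%:E)%E.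
  rewrite -energy_beforeE//; apply: ge0_le_lower_integral.
  - by apply: subset_itvr; rewrite bnd_simp.
  - by move=> x _; rewrite lee_fin sqr_ge0.
  - by move=> x _; rewrite lee_fin sqr_ge0.
  by [].
exists w, c; split => //; split.
(* [H_rep] is determined on [[0, T]] by continuity and its values almost everywhere, hence equals
   [c] there. *)
- move=> t tT.
  have hrep : is_H_representative T i (fun t => u1 t - u t) (H_rep T i (fun t => u1 t - u t)).
    by apply: xgetPex; exists c.
  apply: (continuous_ae_eq T0 hrep.1 crep.1 _ tT).
  by have := ae_and hrep.2 crep.2; apply: ae_mono => x [h1 h3] xT; rewrite h1// h3.
- apply: le_trans wT; apply: ge0_ae_lower_integral_le.
  + exact: mI.
  + by apply: measurable_funTS; exact: smeas_sqr_norm.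
  + by move=> x _; rewrite lee_fin sqr_ge0.
  + by move=> x _; rewrite lee_fin sqr_ge0.
  by apply: ae_mono wE => x wx xT; rewrite wx// lexx.
- apply: (time_derivative_bound crep mD D2 cinc).
  apply: (le_trans (sqr_L2_defect mw mD mI)).
  have bT := bK T (lexx T); move: bT; set Bd := delay_bound _ _ _ _ _ _ _ _ _ _ => bT.
  have -> : (2 * Bd + 2 * (L0 ^+ 2 * energy_before w T))%:E =
    (2%:E * Bd%:E + 2%:E * ((L0 ^+ 2)%:E * (energy_before w T)%:E))%E by [].
  apply: leeD.
    by apply: lee_wpmul2l; [rewrite lee_fin|exact: bT].
  by apply: lee_wpmul2l; [rewrite lee_fin|apply: lee_wpmul2l; [rewrite lee_fin sqr_ge0|exact: wT]].
- move=> t tT; have [t0 t1] := andP tT.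
  have e1 := energy_inequality mw w2 mD D2 D0 cc c0 cw cinc tT.
  have e2 := energy_balance mw w2 mD D2 t.
  rewrite energy_before_vanish//.
  apply: (le_trans (lerD e1 (lexx _))); apply: (le_trans e2).
  rewrite ler_pM2l ?invr_gt0// -lee_fin; apply: le_trans (bK _ t1).
  rewrite /Rintegral fineK//; apply: integrable_fin_num => //.
  apply: L2_integrable_sqr => //.
  exact: defect_L2.
Qed.

End stability.

(** * Convergence *)

(** Once [alpha^-1 * a n < alpha / 2], the term in [E n t] is absorbed by half of [alpha * E n t];
    what remains involves only [E n (t - delta)] and [r n]. Hence induction on the number of delays
    needed to cover [t]. *)
Lemma delayed_recursion_cvg (R : realType) (E : nat -> R -> R) (N : nat -> R -> R)
    (a b r : nat -> R) (alpha delta T beta : R) :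
  0 < alpha -> 0 < delta -> (forall n t, 0 <= N n t) -> (forall n t, 0 <= E n t) ->
  (forall n s t, s <= t -> E n s <= E n t) -> (forall n, E n 0 = 0) ->
  a n @[n --> \oo] --> 0 -> b n @[n --> \oo] --> beta -> r n @[n --> \oo] --> 0 ->
  (forall n t, 0 < t <= T ->
    N n t + alpha * E n t <= alpha^-1 * (a n * E n t + b n * E n (t - delta) + r n)) ->
  forall t, t <= T -> E n t @[n --> \oo] --> 0.
Proof.
move=> alpha0 delta0 N0 E0 Ele E00 a0 bb r0 H.
suff K k : forall t, t <= T -> t <= k%:R * delta -> E n t @[n --> \oo] --> 0.
  move=> t tT; apply: (K (Num.truncn (t / delta)).+1) => //.
  by rewrite -ler_pdivrMr// ltW// truncnS_gt.
elim: k => [|k IH] t tT tk.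
  have -> : (fun n => E n t) = (fun=> 0).
    apply/funext => n; apply/eqP; rewrite eq_le E0 andbT -(E00 n) Ele//.
    by move: tk; rewrite mul0r.
  exact: cvg_cst.
have [t0|t0] := leP t 0.
  have -> : (fun n => E n t) = (fun=> 0).
    by apply/funext => n; apply/eqP; rewrite eq_le E0 andbT -(E00 n) Ele.
  exact: cvg_cst.
have Ed : E n (t - delta) @[n --> \oo] --> 0.
  by apply: IH; [lra|move: tk; rewrite -natr1 mulrDl mul1r; lra].
have ub : 2 * alpha^-1 * (alpha^-1 * (b n * E n (t - delta) + r n)) @[n --> \oo] --> 0.
  rewrite -[X in _ --> X](mulr0 (2 * alpha^-1)); apply: cvgMr.
  rewrite -[X in _ --> X](mulr0 (alpha^-1)); apply: cvgMr.
  rewrite -[X in _ --> X](addr0 0) -[X in _ --> X + _](mulr0 beta).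
  by apply: cvgD => //; exact: cvgM.
apply: (squeeze_cvgr _ (cvg_cst 0) ub).
have a1 : alpha^-1 * a n @[n --> \oo] --> 0.
  by rewrite -[X in _ --> X](mulr0 (alpha^-1)); apply: cvgMr.
near=> n; rewrite E0/=.
have an : alpha^-1 * a n < alpha / 2.
  by near: n; apply: (cvgr_lt _ a1); rewrite divr_gt0.
have tT' : 0 < t <= T by rewrite t0.
have h := H n t tT'; have n0 := N0 n t; have e0 := E0 n t.
have -> : 2 * alpha^-1 = (alpha / 2)^-1 by rewrite invf_div.
rewrite ler_pdivlMl; last by rewrite divr_gt0.
have h1 : alpha^-1 * a n * E n t <= alpha / 2 * E n t by rewrite ler_wpM2r// ltW.
move: h; rewrite -addrA mulrDr mulrA.
move: (alpha^-1 * (b n * E n (t - delta) + r n)) (alpha^-1 * a n * E n t) h1 => x y.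
have -> : alpha * E n t = alpha / 2 * E n t + alpha / 2 * E n t by field.
move: (alpha / 2 * E n t) => z h1 h2; lra.
Unshelve. all: by end_near. Qed.

Section cvg_norms.
Context (R : realType).

Lemma cvg_sqrt0 (z : nat -> R) : z n @[n --> \oo] --> 0 -> Num.sqrt (z n) @[n --> \oo] --> 0.
Proof. by move=> z0; rewrite -(@sqrtr0 R); apply: (cvg_comp z Num.sqrt z0);
  exact: sqrt_continuous. Qed.

Lemma cvge0_squeeze (x : nat -> \bar R) (z : nat -> R) :
  (forall n, 0 <= x n)%E -> (forall n, x n <= (z n)%:E)%E ->
  z n @[n --> \oo] --> 0 -> x n @[n --> \oo] --> 0%E.
Proof.
move=> x0 xz z0.
have z0' : (z n)%:E @[n --> \oo] --> 0%E by apply: cvg_EFin => //; exact: nearW.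
apply: (squeeze_cvge _ (cvg_cst 0%E) z0'); apply: nearW => n.
by rewrite x0 xz.
Qed.

Lemma W_norm_le (T : R) (V H : hilbertType R) (i : gelfand_triple V H) (u : R -> V) (z : R) :
  0 <= z ->
  (sqr_L2_norm lebesgue_measure `]0%R, T[ u +
    sqr_L2_norm lebesgue_measure `]0%R, T[ (dt T i u) <= z%:E)%E ->
  (W_norm T i u <= (Num.sqrt z)%:E)%E.
Proof.
move=> z0 uz; rewrite /W_norm -powR12_sqrt// -poweR_EFin.
apply: gt0_ler_poweR => //.
- by rewrite in_itv/= leey andbT adde_ge0//; apply: integral_ge0 => x _; rewrite lee_fin sqr_ge0.
- by rewrite in_itv/= leey andbT lee_fin.
Qed.

Lemma C_norm_le (T : R) (V H : hilbertType R) (i : gelfand_triple V H) (u : R -> V) (z : R) :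
  (forall t, 0 <= t <= T -> `|H_rep T i u t| <= z) -> (C_norm T i u <= z%:E)%E.
Proof.
move=> uz; apply: ge_ereal_sup => _ [t /= tT <-]; rewrite lee_fin; apply: uz.
by move: tT; rewrite in_itv.
Qed.

Lemma C_norm_ge0 (T : R) (V H : hilbertType R) (i : gelfand_triple V H) (u : R -> V) :
  0 < T -> (0 <= C_norm T i u)%E.
Proof.
move=> T0; apply: (@le_trans _ _ (`|H_rep T i u 0|%:E)); first by rewrite lee_fin.
by apply: ereal_sup_ubound; exists 0 => //=; rewrite in_itv/= lexx ltW.
Qed.

End cvg_norms.

Section narrow_limit.
Context (R : realType) (tau taud m : R).
Notation RT := (measurableTypeR R).
Hypotheses (td : 0 < taud <= tau) (m0 : 0 <= m).
Variable mu_ : nat -> {finite_measure set RT -> \bar R}.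
Hypothesis mu_cvg : narrow_cvg tau mu_ (mscale (NngNum m0) \d_(taud : RT)).

Lemma narrow_cvg_mass : fine (mu_ n `[0, tau]%classic) @[n --> \oo] --> m.
Proof.
have c1 : {within `[0, tau], continuous (fun=> 1 : R)}.
  by apply: continuous_subspaceT => x; exact: cvg_cst.
have := mu_cvg c1.
have mD : measurable (`[0, tau]%classic : set RT) by [].
have tauD : taud \in `[0, tau]%classic by rewrite inE/= in_itv/=; have /andP[/ltW -> ->] := td.
under eq_fun do rewrite Rintegral_cst// mul1r.
rewrite Rintegral_cst// mul1r [X in _ --> fine X](_ : _ = m%:E)//.
by rewrite /= /mscale/= diracE tauD mule1.
Qed.

Lemma narrow_cvg_dist :
  \int[mu_ n]_(s in `[0, tau]) `|s - taud| @[n --> \oo] --> 0.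
Proof.
have c1 : {within `[0, tau], continuous (fun s : R => `|s - taud|)}.
  by apply: continuous_subspaceT => x; apply: cvg_norm; apply: cvgB; [exact: cvg_id|exact: cvg_cst].
have := mu_cvg c1.
have mD : measurable (`[0, tau]%classic : set RT) by [].
rewrite [X in _ --> X](_ : _ = 0)//.
have mf : measurable_fun (`[0, tau]%classic : set RT) (fun s : RT => (`|s - taud|)%:E).
  apply/measurable_EFinP; apply: measurable_funTS; apply: measurableT_comp => //.
  exact: measurable_funB.
by rewrite /Rintegral ge0_integral_mscale// integral_dirac// subrr normr0 !mule0.
Qed.

End narrow_limit.

Theorem corollary5p11 (R : realType) (T tau : R) (T0 : 0 < T) (tau0 : 0 < tau)
  (V H : hilbertType R) (sepV : separable_space V) (sepH : separable_space H)
  (i : gelfand_triple V H)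
  (a0 a1 : {biscalar V}) (L0 L1 alpha0 : R)
  (L0_gt0 : 0 < L0) (L1_gt0 : 0 < L1) (alpha0_gt0 : 0 < alpha0)
  (a0_bounded : forall w v, `|a0 w v| <= L0 * `|w| * `|v|)
  (a1_bounded : forall w v, `|a1 w v| <= L1 * `|w| * `|v|)
  (a0_coercive : forall v : V, alpha0 * `|v| ^+ 2 <= a0 v v)
  (A0 A1 : {linear V -> dual V})
  (A0E : forall w v, A0 w v = a0 w v) (A1E : forall w v, A1 w v = a1 w v)
  (m : R) (m0 : 0 <= m) (taud : R) (taud_in : 0 < taud <= tau)
  (mu_ : nat -> {finite_measure set (measurableTypeR R) -> \bar R})
  (mu_supp : forall n, mu_ n (~` `[0, tau]) = 0%E)
  (mu_ac : forall n, mu_ n `<< @lebesgue_measure R)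
  (mu_cvg : narrow_cvg tau mu_ (mscale (NngNum m0) \d_(taud : measurableTypeR R)))
  (u0 : H) (f : R -> dual V) (psi : R -> V)
  (f_L2 : in_L2 lebesgue_measure `]0, T[ f)
  (psi_L2 : in_L2 lebesgue_measure `]- tau, 0[ psi)
  (u_ : nat -> R -> V) (u : R -> V)
  (u_sol : forall n, weak_solution T tau i A0 A1 (mu_ n) u0 f psi (u_ n))
  (uE : weak_solution T tau i A0 A1 (mscale (NngNum m0) \d_(taud : measurableTypeR R)) u0 f psi u) :
  W_norm T i (fun t => u_ n t - u t) @[n --> \oo] --> 0%E /\
  C_norm T i (fun t => u_ n t - u t) @[n --> \oo] --> 0%E.
Proof.
have A0_bounded v : `|A0 v| <= L0 * `|v|.
  by apply: dual_norm_bound => [|z]; [rewrite mulr_ge0// ltW|rewrite A0E; exact: a0_bounded].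
have A1_bounded v : `|A1 v| <= L1 * `|v|.
  by apply: dual_norm_bound => [|z]; [rewrite mulr_ge0// ltW|rewrite A1E; exact: a1_bounded].
have A0_coercive v : alpha0 * `|v| ^+ 2 <= A0 v v by rewrite A0E; exact: a0_coercive.
have [Wu [cu cuE cu0] [k /is_delay_term_borel[h [mh h_out hE kE]] ueq]] := uE.
have h2 := joined_trajectory_L2 T0 tau0 psi_L2 Wu.1 mh h_out hE.
pose G := fine (\int[lebesgue_measure]_x (`|h x| ^+ 2)%:E)%E.
have hG : (\int[lebesgue_measure]_x (`|h x| ^+ 2)%:E = G%:E)%E.
  by rewrite /G fineK// ge0_fin_numE// integral_ge0.
pose mass n := fine (mu_ n `[0, tau]%classic).
have mass0 n : 0 <= mass n by exact: fine_ge0.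
have massE n : (mu_ n `[0%R, tau]%classic = (mass n)%:E)%E.
  by rewrite /mass fineK//; exact: fin_num_measure.
pose dist n := \int[mu_ n]_(s in `[0, tau]) `|s - taud|.
(* The [+ 1] keeps [M n] positive even if [mu_ n] has no mass, and [M n] still converges. *)
pose M n := mass n + 1.
have M0 n : 0 < M n by rewrite /M ltr_wpDl.
have massM n : (mu_ n `[0%R, tau]%classic <= (M n)%:E)%E by rewrite massE lee_fin lerDl.
pose shift n := (\int[lebesgue_measure]_(r in `]0%R, T[) \int[mu_ n]_(s in `[0%R, tau])
  (`|h (r - s)%R - h (r - taud)%R| ^+ 2)%:E)%E.
(* [C] depends on [eps] but not on [n], so [n] can tend to infinity with [eps] fixed. *)
have shift_le eps : 0 < eps -> exists C, forall n,
    (shift n <= (eps * mass n + C * dist n)%:E)%E.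
  move=> eps0; have [d d0 hd] := translation_continuous_L2 mh h2 eps0.
  exists (4 * G / d) => n.
  exact: (delayed_translation_le (mu_ n) taud_in T mh (ltW eps0) d0 hG hd).
have shift0 n : (0 <= shift n)%E.
  by apply: integral_ge0 => r _; apply: integral_ge0 => s _; rewrite lee_fin sqr_ge0.
pose Rn n := fine (shift n).
have shiftE n : shift n = (Rn n)%:E.
  rewrite /Rn fineK// ge0_fin_numE//.
  by have [C /(_ n) HC] := shift_le 1 ltr01; apply: le_lt_trans HC _; exact: ltry.
have Rn0 n : 0 <= Rn n by exact: fine_ge0.
have hR n : (shift n <= (Rn n)%:E)%E by rewrite shiftE.
have mass_cvg : mass n @[n --> \oo] --> m by exact: (narrow_cvg_mass taud_in mu_cvg).
have dist_cvg : dist n @[n --> \oo] --> 0 by exact: (narrow_cvg_dist mu_cvg).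
have Rn_cvg : Rn n @[n --> \oo] --> 0.
  apply/cvgrPdist_le => e e0.
  (* [mass n <= m + 1] for large [n], so the [eps] term is at most [e / 2]; the divisor is positive
     even for [m = 0]. *)
  have e1 : 0 < e / (2 * (m + 1)) by rewrite divr_gt0// mulr_gt0// ltr_wpDl.
  have [C HC] := shift_le _ e1.
  have Cd : C * dist n @[n --> \oo] --> 0.
    by rewrite -[X in _ --> X](mulr0 C); exact: cvgMr.
  near=> n; rewrite sub0r normrN ger0_norm//.
  have h1 : Rn n <= e / (2 * (m + 1)) * mass n + C * dist n.
    by rewrite -lee_fin -shiftE.
  have h3 : mass n <= m + 1.
    by near: n; apply: (cvgr_le _ mass_cvg); rewrite ltrDl.
  have h4 : C * dist n <= e / 2.
    by near: n; apply: (cvgr_le _ Cd); rewrite divr_gt0.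
  have h5 : e / (2 * (m + 1)) * mass n <= e / 2.
    have -> : e / 2 = e / (2 * (m + 1)) * (m + 1) by field; rewrite gt_eqF// ltr_wpDl.
    by rewrite ler_pM2l.
  apply: (le_trans h1); apply: (le_trans (lerD h5 h4)).
  by rewrite -mulrDl -mulr2n -[e *+ 2]mulr_natr mulfK.
have /choice[w_ H1] := fun n => stability T0 tau0 taud_in (M0 n) L0_gt0 L1_gt0
  alpha0_gt0 A0_bounded A1_bounded A0_coercive sepV (massM n) psi_L2 (u_sol n) Wu cuE cu0
  mh h_out hE kE ueq hG (hR n).
have {H1}[c_ H_] := choice H1.
pose d n t := u_ n t - u t.
pose E n t := energy_before (w_ n) t.
pose bound n t := delay_bound (mu_ n) tau taud L1 (M n) (mass n - m) G (Rn n) (w_ n) t.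
have E_le n s t : s <= t -> E n s <= E n t.
  by have [sw w2 _ _ _] := H_ n; exact: energy_before_le.
have E_ge0 n t : 0 <= E n t by exact: energy_before_ge0.
have E00 n : E n 0 = 0 by have [_ _ ? _ _] := H_ n.
pose p n := fine (mu_ n (`[0, tau] `&` `[0, taud / 2])).
have p0 n : 0 <= p n by exact: fine_ge0.
have taud0 : 0 < taud by case/andP: taud_in.
have p_cvg : p n @[n --> \oo] --> 0.
  apply: (@squeeze_cvgr _ _ _ _ (fun=> 0) (fun n => (taud / 2)^-1 * dist n)).
  - by apply: nearW => n; rewrite p0/=; exact: mass_near_zero_le.
  - exact: cvg_cst.
  - by rewrite -[X in _ --> X](mulr0 (taud / 2)^-1); exact: cvgMr.
have M_cvg : M n @[n --> \oo] --> m + 1 by apply: cvgD => //; exact: cvg_cst.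
(* The bound in the form of the recursion: a vanishing coefficient for the current energy, a
   convergent one for the delayed energy, and a vanishing remainder. *)
have boundE n t : bound n t = 2 * L1 ^+ 2 * (M n * (2 * p n)) * E n t
    + 2 * L1 ^+ 2 * (M n * (2 * mass n)) * E n (t - taud / 2)
    + 2 * L1 ^+ 2 * (M n * (2 * Rn n) + (mass n - m) ^+ 2 * G).
  by rewrite /bound /delay_bound -/(mass n) -/(p n) -/(E n t) -/(E n (t - taud / 2)); ring.
have a_cvg : 2 * L1 ^+ 2 * (M n * (2 * p n)) @[n --> \oo] --> 0.
  rewrite -[X in _ --> X](_ : 2 * L1 ^+ 2 * ((m + 1) * (2 * 0)) = 0); last by ring.
  by apply: cvgMr; apply: cvgM => //; exact: cvgMr.
have b_cvg : 2 * L1 ^+ 2 * (M n * (2 * mass n)) @[n --> \oo] -->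
    2 * L1 ^+ 2 * ((m + 1) * (2 * m)).
  by apply: cvgMr; apply: cvgM => //; exact: cvgMr.
have r_cvg : 2 * L1 ^+ 2 * (M n * (2 * Rn n) + (mass n - m) ^+ 2 * G)
    @[n --> \oo] --> 0.
  rewrite -[X in _ --> X](_ : 2 * L1 ^+ 2 * ((m + 1) * (2 * 0) + (m - m) ^+ 2 * G) = 0);
    last by ring.
  apply: cvgMr; apply: cvgD; first by apply: cvgM => //; exact: cvgMr.
  apply: cvgMl; under eq_fun do rewrite expr2; rewrite expr2.
  by apply: cvgM; apply: cvgB => //; exact: cvg_cst.
have E_cvg t : t <= T -> E n t @[n --> \oo] --> 0.
  apply: (@delayed_recursion_cvg _ E (fun n t => `|c_ n t| ^+ 2) _ _ _
    alpha0 (taud / 2) T _ alpha0_gt0 _ _ E_ge0 E_le E00 a_cvg b_cvg r_cvg).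
  - by rewrite divr_gt0.
  - by move=> n s; exact: sqr_ge0.
  - move=> n s s_in; have [_ _ _ _ [_ _ _ HE]] := H_ n.
    by rewrite -boundE; exact: HE.
have bound_cvg : bound n T @[n --> \oo] --> 0.
  rewrite (funext (boundE^~ T)).
  rewrite -[X in _ --> X](_ : 0 * 0 + 2 * L1 ^+ 2 * ((m + 1) * (2 * m)) * 0 + 0 = 0); last by ring.
  apply: cvgD => //; apply: cvgD; first by apply: cvgM => //; exact: E_cvg.
  by apply: cvgM => //; apply: E_cvg; rewrite gerBl divr_ge0 ?ltW.
(* Makes the pointwise estimate of [c_ n t] uniform in [t], as the supremum norm requires. *)
have bound_le n t : t <= T -> bound n t <= bound n T.
  move=> tT; rewrite !boundE lerD2r; apply: lerD; apply: ler_wpM2l.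
  - by rewrite !mulr_ge0 ?sqr_ge0// ltW.
  - exact: E_le.
  - by rewrite !mulr_ge0 ?sqr_ge0// ltW.
  - by apply: E_le; rewrite lerD2r.
have G0 : 0 <= G by rewrite /G fine_ge0// integral_ge0.
have bound_ge0 n : 0 <= bound n T.
  have K0 : 0 <= 2 * L1 ^+ 2 by rewrite mulr_ge0// sqr_ge0.
  have M0' : 0 <= M n by exact: ltW.
  rewrite boundE; apply: addr_ge0; first apply: addr_ge0.
  - by apply: mulr_ge0 => //; apply: mulr_ge0 => //; apply: mulr_ge0 => //; exact: mulr_ge0.
  - by apply: mulr_ge0 => //; apply: mulr_ge0 => //; apply: mulr_ge0 => //; exact: mulr_ge0.
  - apply: mulr_ge0 => //; apply: addr_ge0.
      by apply: mulr_ge0 => //; exact: mulr_ge0.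
    by apply: mulr_ge0 => //; exact: sqr_ge0.
split.
  (* Bounds the square of the norm in [W(0, T)]: the energy of the difference plus the estimate of
     its time derivative. *)
  pose z n := E n T + (2 * bound n T + 2 * (L0 ^+ 2 * E n T)).
  have z_cvg : z n @[n --> \oo] --> 0.
    rewrite -[X in _ --> X](_ : 0 + (2 * 0 + 2 * (L0 ^+ 2 * 0)) = 0); last by ring.
    apply: cvgD; first exact: E_cvg.
    apply: cvgD; first exact: cvgMr.
    by apply: cvgMr; apply: cvgMr; exact: E_cvg.
  apply: (cvge0_squeeze _ _ (cvg_sqrt0 z_cvg)) => n.
    by rewrite poweR_ge0.
  apply: W_norm_le.
    apply: addr_ge0 => //; apply: addr_ge0; apply: mulr_ge0 => //.
    by apply: mulr_ge0 => //; exact: sqr_ge0.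
  have [_ _ _ _ [_ hu hdt _]] := H_ n.
  by rewrite /z EFinD; exact: leeD.
have s_cvg : alpha0^-1 * bound n T @[n --> \oo] --> 0.
  by rewrite -[X in _ --> X](mulr0 alpha0^-1); exact: cvgMr.
apply: (cvge0_squeeze _ _ (cvg_sqrt0 s_cvg)) => n.
  exact: C_norm_ge0.
apply: C_norm_le => t t_in.
have [_ _ _ c0 [cE _ _ HE]] := H_ n.
rewrite cE//; have /andP[t0 tT] := t_in.
(* The energy estimate is stated for [t > 0]; at 0 the difference vanishes because the initial value
   is common. *)
have [->|tn0] := eqVneq t 0; first by rewrite c0 normr0 sqrtr_ge0.
rewrite -[leLHS]ger0_norm// -sqrtr_sqr ler_wsqrtr//.
have {}t0 : 0 < t by rewrite lt_neqAle eq_sym tn0.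
have ht : 0 < t <= T by rewrite t0.
apply: (@le_trans _ _ (alpha0^-1 * bound n t)).
  apply: le_trans (HE t ht).
  by rewrite lerDl; apply: mulr_ge0; [exact: ltW|exact: energy_before_ge0].
by rewrite ler_pM2l ?invr_gt0//; exact: bound_le.
Unshelve. all: by end_near. Qed.
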